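(* Work over $\overline{\mathbb{Q}}$, and for a finite group $\Gamma$ let $\mathcal{A}_3(\Gamma)\subset\mathcal{M}_3$ be the set of conjugacy classes of degree $3$ endomorphisms of $\mathbb{P}^1$ whose automorphism group contains a subgroup isomorphic to $\Gamma$. Then: (1) $\mathcal{A}_3(C_4)=\mathcal{A}_3(D_4)$, and this locus is a single conjugacy class in $\mathcal{M}_3$, given by $f(z)=\frac{1}{z^3}$. (2) $\mathcal{A}_3(\mathfrak{A}_4)$ is a single conjugacy class in $\mathcal{M}_3$, given by $f(z)=\frac{z^3-3}{-3z^2}$. This single conjugacy class is exactly the intersection $\mathcal{A}_3(C_2)\cap\mathcal{A}_3(C_3)$. (3) $\mathcal{A}_3(C_3)$ is an irreducible curve in $\mathcal{M}_3$, given by the family $f_a(z)=\frac{z^3+a}{az^2}$, $a\neq 0$. (4) $\mathcal{A}_3(D_2)$ consists of two irreducible curves, given by the families $f_a(z)=\frac{az^2+1}{z^3+az}$, $a\neq\pm1$, and $g_a(z)=\frac{az^2-1}{z^3-az}$, $a\neq\pm1$, which intersect at the single point $\mathcal{A}_3(D_4)=\mathcal{A}_3(C_4)$. (5) $\mathcal{A}_3(C_2)$ is the union of two irreducible surfaces, given by the families $f_{a,b}(z)=\frac{z^3+az}{bz^2+1}$, $ab\neq1$, and $g_{a,b}(z)=\frac{az^2+1}{z^3+bz}$, $ab\neq 1$, which intersect in a curve, namely the component of $\mathcal{A}_3(D_2)$ given by the family $\frac{az^2+1}{z^3+az}$, $a\neq\pm1$.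
   Context: $\mathrm{Rat}_d$ is the space of degree $d$ endomorphisms of $\mathbb{P}^1$ (pairs of homogeneous degree $d$ polynomials with no common factor, up to scaling), written in the affine coordinate $z$. $\mathrm{PGL}_2$ acts on it by conjugation, $f^\alpha=\alpha^{-1}\circ f\circ\alpha$; $\mathcal{M}_d=\mathrm{Rat}_d/\mathrm{PGL}_2$ is the (geometric) quotient and $[f]\in\mathcal{M}_d$ is the class of $f$. $\mathrm{Aut}(f)=\{\alpha\in\mathrm{PGL}_2(\overline{\mathbb{Q}}): f^\alpha=f\}$. $C_n$ is the cyclic group of order $n$, $D_n$ the dihedral group of order $2n$, $\mathfrak{A}_4$ the alternating group on $4$ letters. A locus (or component of a locus) is ''given by'' a family of maps if it equals the set of conjugacy classes of the maps in the family, the parameters ranging over all values in $\overline{\mathbb{Q}}$ subject to the stated conditions. *)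

(* Defs.v *)
From HB Require Import structures.
From mathcomp Require Import all_boot all_order all_algebra all_fingroup.
From mathcomp Require Import all_solvable all_field generic_quotient ring.
From mathcomp Require Import mpoly.
From mathcomp Require Import boolp classical_sets topology.

Set Implicit Arguments.
Unset Strict Implicit.
Unset Printing Implicit Defensive.

Import GRing.Theory.

Local Open Scope classical_set_scope.
Local Open Scope quotient_scope.
Local Open Scope ring_scope.

Record GL2 := MkGL2 { GL2_val :> 'M[algC]_2; _ : GL2_val \in unitmx }.
HB.instance Definition _ := [isSub for GL2_val].
HB.instance Definition _ := [Choice of GL2 by <:].

Lemma GL2_unit (A : GL2) : (A : 'M_2) \in unitmx.
Proof. by case: A. Qed.

Definition GL2_one : GL2 := MkGL2 (unitmx1 algC 2).

Fact GL2_mul_subproof (A B : GL2) : (A : 'M_2) *m B \in unitmx.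
Proof. by rewrite unitmx_mul !GL2_unit. Qed.
Definition GL2_mul (A B : GL2) : GL2 := MkGL2 (GL2_mul_subproof A B).

Fact GL2_inv_subproof (A : GL2) : invmx (A : 'M_2) \in unitmx.
Proof. by rewrite unitmx_inv GL2_unit. Qed.
Definition GL2_inv (A : GL2) : GL2 := MkGL2 (GL2_inv_subproof A).

Definition GL2_scal_rel (A B : GL2) : bool :=
  `[< exists2 c : algC, c != 0 & (B : 'M_2) = c *: (A : 'M_2) >].

Fact GL2_scal_rel_equiv :
  [/\ reflexive GL2_scal_rel, ssrbool.symmetric GL2_scal_rel
    & transitive GL2_scal_rel].
Proof.
have sym A B : GL2_scal_rel A B -> GL2_scal_rel B A.
  move=> /asboolP[c c0 e]; apply/asboolP; exists c^-1; first by rewrite invr_eq0.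
  by rewrite e scalerA mulVf // scale1r.
split=> [A|A B|B A C].
- by apply/asboolP; exists 1; rewrite ?oner_eq0 // scale1r.
- by apply/idP/idP; apply: sym.
- move=> /asboolP[c c0 eB] /asboolP[e e0 eC]; apply/asboolP.
  by exists (e * c); [rewrite mulf_neq0 | rewrite eC eB scalerA].
Qed.

Canonical GL2_scal_equiv :=
  EquivRel GL2_scal_rel (let: And3 r _ _ := GL2_scal_rel_equiv in r)
    (let: And3 _ s _ := GL2_scal_rel_equiv in s)
    (let: And3 _ _ t := GL2_scal_rel_equiv in t).

Definition PGL2 := {eq_quot GL2_scal_equiv}.
HB.instance Definition _ := Choice.on PGL2.
HB.instance Definition _ := EqQuotient.on PGL2.

Lemma PGL2_eqP (A B : GL2) :
  \pi_PGL2 A = \pi_PGL2 B <-> exists2 c : algC, c != 0 & (B : 'M_2) = c *: (A : 'M_2).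
Proof.
split; first by move=> /eqP; rewrite piE => /asboolP.
by move=> h; apply/eqP; rewrite piE; apply/asboolP.
Qed.

Lemma PGL2_repr (A : GL2) :
  exists2 c : algC, c != 0 & (repr (\pi_PGL2 A) : 'M_2) = c *: (A : 'M_2).
Proof. by apply/PGL2_eqP; rewrite reprK. Qed.

Definition PGL2_one : PGL2 := \pi_PGL2 GL2_one.
Definition PGL2_mul (x y : PGL2) : PGL2 := \pi_PGL2 (GL2_mul (repr x) (repr y)).
Definition PGL2_inv (x : PGL2) : PGL2 := \pi_PGL2 (GL2_inv (repr x)).

Lemma PGL2_mulE (A B : GL2) :
  PGL2_mul (\pi_PGL2 A) (\pi_PGL2 B) = \pi_PGL2 (GL2_mul A B).
Proof.
apply/esym/PGL2_eqP.
have [a a0 /= ->] := PGL2_repr A; have [b b0 /= ->] := PGL2_repr B.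
exists (a * b); first by rewrite mulf_neq0.
by rewrite -scalemxAl -scalemxAr scalerA.
Qed.

Lemma PGL2_invE (A : GL2) : PGL2_inv (\pi_PGL2 A) = \pi_PGL2 (GL2_inv A).
Proof.
apply/esym/PGL2_eqP; have [a a0 /= ->] := PGL2_repr A.
exists a^-1; first by rewrite invr_eq0.
by rewrite invmxZ ?unitmxZ ?unitfE ?GL2_unit.
Qed.

Fact PGL2_mulA : associative PGL2_mul.
Proof.
elim/quotW=> A; elim/quotW=> B; elim/quotW=> C.
rewrite (PGL2_mulE B C) (PGL2_mulE A B) !PGL2_mulE.
by apply: (congr1 \pi_PGL2); apply: val_inj; rewrite /= mulmxA.
Qed.

Fact PGL2_mul1 : left_id PGL2_one PGL2_mul.
Proof.
elim/quotW=> A; rewrite PGL2_mulE.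
by apply: (congr1 \pi_PGL2); apply: val_inj; rewrite /= mul1mx.
Qed.

Fact PGL2_mulr1 : right_id PGL2_one PGL2_mul.
Proof.
elim/quotW=> A; rewrite PGL2_mulE.
by apply: (congr1 \pi_PGL2); apply: val_inj; rewrite /= mulmx1.
Qed.

Fact PGL2_mulV : left_inverse PGL2_one PGL2_inv PGL2_mul.
Proof.
elim/quotW=> A; rewrite PGL2_invE PGL2_mulE.
by apply: (congr1 \pi_PGL2); apply: val_inj; rewrite /= mulVmx // GL2_unit.
Qed.

Fact PGL2_mulrV : right_inverse PGL2_one PGL2_inv PGL2_mul.
Proof.
elim/quotW=> A; rewrite PGL2_invE PGL2_mulE.
by apply: (congr1 \pi_PGL2); apply: val_inj; rewrite /= mulmxV // GL2_unit.
Qed.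

HB.instance Definition _ := isGroup.Build PGL2
  PGL2_mulA PGL2_mul1 PGL2_mulr1 PGL2_mulV PGL2_mulrV.

Notation form2 := {mpoly algC[2]}.

Definition X : form2 := 'X_0.
Definition Y : form2 := 'X_1.

Definition common_factor (h : form2) (f : form2 * form2) :=
  (exists q, f.1 = h * q) /\ (exists q, f.2 = h * q).

(* The pair (F, G) stands for the map (X : Y) |-> (F(X, Y) : G(X, Y)), i.e.
   z |-> F(z, 1) / G(z, 1) in the affine coordinate z = X / Y.  The units of
   {mpoly algC[2]} are the nonzero constants. *)
Definition is_endo (d : nat) (f : form2 * form2) : Prop :=
  [/\ f.1 \is d.-homog, f.2 \is d.-homog
    & forall h, common_factor h f -> h \is a GRing.unit].

Record endo_lift (d : nat) :=
  EndoLift { lift_val :> form2 * form2; _ : `[< is_endo d lift_val >] }.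
HB.instance Definition _ d := [isSub for @lift_val d].
HB.instance Definition _ d := [Choice of endo_lift d by <:].

Lemma endo_liftP d (f : endo_lift d) : is_endo d f.
Proof. by case: f => f /= /asboolP. Qed.

Definition mk_lift d f (h : is_endo d f) : endo_lift d := EndoLift (asboolT h).

Definition lift_scal_rel d (f g : endo_lift d) : bool :=
  `[< exists2 c : algC, c != 0 & lift_val g = (c *: f.1, c *: f.2) >].

Fact lift_scal_rel_equiv d :
  [/\ reflexive (@lift_scal_rel d), ssrbool.symmetric (@lift_scal_rel d)
    & transitive (@lift_scal_rel d)].
Proof.
have sym f g : @lift_scal_rel d f g -> @lift_scal_rel d g f.
  move=> /asboolP[c c0 e]; apply/asboolP; exists c^-1; first by rewrite invr_eq0.
  by rewrite e /= !scalerA mulVf // !scale1r -surjective_pairing.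
split=> [f|f g|g f h].
- by apply/asboolP; exists 1; rewrite ?oner_eq0 // !scale1r -surjective_pairing.
- by apply/idP/idP; apply: sym.
- move=> /asboolP[c c0 eg] /asboolP[e e0 eh]; apply/asboolP.
  by exists (e * c); [rewrite mulf_neq0 | rewrite eh eg /= !scalerA].
Qed.

Canonical lift_scal_equiv d :=
  EquivRel (@lift_scal_rel d) (let: And3 r _ _ := lift_scal_rel_equiv d in r)
    (let: And3 _ s _ := lift_scal_rel_equiv d in s)
    (let: And3 _ _ t := lift_scal_rel_equiv d in t).

Definition RatMap (d : nat) := {eq_quot (@lift_scal_equiv d)}.
HB.instance Definition _ d := Choice.on (RatMap d).
HB.instance Definition _ d := EqQuotient.on (RatMap d).

Lemma RatMap_eqP d (f g : endo_lift d) :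
  \pi_(RatMap d) f = \pi_(RatMap d) g <->
  exists2 c : algC, c != 0 & lift_val g = (c *: f.1, c *: f.2).
Proof.
split; first by move=> /eqP; rewrite piE => /asboolP.
by move=> h; apply/eqP; rewrite piE; apply/asboolP.
Qed.

Lemma RatMap_repr d (f : endo_lift d) :
  exists2 c : algC, c != 0 & lift_val (repr (\pi_(RatMap d) f)) = (c *: f.1, c *: f.2).
Proof. by apply/RatMap_eqP; rewrite reprK. Qed.

Definition lin_forms (A : 'M[algC]_2) : 2.-tuple form2 :=
  [tuple \sum_(j < 2) A i j *: 'X_j | i < 2].

Definition precomp (f : form2 * form2) (A : 'M[algC]_2) : form2 * form2 :=
  (f.1 \mPo lin_forms A, f.2 \mPo lin_forms A).

Definition postcomp (B : 'M[algC]_2) (f : form2 * form2) : form2 * form2 :=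
  (B 0 0 *: f.1 + B 0 1 *: f.2, B 1 0 *: f.1 + B 1 1 *: f.2).

Definition conj_pair (f : form2 * form2) (A : 'M[algC]_2) : form2 * form2 :=
  postcomp (invmx A) (precomp f A).

Lemma comp_lin_formsM (p : form2) A B :
  (p \mPo lin_forms A) \mPo lin_forms B = p \mPo lin_forms (A *m B).
Proof.
rewrite (comp_mpolyEX p (lin_forms A)) (comp_mpolyEX p (lin_forms (A *m B))) raddf_sum /=; apply: eq_bigr => m _.
rewrite comp_mpolyZ; congr (_ *: _).
rewrite !comp_mpolyX rmorph_prod /=; apply: eq_bigr => i _.
rewrite rmorphXn /= !tnth_mktuple raddf_sum /=; congr (_ ^+ _).
under eq_bigr => j _.
  rewrite comp_mpolyZ comp_mpolyXU -tnth_nth tnth_mktuple scaler_sumr; over.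
rewrite exchange_big /=; apply: eq_bigr => k _.
rewrite mxE scaler_suml; apply: eq_bigr => j _.
by rewrite scalerA.
Qed.

Lemma comp_lin_forms1 (p : form2) : p \mPo lin_forms 1%:M = p.
Proof.
rewrite -[RHS]comp_mpoly_id; congr (_ \mPo _); apply: eq_from_tnth => i.
rewrite !tnth_mktuple (bigD1 i) //= big1 => [|j ji]; rewrite mxE.
  by rewrite eqxx scale1r addr0.
by rewrite eq_sym (negPf ji) scale0r.
Qed.

Lemma mulmx2E (A B : 'M[algC]_2) i j :
  (A *m B) i j = A i 0 * B 0 j + A i 1 * B 1 j.
Proof.
rewrite mxE big_ord_recl big_ord1.
by have -> : lift ord0 ord0 = 1 :> 'I_2 by apply: val_inj.
Qed.

Lemma postcompM A B f : postcomp A (postcomp B f) = postcomp (A *m B) f.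
Proof.
rewrite /postcomp /= !mulmx2E.
by congr pair; rewrite !scalerDr !scalerDl !scalerA addrACA.
Qed.

Lemma postcomp1 f : postcomp 1%:M f = f.
Proof.
by case: f => F G; rewrite /postcomp /= !mxE /= !scale1r !scale0r addr0 add0r.
Qed.

Lemma precomp_post A B f : precomp (postcomp B f) A = postcomp B (precomp f A).
Proof. by rewrite /precomp /postcomp /= !comp_mpolyD !comp_mpolyZ. Qed.

Lemma precompM A B f : precomp (precomp f A) B = precomp f (A *m B).
Proof. by rewrite /precomp /= !comp_lin_formsM. Qed.

Lemma precomp1 f : precomp f 1%:M = f.
Proof. by case: f => F G; rewrite /precomp /= !comp_lin_forms1. Qed.

Lemma comp_lin_homog d (p : form2) A :
  p \is d.-homog -> p \mPo lin_forms A \is d.-homog.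
Proof.
move=> /dhomogP hp; rewrite comp_mpolyEX big_seq; apply: rpred_sum => m /hp <-.
apply: rpredZ; rewrite comp_mpolyX.
rewrite /= mdegE.
elim/big_rec2: _ => [|i k q _ hq]; first exact: dhomog1.
apply: dhomogM => //; rewrite -[X in X.-homog]mul1n; apply: dhomogMn.
rewrite tnth_mktuple; apply: rpred_sum => j _; apply: rpredZ.
by rewrite dhomogX /= mdeg1.
Qed.

Lemma common_factor_post h B f : common_factor h f -> common_factor h (postcomp B f).
Proof.
move=> [[p fp] [q fq]]; rewrite /common_factor /postcomp /= fp fq.
split; [exists (B 0 0 *: p + B 0 1 *: q) | exists (B 1 0 *: p + B 1 1 *: q)];
  by rewrite mulrDr -!scalerAr.
Qed.

Lemma common_factor_pre h A f :
  common_factor h f -> common_factor (h \mPo lin_forms A) (precomp f A).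
Proof.
move=> [[p fp] [q fq]]; rewrite /common_factor /precomp /= fp fq.
by split; [exists (p \mPo lin_forms A) | exists (q \mPo lin_forms A)];
  rewrite rmorphM.
Qed.

Fact conj_pair_endo d (f : endo_lift d) (A : GL2) : is_endo d (conj_pair f A).
Proof.
have [h1 h2 hc] := endo_liftP f; split=> [||h].
- by apply: rpredD; apply: rpredZ; apply: comp_lin_homog.
- by apply: rpredD; apply: rpredZ; apply: comp_lin_homog.
move=> /(common_factor_post A); rewrite postcompM mulmxV ?GL2_unit // postcomp1.
move=> /(common_factor_pre (invmx A)).
rewrite precompM mulmxV ?GL2_unit // precomp1 => /hc hu.
rewrite -[h]comp_lin_forms1 -(mulVmx (GL2_unit A)) -comp_lin_formsM.
exact: (rmorph_unit (comp_mpoly (lin_forms A))).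
Qed.

Definition lift_conj d (f : endo_lift d) (A : GL2) : endo_lift d :=
  mk_lift (conj_pair_endo f A).

Definition rat_conj d (f : RatMap d) (x : PGL2) : RatMap d :=
  \pi_(RatMap d) (lift_conj (repr f) (repr x)).

Lemma comp_linZ d (p : form2) c A :
  p \is d.-homog -> p \mPo lin_forms (c *: A) = c ^+ d *: (p \mPo lin_forms A).
Proof.
move=> /dhomogP hp; rewrite !comp_mpolyEX scaler_sumr !big_seq.
apply: eq_bigr => m /hp <-; rewrite scalerA mulrC -scalerA; congr (_ *: _).
rewrite /= mdegE.
rewrite !comp_mpolyX -prodrXr -scaler_prod; apply: eq_bigr => i _.
rewrite -exprZn; congr (_ ^+ _); rewrite !tnth_mktuple scaler_sumr.
by apply: eq_bigr => j _; rewrite mxE scalerA.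
Qed.

Lemma rat_conjE d (f : endo_lift d) (A : GL2) :
  rat_conj (\pi_(RatMap d) f) (\pi_PGL2 A) = \pi_(RatMap d) (lift_conj f A).
Proof.
apply/esym/RatMap_eqP; have [a a0 ea] := PGL2_repr A.
have [c c0 ec] := RatMap_repr f; have [h1 h2 _] := endo_liftP f.
exists (a^-1 * (a ^+ d * c)); first by rewrite !mulf_neq0 ?invr_eq0 ?expf_neq0.
rewrite /lift_conj /= /conj_pair ea ec /precomp /= !comp_mpolyZ !(comp_linZ _ _ h1).
rewrite !(comp_linZ _ _ h2) invmxZ ?unitmxZ ?unitfE ?GL2_unit //.
rewrite /postcomp /= !mxE !scalerDr !scalerA.
by congr pair; congr (_ *: _ + _ *: _); ring.
Qed.

Lemma rat_conj1 d (f : RatMap d) : rat_conj f 1%g = f.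
Proof.
elim/quotW: f => f; rewrite [1%g](_ : _ = \pi_PGL2 GL2_one) // rat_conjE.
apply: (congr1 \pi_(RatMap d)); apply: val_inj.
by rewrite /= /conj_pair invmx1 precomp1 postcomp1.
Qed.

Lemma rat_conjM d (f : RatMap d) (x y : PGL2) :
  rat_conj f (x * y)%g = rat_conj (rat_conj f x) y.
Proof.
elim/quotW: f => f; elim/quotW: x => A; elim/quotW: y => B.
rewrite [(_ * _)%g](PGL2_mulE A B) (rat_conjE f A) !rat_conjE; apply: (congr1 \pi_(RatMap d)); apply: val_inj.
rewrite /= /conj_pair precomp_post postcompM precompM.
by rewrite [invmx (_ *m _)]invrM ?GL2_unit.
Qed.

Definition rat_Aut d (f : RatMap d) : set PGL2 := [set x | rat_conj f x = f].

(* Homogeneous coordinates of f in P^(2d+1): the coefficients of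
   X^j Y^(d-j), 0 <= j <= d, in the numerator and then in the denominator. *)
Definition coords d (f : endo_lift d) : 'rV[algC]_(d.+1 + d.+1) :=
  let mon (j : 'I_d.+1) := [multinom (if i == 0%R then val j else d - j)%N | i < 2] in
  row_mx (\row_j f.1@_(mon j)) (\row_j f.2@_(mon j)).

Definition zeros d (S : set {mpoly algC[d.+1 + d.+1]}) : set (RatMap d) :=
  [set f | forall P, S P -> P.@[coords (repr f) 0] = 0].

Definition zariski_closed d (Z : set (RatMap d)) : Prop :=
  exists S : set {mpoly algC[d.+1 + d.+1]},
    (forall P, S P -> exists k, P \is k.-homog) /\ Z = zeros S.

Definition zariski_open d (U : set (RatMap d)) : Prop := zariski_closed (~` U).

Fact zariski_openT d : zariski_open [set: RatMap d].
Proof.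
exists [set 1]; split=> [_ ->|]; first by exists 0%N; apply: dhomog1.
apply/seteqP; split=> [f []|f /(_ 1 erefl)]; first exact.
by rewrite meval1 => /eqP; rewrite oner_eq0.
Qed.

Fact zariski_openI d : setI_closed (@zariski_open d).
Proof.
move=> U V [S [hS eS]] [T [hT eT]].
exists [set P | exists Q R, [/\ S Q, T R & P = Q * R]]; split.
  move=> _ [Q [R [/hS[k hk] /hT[l hl] ->]]].
  by exists (k + l)%N; apply: dhomogM.
rewrite setCI eS eT; apply/seteqP; split=> f /=.
  move=> h _ [Q [R [SQ TR ->]]]; rewrite mevalM.
  by case: h => [/(_ _ SQ)|/(_ _ TR)] ->; rewrite ?mul0r ?mulr0.
move=> h; have [|/existsNP[Q /not_implyP[SQ Q0]]] := pselect (zeros S f).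
  by left.
right=> R TR; have /eqP := h _ (ex_intro _ Q (ex_intro _ R (And3 SQ TR erefl))).
by rewrite mevalM mulf_eq0 => /orP[/eqP //|/eqP].
Qed.

Fact zariski_open_bigU d (I : Type) (U : I -> set (RatMap d)) :
  (forall i, zariski_open (U i)) -> zariski_open (\bigcup_i U i).
Proof.
move=> hU.
exists [set P | exists i S, [/\ forall P, S P -> exists k, P \is k.-homog,
  ~` U i = zeros S & S P]]; split.
  by move=> P [i [S [hS _ /hS]]].
apply/seteqP; split=> f /=.
  move=> nU P [i [S [_ eS SP]]].
  have : (~` U i) f by move=> Uf; apply: nU; exists i.
  by rewrite eS; apply.
move=> h [i _]; have [S [hS eS]] := hU i.
suff : (~` U i) f by [].
by rewrite eS => P SP; apply: h; exists i, S.
Qed.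

HB.instance Definition _ d := isOpenTopological.Build (RatMap d)
  (@zariski_openT d) (@zariski_openI d) (@zariski_open_bigU d).

Lemma RatMap_closedE d (Z : set (RatMap d)) : closed Z <-> zariski_closed Z.
Proof. by rewrite -openC; rewrite /open /= /zariski_open setCK. Qed.

Definition conj_rel d (f g : RatMap d) : bool := `[< exists x, g = rat_conj f x >].

Fact conj_rel_equiv d :
  [/\ reflexive (@conj_rel d), ssrbool.symmetric (@conj_rel d)
    & transitive (@conj_rel d)].
Proof.
have sym f g : @conj_rel d f g -> @conj_rel d g f.
  move=> /asboolP[x ->]; apply/asboolP; exists x^-1%g.
  by rewrite -rat_conjM mulgV rat_conj1.
split=> [f|f g|g f h].
- by apply/asboolP; exists 1%g; rewrite rat_conj1.
- by apply/idP/idP; apply: sym.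
- by move=> /asboolP[x ->] /asboolP[y ->]; apply/asboolP; exists (x * y)%g; rewrite rat_conjM.
Qed.

Canonical conj_equiv d :=
  EquivRel (@conj_rel d) (let: And3 r _ _ := conj_rel_equiv d in r)
    (let: And3 _ s _ := conj_rel_equiv d in s)
    (let: And3 _ _ t := conj_rel_equiv d in t).

(* The underlying space of a geometric quotient is the orbit space with the
   quotient topology, so this is M_d with its Zariski topology. *)
Definition Moduli (d : nat) := quotient_topology {eq_quot (@conj_equiv d)}.
HB.instance Definition _ d := Topological.on (Moduli d).
HB.instance Definition _ d := Quotient.on (Moduli d).

Definition rat_class d (f : RatMap d) : Moduli d := \pi_(Moduli d) f.

Lemma rat_classP d (f g : RatMap d) : rat_class f = rat_class g <-> exists x, g = rat_conj f x.
Proof.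
split; first by move=> /eqmodP/asboolP.
by move=> h; apply/eqmodP/asboolP.
Qed.

Lemma Moduli_closedE d (Z : set (Moduli d)) :
  closed Z <-> zariski_closed (@rat_class d @^-1` Z).
Proof. by rewrite -RatMap_closedE -!openC preimage_setC. Qed.

(* Classes of the maps whose automorphism group contains a subgroup isomorphic
   to G, namely the image of an injective morphism G -> PGL_2 *)
Definition autlocus d (gT : finGroupType) (G : {group gT}) : set (Moduli d) :=
  [set m | exists2 f : RatMap d, m = rat_class f &
     exists phi : gT -> PGL2,
       [/\ {in G &, {morph phi : x y / (x * y)%g}},
           {in G &, injective phi}
         & forall x, x \in G -> rat_Aut f (phi x)]].

Arguments autlocus : clear implicits.
Arguments autlocus d {gT} G _ : rename.

Section Dimension.
Context {T : topologicalType}.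
Implicit Types Z : set T.

Definition irreducible_closed Z : Prop :=
  [/\ closed Z, Z !=set0
    & forall A B : set T, closed A -> closed B ->
        Z `<=` A `|` B -> Z `<=` A \/ Z `<=` B].

Definition has_chain Z (n : nat) : Prop :=
  exists C : nat -> set T,
    (forall i, (i <= n)%N -> irreducible_closed (C i) /\ C i `<=` Z) /\
    (forall i, (i < n)%N -> C i `<` C i.+1).

Definition krull_dim Z (n : nat) : Prop := has_chain Z n /\ ~ has_chain Z n.+1.

Definition irreducible_curve Z : Prop := irreducible_closed Z /\ krull_dim Z 1.
Definition irreducible_surface Z : Prop := irreducible_closed Z /\ krull_dim Z 2.

End Dimension.

Definition class_of_pair d (F : form2 * form2) (m : Moduli d) : Prop :=
  exists2 f : endo_lift d, lift_val f = F & m = rat_class (\pi_(RatMap d) f).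

Definition given_by d (I : Type) (L : set (Moduli d)) (D : set I)
    (F : I -> form2 * form2) : Prop :=
  (forall t, D t -> is_endo d (F t)) /\
  L = [set m | exists2 t, D t & class_of_pair (F t) m].

(* Main.v *)
(* A linear automorphism A of a cubic map f cannot be unipotent, and if it is
   diagonal then comparing coefficients shows that it has order 2, 3 or 4 and
   leaves one of four normal forms for f.  In order 2, with A^2 = s, one has
   f(Av) = s A f(v) or f(Av) = - s A f(v): these two types of involutions give
   the two surfaces, order 3 gives the curve of (3) and order 4 gives 1/z^3.
   The product of anticommuting involutions of types e, e' has type -ee', so a
   four-group of automorphisms has types (+,+,-) or (-,-,-), which gives the two
   curves of (4).  Involutions A, B of opposite types are never conjugate, so AB
   cannot have order 3; hence they commute in PGL_2 or AB has order 4, which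
   yields all the intersections.  Conversely, maps with large automorphism
   groups are recognized by the permutations of four points of P^1.

   The parametrizations of the loci are closed maps to M_3: the fixed lines of
   the automorphism range over P^1 x P^1 and are eliminated by two resultants.
   The dimension of a surface is at most 2, because a closed set properly
   contained in it pulls back into a plane curve h = 0, which is irreducible if
   h has minimal degree, and then meets any further hypersurface in finitely
   many points. *)

Require Import Defs.
From mathcomp Require Import all_boot all_order all_algebra all_fingroup.
From mathcomp Require Import all_solvable all_field generic_quotient ring zify.
From mathcomp Require Import mpoly.
From mathcomp Require Import boolp classical_sets topology.

Set Implicit Arguments.
Unset Strict Implicit.
Unset Printing Implicit Defensive.

Import GRing.Theory Num.Theory.

Local Open Scope classical_set_scope.
Local Open Scope quotient_scope.
Local Open Scope ring_scope.

(** * Elimination over the projective line *)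

(** The obstacle is topological. A locus is closed in [Moduli] only if its preimage in the
    coefficient space is cut out by homogeneous equations, and the dimension bounds need more: every
    closed subset of the parameter space must have a closed image. A class lies in such an image
    when some frame of two lines brings the map to a normal form with constrained parameters, but
    frames do not form a complete variety, since the two lines may collide. Replacing the inverse of
    the frame g by its adjugate cures this: A = g diag(om, 1) adj(g) satisfies f(Av) = la det(g)^2 A
    f(v), an equation polynomial in all the data, and a collision would make f vanish at a nonzero
    vector. The condition is therefore closed over pairs of lines, and completeness of the
    projective line applies twice. Closedness is phrased by separating polynomials over an abstract
    ring of functions, so that elimination can be iterated. The points that start the chains for the
    lower bounds on dimensions are closed as intersections of loci already known to be closed. *)

Lemma exists_nonroot (p : {poly algC}) : p != 0 -> exists c, p.[c] != 0.
Proof.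
move=> p0; apply: contrapT => h.
have h' c : root p c by apply/negPn/negP => hc; apply: h; exists c.
have : uniq [seq i%:R : algC | i <- iota 0 (size p)].
  rewrite map_inj_in_uniq ?iota_uniq // => i j _ _ /eqP.
  by rewrite eqr_nat => /eqP.
have rs : all (root p) [seq i%:R : algC | i <- iota 0 (size p)] by apply/allP => c _.
by move=> /(max_poly_roots p0 rs); rewrite size_map size_iota ltnn.
Qed.

(** Here [d] and [e] are formal degrees, which may exceed the true ones. The coefficient of index
    [d] is the value at infinity of a binary form of degree [d], and such values multiply. *)
Lemma coefM_top (R : nzRingType) (p q : {poly R}) d e :
  (size p <= d.+1)%N -> (size q <= e.+1)%N -> (p * q)`_(d + e) = p`_d * q`_e.
Proof.
move=> sp sq; rewrite coefM (bigD1 (inord d)) //= inordK ?ltnS ?leq_addr //.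
rewrite addKn big1 ?addr0 // => i ne.
have {}ne : nat_of_ord i != d.
  by apply: contraNneq ne => e'; apply/eqP/val_inj; rewrite /= inordK ?ltnS ?leq_addr.
case: (ltngtP i d) ne => // h _.
  by rewrite [q`__]nth_default ?mulr0 //; apply: leq_trans sq _; rewrite ltn_subRL ltn_add2r.
by rewrite [p`__]nth_default ?mul0r // (leq_trans sp).
Qed.

Lemma size_mul_top (R : nzRingType) (p q : {poly R}) d e :
  (size p <= d.+1)%N -> (size q <= e.+1)%N -> (size (p * q)%R <= (d + e).+1)%N.
Proof.
move=> sp sq; apply: leq_trans (size_polyMleq _ _) _.
by rewrite -subn1 leq_subLR (leq_trans (leq_add sp sq)) // addSn addnS.
Qed.

Lemma size_exp_top (R : nzRingType) (p : {poly R}) d n :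
  (size p <= d.+1)%N -> (size (p ^+ n)%R <= (n * d).+1)%N.
Proof.
move=> sp; elim: n => [|n IH]; first by rewrite expr0 size_poly1.
by rewrite exprS mulSn; apply: size_mul_top.
Qed.

Lemma coefX_top (R : nzRingType) (p : {poly R}) d n :
  (size p <= d.+1)%N -> (p ^+ n)`_(n * d) = p`_d ^+ n.
Proof.
move=> sp; elim: n => [|n IH]; first by rewrite expr0 coef1.
by rewrite exprS mulSn coefM_top ?IH ?exprS // size_exp_top.
Qed.

Section Elimination.
Variables (R : comNzRingType) (Y : Type) (ev : Y -> {rmorphism R -> algC}).

(** Zariski closedness of [Z] in [dom], stated point by point: [R] is a ring of functions on [Y] and
    [ev] its evaluation, so neither an ideal nor a topology on [Y] is involved. *)
Definition poly_separated (dom Z : set Y) := forall y, dom y -> ~ Z y ->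
  exists r, (forall z, dom z -> Z z -> ev z r = 0) /\ ev y r != 0.

(** Adjoins one affine coordinate to [Y]. In iterated use the outermost polynomial variable is the
    first component of the point. *)
Definition ev_poly (ty : algC * Y) : {rmorphism {poly R} -> algC} :=
  horner_eval ty.1 \o map_poly (ev ty.2).

Lemma ev_polyE t y p : ev_poly (t, y) p = (map_poly (ev y) p).[t].
Proof. by []. Qed.

Lemma ev_polyC t y c : ev_poly (t, y) c%:P = ev y c.
Proof. by rewrite ev_polyE map_polyC hornerC. Qed.

Lemma ev_polyX t y : ev_poly (t, y) 'X = t.
Proof. by rewrite ev_polyE map_polyX hornerX. Qed.

Lemma map_resultant_ev (f : {rmorphism R -> algC}) p q :
    f (lead_coef p) != 0 -> f (lead_coef q) != 0 ->
  f (resultant p q) = resultant (map_poly f p) (map_poly f q).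
Proof.
move=> nz_fp nz_fq; rewrite /resultant /Sylvester_mx !size_map_poly_id0 //.
rewrite -det_map_mx /= map_col_mx; congr (\det (col_mx _ _));
  by apply: map_lin1_mx => v; rewrite map_poly_rV rmorphM /= map_rVpoly.
Qed.

End Elimination.

Section ProjectiveLine.
Variables (R : comNzRingType) (Y : Type) (ev : Y -> {rmorphism R -> algC}).
Variables (dom : set Y) (T : set (algC * (algC * Y))).
Hypothesis Tscale : forall (c s t : algC) y, c != 0 -> T (s, (t, y)) -> T (c * s, (c * t, y)).
Hypothesis Tclosed : forall (s t : algC) y, (s, t) != (0, 0) -> dom y -> ~ T (s, (t, y)) ->
  exists r : {poly {poly R}},
   (forall (s t : algC) y, (s, t) != (0, 0) -> dom y -> T (s, (t, y)) -> ev_poly (ev_poly ev) (s, (t, y)) r = 0)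
   /\ ev_poly (ev_poly ev) (s, (t, y)) r != 0.

(* A pair (d, p) stands for the binary form t^d p(s / t) of degree d, whose
   value at infinity (s, t) = (1, 0) is the coefficient of index d. *)
Let vform (dp : nat * {poly R}) :=
  [/\ (size dp.2 <= dp.1.+1)%N,
   forall s y, dom y -> T (s, (1, y)) -> (map_poly (ev y) dp.2).[s] = 0
 & forall y, dom y -> T (1, (0, y)) -> ev y dp.2`_dp.1 = 0].

(** [r] is a polynomial in s (outer variable) and t (inner variable); this is its component of total
    degree [d], dehomogenized at t = 1. Its values as a form are [hval]. *)
Let hform (r : {poly {poly R}}) d := \poly_(i < d.+1) r`_i`_(d - i).

Let hval (r : {poly {poly R}}) d s t y :=
  \sum_(i < d.+1) ev y r`_i`_(d - i) * s ^+ i * t ^+ (d - i).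

Lemma hval_sum (r : {poly {poly R}}) : exists N, forall s t y,
  ev_poly (ev_poly ev) (s, (t, y)) r = \sum_(d < N) hval r d s t y.
Proof.
pose n := size r; pose m := \max_(i < n) size (r`_i)%R.
have rz i j : (n <= i)%N || (m <= j)%N -> r`_i`_j = 0.
  have [/(nth_default 0) -> _|ni /= h] := leqP n i; first by rewrite coef0.
  rewrite nth_default //; apply: leq_trans h; exact: (leq_bigmax (Ordinal ni)).
exists (n + m)%N => s t y.
have -> : ev_poly (ev_poly ev) (s, (t, y)) r =
    \sum_(i < n + m) \sum_(j < n + m) ev y r`_i`_j * s ^+ i * t ^+ j.
  rewrite ev_polyE (@horner_coef_wide _ (n + m)); last first.
    by rewrite (leq_trans (size_poly _ _)) // leq_addr.
  apply: eq_bigr => i _; rewrite coef_map /= [X in X * _](@horner_coef_wide _ (n + m)); last first.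
    rewrite (leq_trans (size_poly _ _)) //; apply/leq_sizeP => j hj.
    by rewrite rz // (leq_trans (leq_addl _ _) hj) orbT.
  rewrite mulr_suml; apply: eq_bigr => j _; rewrite coef_map /=.
  by rewrite mulrAC.
rewrite /hval; under [RHS]eq_bigr => d _ do
  rewrite (big_ord_widen_cond (n + m) xpredT (fun i => ev y r`_i`_(d - i) * s ^+ i * t ^+ (d - i))) //=.
rewrite [RHS](exchange_big_dep xpredT) //=; apply: eq_bigr => i _.
rewrite -(big_mkord xpredT (fun j => ev y r`_i`_j * s ^+ i * t ^+ j)).
rewrite -(big_mkord (fun d => (i < d.+1)%N) (fun d => ev y r`_i`_(d - i) * s ^+ i * t ^+ (d - i))).
rewrite [RHS](@big_cat_nat _ _ _ i) //=; last exact/ltnW.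
rewrite [X in _ = X + _]big_nat_cond [X in _ = X + _]big1 ?add0r; last first.
  by move=> j /andP[/andP[_ h1]]; rewrite ltnS leqNgt h1.
rewrite -[X in _ = \sum_(X <= _ < _ | _) _]add0n big_addn.
rewrite [LHS](@big_cat_nat _ _ _ (n + m - i)) ?leq_subr //=.
rewrite [X in _ + X]big_nat_cond [X in _ + X]big1 ?addr0; last first.
  move=> j; rewrite andbT leq_subLR => /andP[h _].
  rewrite rz ?rmorph0 ?mul0r //; have [//|hi] := leqP n i.
  by rewrite -(leq_add2l n) (leq_trans h) // leq_add2r ltnW.
rewrite big_nat_cond [RHS]big_nat_cond; apply: eq_big => j; first by rewrite ltnS leq_addl !andbT.
by rewrite addnK.
Qed.

Lemma hval_scale r d c s t y : hval r d (c * s) (c * t) y = c ^+ d * hval r d s t y.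
Proof.
rewrite /hval mulr_sumr; apply: eq_bigr => i _.
have -> : c ^+ d = c ^+ i * c ^+ (d - i) by rewrite -exprD subnKC // -ltnS.
by rewrite !exprMn; ring.
Qed.

(** As [T] is stable under scaling of (s, t), an equation vanishing on it vanishes along c |-> (cs,
    ct), which is a polynomial in c whose coefficients are the values of the homogeneous components.
    Each component thus vanishes on [T], and one of them is nonzero at the given point. *)
Lemma sep_form s t y : (s, t) != (0, 0) -> dom y -> ~ T (s, (t, y)) ->
  exists r d, (forall (s t : algC) y, (s, t) != (0, 0) -> dom y -> T (s, (t, y)) -> hval r d s t y = 0)
     /\ hval r d s t y != 0.
Proof.
move=> st dy nT; have [r [rT ry]] := Tclosed st dy nT.
have [N rE] := hval_sum r.
have [d hd] : exists d : 'I_N, hval r d s t y != 0.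
  apply: contrapT => h; move/negP: ry; apply; rewrite rE big1 // => d _.
  by apply: contrapT => /eqP h'; apply: h; exists d.
exists r, d; split=> // {s t y st dy nT ry hd} s t y st dy Ty.
pose P := \poly_(i < N) hval r i s t y.
have P0 : P = 0.
  apply/eqP; apply: contraT => Pn.
  (* The factor ['X] keeps [c] away from 0, where [Tscale] says nothing. *)
  have [c /negP[]] : exists c, ('X * P).[c] != 0.
    by apply: exists_nonroot; rewrite mulf_neq0 ?polyX_eq0.
  rewrite hornerM hornerX; have [->|c0] := eqVneq c 0; first by rewrite mul0r.
  rewrite mulf_eq0; apply/orP; right.
  rewrite horner_poly; apply/eqP; rewrite -[RHS](rT (c * s) (c * t) y) ?Tscale //.
    by rewrite rE; apply: eq_bigr => i _; rewrite hval_scale mulrC.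
    by apply: contra st; rewrite !xpair_eqE !mulf_eq0 (negPf c0).
  exact: Tscale.
by have := congr1 (fun p : {poly _} => p`_d) P0; rewrite coef_poly ltn_ord coef0.
Qed.

Lemma hformE r d s y : (map_poly (ev y) (hform r d)).[s] = hval r d s 1 y.
Proof.
rewrite /hval (@horner_coef_wide _ d.+1); last first.
  by rewrite (leq_trans (size_poly _ _)) // size_poly.
by apply: eq_bigr => i _; rewrite coef_map coef_poly ltn_ord expr1n mulr1.
Qed.

Lemma hform_inf r d y : ev y (hform r d)`_d = hval r d 1 0 y.
Proof.
rewrite coef_poly ltnSn subnn /hval big_ord_recr /= subnn expr0 expr1n !mulr1.
rewrite big1 ?add0r // => i _.
by rewrite expr0n subn_eq0 leqNgt ltn_ord mulr0.
Qed.

Lemma hform_vform r d :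
  (forall (s t : algC) y, (s, t) != (0, 0) -> dom y -> T (s, (t, y)) -> hval r d s t y = 0) ->
  vform (d, hform r d).
Proof.
move=> h; split=> [|s y dy Ty|y dy Ty] /=; first exact: size_poly.
- by rewrite hformE h // xpair_eqE oner_eq0 andbF.
- by rewrite hform_inf h // xpair_eqE oner_eq0.
Qed.

Let proj : set Y := [set y | exists s t, (s, t) != (0, 0) /\ T (s, (t, y))].

Lemma sep_aff s y : dom y -> ~ proj y ->
  exists2 dp, vform dp & (map_poly (ev y) dp.2).[s] != 0.
Proof.
move=> dy np; have st : (s, 1 : algC) != (0, 0) by rewrite xpair_eqE oner_eq0 andbF.
have [|r [d [h hy]]] := sep_form st dy; first by move=> h; apply: np; exists s, 1.
by exists (d, hform r d); [apply: hform_vform|rewrite hformE].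
Qed.

Lemma sep_inf y : dom y -> ~ proj y -> exists2 dp, vform dp & ev y dp.2`_dp.1 != 0.
Proof.
move=> dy np; have st : (1 : algC, 0 : algC) != (0, 0) by rewrite xpair_eqE oner_eq0.
have [|r [d [h hy]]] := sep_form st dy; first by move=> h; apply: np; exists 1, 0.
by exists (d, hform r d); [apply: hform_vform|rewrite hform_inf].
Qed.

(** Raising each form to the degree of the other equalizes the degrees, so that combinations are
    again forms. Positive degrees are needed for the powers to vanish where the forms do. *)
Lemma vform_comb dp dq (c : R) : vform dp -> vform dq -> (0 < dp.1)%N -> (0 < dq.1)%N ->
  vform ((dp.1 * dq.1)%N, dp.2 ^+ dq.1 + c%:P * dq.2 ^+ dp.1).
Proof.
move=> [sp pT pI] [sq qT qI] d0 e0; split=> [|s y dy Ty|y dy Ty] /=.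
- rewrite (leq_trans (size_polyD _ _)) // geq_max mulnC size_exp_top //= mulnC.
  rewrite mul_polyC (leq_trans (size_scale_leq _ _)) //.
  exact: size_exp_top.
- rewrite rmorphD rmorphM /= !rmorphXn hornerD hornerM !horner_exp (pT _ _ dy Ty) (qT _ _ dy Ty).
  by rewrite !expr0n !gtn_eqF // mulr0 addr0.
- rewrite coefD coefCM mulnC coefX_top // mulnC coefX_top // rmorphD rmorphM !rmorphXn /=.
  by rewrite pI // qI // !expr0n !gtn_eqF // mulr0 addr0.
Qed.

Hypothesis constR : exists2 cst : algC -> R, True & forall c y, ev y (cst c) = c.

(** A single form avoiding infinity and a finite list of points, built by induction: if the current
    form vanishes at the new point, add a generic multiple of one that does not. It is applied later
    to the roots of a first form, to produce a coprime second one. *)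
Lemma sep_seq y (L : seq algC) : dom y -> ~ proj y ->
  exists dp, [/\ vform dp, ev y dp.2`_dp.1 != 0 &
     all (fun s => (map_poly (ev y) dp.2).[s] != 0) L].
Proof.
move=> dy np; elim: L => [|s L [dp [vp pI pL]]].
  by have [dp ? ?] := sep_inf dy np; exists dp.
have [ps|] := boolP ((map_poly (ev y) dp.2).[s] != 0); first by exists dp; rewrite /= ps.
rewrite negbK => /eqP ps.
have [dq vq qs] := sep_aff s dy np.
have cst0 dr : vform dr -> dr.1 = 0%N -> forall s, (map_poly (ev y) dr.2).[s] = ev y dr.2`_dr.1.
  move=> [] + _ _ d0 s'; rewrite d0 => /size1_polyC ->.
  by rewrite map_polyC hornerC coefC.
have [e0|e0] := posnP dq.1.
  exists dq; have qI := cst0 _ vq e0; rewrite -(qI 0); split=> //.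
    by rewrite qI -(qI s).
  by rewrite /= qs; apply/allP => s' _; rewrite qI -(qI s).
have [d0|d0] := posnP dp.1.
  by move: pI; rewrite -(cst0 _ vp d0 s) ps eqxx.
have [cst _ cstE] := constR.
pose A s := (map_poly (ev y) dp.2).[s] ^+ dq.1.
pose B s := (map_poly (ev y) dq.2).[s] ^+ dp.1.
(* The roots of [Q] are the bad values of [c]: 0, which would leave the new point uncured, and those
   for which the combination vanishes at a point of [L] or at infinity. *)
pose Q := 'X * \prod_(s <- L) ((A s)%:P + (B s) *: 'X) *
   ((ev y dp.2`_dp.1 ^+ dq.1)%:P + (ev y dq.2`_dq.1 ^+ dp.1) *: 'X).
have lin (a b : algC) : a != 0 -> a%:P + b *: 'X != 0.
  move=> a0; apply: contra a0 => /eqP/(congr1 (fun p : {poly _} => p.[0])).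
  by rewrite !hornerE ?mulr0 ?addr0 => ->.
have [c] : exists c, Q.[c] != 0.
  apply: exists_nonroot; rewrite !mulf_neq0 ?polyX_eq0 // ?lin ?expf_neq0 //.
  rewrite prodf_seq_neq0; apply/allP => s' /(allP pL) ps' /=.
  by rewrite lin // expf_neq0.
rewrite !hornerM !mulf_eq0 !negb_or hornerX => /andP[/andP[c0 cL] cI].
exists ((dp.1 * dq.1)%N, dp.2 ^+ dq.1 + (cst c)%:P * dq.2 ^+ dp.1); split.
- exact: vform_comb.
- have [sp _ _] := vp; have [sq _ _] := vq.
  rewrite /= coefD coefCM mulnC coefX_top // mulnC coefX_top // rmorphD rmorphM !rmorphXn /= cstE.
  by move: cI; rewrite !hornerE mulrC.
- have E s' : (map_poly (ev y) (dp.2 ^+ dq.1 + (cst c)%:P * dq.2 ^+ dp.1)).[s'] = A s' + c * B s'.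
    by rewrite rmorphD rmorphM /= map_polyC /= !rmorphXn hornerD hornerM hornerC !horner_exp /= cstE.
  rewrite /= E /A ps expr0n gtn_eqF // add0r mulf_neq0 ?expf_neq0 //=.
  apply/allP => s' hs'; rewrite E; move: cL.
  rewrite horner_prod prodf_seq_neq0 => /allP/(_ _ hs')/=.
  by rewrite !hornerE mulrC.
Qed.

(** Completeness of the projective line. Over [y] two forms vanishing on [T] are chosen without
    common zero and nonzero at infinity, so their degrees do not drop and their resultant survives
    at [y]; over a point of the projection it vanishes, because it lies in the ideal of the two
    forms. *)
Lemma projective_elimination : poly_separated ev dom proj.
Proof.
move=> y dy np.
have projP z : proj z -> (exists s, T (s, (1, z))) \/ T (1, (0, z)).
  move=> [s [t [st Tz]]]; have [t0|t0] := eqVneq t 0.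
    have s0 : s != 0 by move: st; rewrite t0 xpair_eqE eqxx andbT.
    by right; have := Tscale (_ : s^-1 != 0) Tz; rewrite t0 mulr0 mulVf ?invr_eq0 //; apply.
  left; exists (t^-1 * s); have := Tscale (_ : t^-1 != 0) Tz.
  by rewrite mulVf ?invr_eq0 //; apply.
have [[d p] /= [[sp pT pI] py _]] := sep_seq [::] dy np; simpl in *.
have [rs prs] := closed_field_poly_normal (map_poly (ev y) p).
have [[e q] /= [[sq qT qI] qy qrs]] := sep_seq rs dy np; simpl in *.
have const0 d' (p' : {poly R}) : (size p' <= d'.+1)%N ->
   (forall s y, dom y -> T (s, (1, y)) -> (map_poly (ev y) p').[s] = 0) ->
   (forall y, dom y -> T (1, (0, y)) -> ev y p'`_d' = 0) -> ev y p'`_d' != 0 -> d' = 0%N ->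
  exists r, (forall z, dom z -> proj z -> ev z r = 0) /\ ev y r != 0.
  move=> sp' p'T p'I p'y d0; exists p'`_0; rewrite d0 in sp' p'I p'y; split=> // z dz /projP[[s Tz]|Tz].
    by have := p'T _ _ dz Tz; rewrite (size1_polyC sp') map_polyC hornerC coefC.
  exact: p'I.
have sz d' (p' : {poly R}) : (size p' <= d'.+1)%N -> ev y p'`_d' != 0 -> size p' = d'.+1.
  move=> sp' p'y; apply/eqP; rewrite eqn_leq sp' ltnNge; apply: contra p'y => h.
  by rewrite nth_default // rmorph0.
have [d0|d0] := posnP d; first exact: const0 pT pI py d0.
have [e0|e0] := posnP e; first exact: const0 qT qI qy e0.
have spE := sz _ _ sp py; have sqE := sz _ _ sq qy.
have lp : lead_coef p = p`_d by rewrite /lead_coef spE.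
have lq : lead_coef q = q`_e by rewrite /lead_coef sqE.
exists (resultant p q * p`_d); split; last first.
  rewrite rmorphM mulf_neq0 // map_resultant_ev ?lp ?lq // resultant_eq0 -leqNgt.
  rewrite leqNgt; apply/negP => /ltn_eqF/negbT; rewrite eq_sym => /closed_rootP[s].
  rewrite root_gcd => /andP[]; rewrite prs rootZ; last first.
    rewrite lead_coef_eq0; apply: contra py => /eqP/(congr1 (fun p : {poly _} => p`_d)).
    by rewrite coef_map coef0 => /= ->.
  by rewrite root_prod_XsubC => /(allP qrs)/= h /eqP h0; rewrite h0 eqxx in h.
move=> z dz /projP[[s Tz]|Tz]; rewrite rmorphM; last by rewrite pI ?mulr0.
have p1 : (1 < size p)%N by rewrite spE.
have q1 : (1 < size q)%N by rewrite sqE.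
have [[u v] _ /= E] := resultant_in_ideal p1 q1.
have := congr1 (fun r => (map_poly (ev z) r).[s]) E.
rewrite /= map_polyC hornerC /= => ->.
by rewrite rmorphD !rmorphM /= hornerD !hornerM pT // qT // !mulr0 addr0 mul0r.
Qed.

End ProjectiveLine.

(** * Plane curves and chains of closed sets *)

(** In [{poly {poly algC}}] the inner variable is the first coordinate of the plane and the outer
    variable the second; this restricts to a vertical line. *)
Definition at_fst (a : algC) : {rmorphism {poly {poly algC}} -> {poly algC}} :=
  map_poly (horner_eval a).

Definition ev2 (a b : algC) : {rmorphism {poly {poly algC}} -> algC} :=
  horner_eval b \o at_fst a.

Lemma ev2E a b h : ev2 a b h = (at_fst a h).[b].
Proof. by []. Qed.

Lemma ev2C a b (c : {poly algC}) : ev2 a b c%:P = c.[a].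
Proof. by rewrite ev2E /at_fst /= map_polyC hornerC. Qed.

Lemma ev2X a b : ev2 a b 'X = b.
Proof. by rewrite ev2E /at_fst /= map_polyX hornerX. Qed.

Lemma ev2D a b : {morph ev2 a b : g h / g + h}. Proof. exact: rmorphD. Qed.
Lemma ev2B a b : {morph ev2 a b : g h / g - h}. Proof. exact: rmorphB. Qed.
Lemma ev2M a b : {morph ev2 a b : g h / g * h}. Proof. exact: rmorphM. Qed.

Lemma ev2_nonroot (h : {poly {poly algC}}) : h != 0 -> exists a b, ev2 a b h != 0.
Proof.
move=> h0; have [|a ha] := @exists_nonroot (lead_coef h); first by rewrite lead_coef_eq0.
have [|b hb] := @exists_nonroot (at_fst a h); last by exists a, b.
apply: contra ha => /eqP/(congr1 (fun p : {poly _} => p`_(size h).-1)).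
by rewrite coef_map coef0 => /eqP.
Qed.

Lemma at_fst_eq0 a h : at_fst a h = 0 -> exists h', h = ('X - a%:P)%:P * h'.
Proof.
move=> e; exists (\poly_(i < size h) (h`_i %/ ('X - a%:P))).
apply/polyP => i; rewrite coefCM coef_poly; case: ltnP => hi; last first.
  by rewrite nth_default // mulr0.
rewrite mulrC divpK // dvdp_XsubCl /root.
by have /(congr1 (fun p : {poly _} => p`_i)) := e; rewrite coef_map coef0 => /eqP.
Qed.

(** The degree of the lexicographically leading monomial, not the total degree. It is additive on
    products and zero only on constants, which is all that irreducibility by minimality requires. *)
Definition bidegree (h : {poly {poly algC}}) := ((size h).-1 + (size (lead_coef h)).-1)%N.

Lemma bidegreeM (g h : {poly {poly algC}}) : g != 0 -> h != 0 ->
  bidegree (g * h) = (bidegree g + bidegree h)%N.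
Proof.
move=> g0 h0; rewrite /bidegree lead_coefM !size_mul ?lead_coef_eq0 //.
have := size_poly_gt0 g; have := size_poly_gt0 h.
have := size_poly_gt0 (lead_coef g); have := size_poly_gt0 (lead_coef h).
rewrite !lead_coef_eq0 g0 h0.
case: (size _) => // n _; case: (size _) => // m _; case: (size _) => // p _; case: (size _) => // q _.
by rewrite !addSn !addnS /= addnACA.
Qed.

Lemma bidegree0 (h : {poly {poly algC}}) : h != 0 -> bidegree h = 0%N -> exists2 c, c != 0 & h = c%:P%:P.
Proof.
move=> h0 /eqP; rewrite addn_eq0 => /andP[/eqP s1 /eqP s2].
have /size1_polyC e : (size h <= 1)%N by case: (size h) s1 => // [[]].
rewrite e lead_coefC in s2.
have /size1_polyC e2 : (size (h`_0)%R <= 1)%N by case: (size h`_0) s2 => // [[]].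
have e3 : h = (h`_0`_0)%:P%:P by rewrite -e2 -e.
by exists h`_0`_0 => //; apply: contraNneq h0 => z; rewrite e3 z.
Qed.

Lemma bidegree_XsubC a : bidegree ('X - a%:P)%:P = 1%N.
Proof. by rewrite /bidegree lead_coefC size_polyC polyXsubC_eq0 size_XsubC. Qed.

Lemma XsubCC_neq0 (a : algC) : ('X - a%:P)%:P != 0 :> {poly {poly algC}}.
Proof. by rewrite polyC_eq0 polyXsubC_eq0. Qed.

(* Gauss's lemma: over an algebraically closed field, denominators in k[a] can
   be cleared one linear factor at a time. *)
Lemma gauss_factor (c : {poly algC}) (h q e : {poly {poly algC}}) :
  c != 0 -> c *: h = q * e ->
  exists q1 e1 al be, [/\ h = q1 * e1, q = be *: q1 & e = al *: e1].
Proof.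
have [n] := ubnP (size c); elim: n => // n IH in c h q e * => sc c0 E.
have [c1|c1] := leqP (size c) 1.
  have /size1_polyC ce := c1; have k0 : c`_0 != 0 by apply: contraNneq c0 => z; rewrite ce z.
  exists ((c`_0)^-1%:P *: q), e, 1, c; split; last by rewrite scale1r.
    by rewrite -scalerAl -E scalerA {2}ce -polyCM mulVf // scale1r.
  by rewrite scalerA {1}ce -polyCM mulfV // scale1r.
have [a /factor_theorem[c' ec]] : exists a, root c a by apply/closed_rootP; rewrite gtn_eqF.
have c'0 : c' != 0 by apply: contraNneq c0 => z; rewrite ec z mul0r.
have sc' : (size c' < n)%N.
  by move: sc; rewrite ec size_mul ?polyXsubC_eq0 // size_XsubC addn2.
(* On the vertical line over a root [a] of the denominator the product vanishes, so one of the two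
   factors is divisible by X - a. *)
have : at_fst a q * at_fst a e = 0.
  rewrite -rmorphM -E ec -mul_polyC rmorphM /= [at_fst a _](_ : _ = 0) ?mul0r //.
  by rewrite /at_fst /= map_polyC /= /horner_eval !hornerE subrr mulr0.
have X0 := XsubCC_neq0 a.
move/eqP; rewrite mulf_eq0 => /orP[] /eqP/at_fst_eq0[r er].
  have [|q1 [e1 [al [be [E1 E2 E3]]]]] := IH c' h r e sc' c'0.
    apply: (mulfI X0); rewrite mulrA -er -E ec -!mul_polyC polyCM; ring.
  by exists q1, e1, al, (('X - a%:P) * be); split=> //; rewrite er E2 mul_polyC scalerA.
have [|q1 [e1 [al [be [E1 E2 E3]]]]] := IH c' h q r sc' c'0.
  apply: (mulfI X0); rewrite mulrCA -er -E ec -!mul_polyC polyCM; ring.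
by exists q1, e1, (('X - a%:P) * al), be; split=> //; rewrite er E3 mul_polyC scalerA.
Qed.

Section PlaneCurves.
Variable h : {poly {poly algC}}.
Hypothesis h0 : h != 0.
Hypothesis h_irr : forall h1 h2, h = h1 * h2 -> bidegree h1 = 0%N \/ bidegree h2 = 0%N.

(** A vertical line inside the curve would split off a factor X - a, leaving a cofactor of positive
    degree in the second variable. *)
Lemma irr_at_fst a : (1 < size h)%N -> at_fst a h != 0.
Proof.
move=> sh; apply/eqP => /at_fst_eq0[h' e].
have [] := h_irr e; first by rewrite bidegree_XsubC.
have sh' : size h' = size h by rewrite e size_Cmul // polyXsubC_eq0.
by rewrite /bidegree sh'; case: (size h) sh => // [[]].
Qed.

(** Divisibility over the field of rational functions in the first variable descends to polynomials:
    each linear factor of [c] must divide [w], since it does not divide [h]. *)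
Lemma irr_dvd (c : {poly algC}) g w : (1 < size h)%N -> c != 0 -> c *: g = w * h ->
  exists v, g = v * h.
Proof.
move=> sh; have [n] := ubnP (size c); elim: n => // n IH in c g w * => sc c0 E.
have [c1|c1] := leqP (size c) 1.
  have /size1_polyC ce := c1; have k0 : c`_0 != 0 by apply: contraNneq c0 => z; rewrite ce z.
  exists ((c`_0)^-1%:P *: w).
  by rewrite -scalerAl -E scalerA {2}ce -polyCM mulVf // scale1r.
have [a /factor_theorem[c' ec]] : exists a, root c a by apply/closed_rootP; rewrite gtn_eqF.
have c'0 : c' != 0 by apply: contraNneq c0 => z; rewrite ec z mul0r.
have sc' : (size c' < n)%N.
  by move: sc; rewrite ec size_mul ?polyXsubC_eq0 // size_XsubC addn2.
have : at_fst a w * at_fst a h = 0.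
  rewrite -rmorphM -E ec -mul_polyC rmorphM /= [at_fst a _](_ : _ = 0) ?mul0r //.
  by rewrite /at_fst /= map_polyC /= /horner_eval !hornerE subrr mulr0.
move/eqP; rewrite mulf_eq0 (negPf (irr_at_fst _ sh)) orbF => /eqP/at_fst_eq0[r er].
apply: (IH c' g r sc' c'0); apply: (mulfI (XsubCC_neq0 a)).
by rewrite mulrA -er -E ec -!mul_polyC polyCM; ring.
Qed.

Lemma finite_roots (p : {poly algC}) : p != 0 -> exists L : seq algC, forall a, p.[a] = 0 -> a \in L.
Proof.
move=> p0; have [rs e] := closed_field_poly_normal p.
exists rs => a /eqP; rewrite -/(root p a) e rootZ ?lead_coef_eq0 //.
by rewrite root_prod_XsubC.
Qed.

(** If the resultant is nonzero, its roots contain the first coordinates. If it is zero, the gcd has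
    positive degree; [gauss_factor] turns it into a true factor of [h], hence by irreducibility into
    [h] itself up to scalars in the first variable, and [h] divides [g], against [g] being nonzero
    at a point of the curve. *)
Lemma irr_finite_fst g a b : (1 < size h)%N -> ev2 a b h = 0 -> ev2 a b g != 0 ->
  exists L : seq algC, forall a' b', ev2 a' b' h = 0 -> ev2 a' b' g = 0 -> a' \in L.
Proof.
move=> sh hab gab.
have g0 : g != 0 by apply: contraNneq gab => ->; rewrite rmorph0.
have [sg|sg] := leqP (size g) 1.
  move: g0; rewrite (size1_polyC sg) polyC_eq0 => /finite_roots[L hL].
  by exists L => a' b' _; rewrite ev2C; apply: hL.
have [r0|/finite_roots[L hL]] := eqVneq (resultant h g) 0; last first.
  exists L => a' b' h' g'; apply: hL; rewrite -(ev2C a' b').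
  have [[u v] _ E] := resultant_in_ideal sh sg.
  have -> : (resultant h g)%:P = u * h + v * g by [].
  by rewrite ev2D !ev2M h' g' !mulr0 addr0.
move/eqP: r0; rewrite resultant_eq0; set e := gcdp h g => se.
have /eqP eh : lead_coef e ^+ scalp h e *: h == h %/ e * e.
  by rewrite -Pdiv.Idomain.dvdp_eq dvdp_gcdl.
have /eqP eg : lead_coef e ^+ scalp g e *: g == g %/ e * e.
  by rewrite -Pdiv.Idomain.dvdp_eq dvdp_gcdr.
have e0 : e != 0 by rewrite -size_poly_gt0 ltnW.
have lc n : lead_coef e ^+ n != 0 by rewrite expf_neq0 // lead_coef_eq0.
have [q1 [e1 [al [be [E1 _ E3]]]]] := gauss_factor (lc _) eh.
have [] := h_irr E1; last first.
  move/eqP; rewrite addn_eq0 => /andP[]; move: se; rewrite E3.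
  move/leq_trans/(_ (size_scale_leq _ _)).
  by case: (size e1) => // [[]].
have q10 : q1 != 0 by apply: contraNneq h0 => z; rewrite E1 z mul0r.
move/(bidegree0 q10) => [k k0 ek].
have E4 : e = (k^-1%:P * al) *: h.
  have -> : h = k%:P *: e1 by rewrite E1 ek mul_polyC.
  by rewrite scalerA mulrAC -polyCM mulVf // mul1r.
have [v ev] : exists v, g = v * h.
  apply: (@irr_dvd _ g ((g %/ e) * (k^-1%:P * al)%:P) sh (lc (scalp g e))).
  by rewrite eg {2}E4 -mul_polyC mulrA.
by move: gab; rewrite ev ev2M hab mulr0 eqxx.
Qed.

Lemma irr_finite g a b : ev2 a b h = 0 -> ev2 a b g != 0 ->
  exists L : seq (algC * algC), forall a' b', ev2 a' b' h = 0 -> ev2 a' b' g = 0 -> (a', b') \in L.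
Proof.
move=> hab gab; have [sh|sh] := leqP (size h) 1; last first.
  have [La hLa] := irr_finite_fst sh hab gab.
  have hb a' : exists L : seq algC, forall b', ev2 a' b' h = 0 -> b' \in L.
    by have [L hL] := finite_roots (irr_at_fst a' sh); exists L.
  have [Lb hLb] := choice hb.
  exists (flatten [seq [seq (a', b') | b' <- Lb a'] | a' <- La]) => a' b' h' g'.
  apply/flattenP; exists [seq (a', b') | b' <- Lb a'].
    by apply: map_f; apply: hLa h' g'.
  by apply: map_f; apply: hLb.
(* Here [h] does not involve the second variable, and irreducibility makes the curve a single
   vertical line through (a, b). *)
have eh := size1_polyC sh; set c := h`_0 in eh.
have c0 : c != 0 by apply: contraNneq h0 => z; rewrite eh z.
have [c1|c1] := leqP (size c) 1.
  by move: hab; rewrite eh ev2C (size1_polyC c1) hornerC => z; move: c0; rewrite (size1_polyC c1) z eqxx.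
have ra : root c a by rewrite /root -(ev2C a b) -eh hab.
have /factor_theorem[c' ec] := ra.
have eh' : h = c'%:P * ('X - a%:P)%:P by rewrite eh ec polyCM.
have c'0 : c' != 0 by apply: contraNneq c0 => z; rewrite ec z mul0r.
have [] := h_irr eh'; last by rewrite bidegree_XsubC.
move/bidegree0; rewrite polyC_eq0 => /(_ c'0)[k k0 /polyC_inj ek].
have ga0 : at_fst a g != 0.
  by apply: contraNneq gab; rewrite ev2E => ->; rewrite horner0.
have [L hL] := finite_roots ga0.
exists [seq (a, b') | b' <- L] => a' b'.
rewrite eh' ev2M !ev2C ek !hornerE => /eqP; rewrite mulf_eq0 (negPf k0) subr_eq0 /=.
by move=> /eqP -> /hL; apply: map_f.
Qed.

End PlaneCurves.

Section Surface.
Variables (T : topologicalType) (phi : algC -> algC -> T) (u : {poly {poly algC}}).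
Hypothesis u0 : u != 0.

Definition surf_image (S : set {poly {poly algC}}) : set T :=
  [set m | exists a b, [/\ ev2 a b u != 0, forall h, S h -> ev2 a b h = 0 & m = phi a b]].

(** Continuity of [phi] on the open set where [u] is nonzero; with the next hypothesis, [phi] is a
    continuous closed map, expressed without a topology on the plane. *)
Hypothesis phi_cont : forall C a b, closed C -> ev2 a b u != 0 -> ~ C (phi a b) ->
  exists h, (forall a b, ev2 a b u != 0 -> C (phi a b) -> ev2 a b h = 0) /\ ev2 a b h != 0.
Hypothesis phi_closed : forall S, closed (surf_image S).

Lemma surf_irreducible : irreducible_closed (surf_image set0).
Proof.
split; first exact: phi_closed.
  by have [a [b ab]] := ev2_nonroot u0; exists (phi a b), a, b.
move=> A B cA cB sub; apply: contrapT => /not_orP[/existsNP[x /not_implyP[Vx nA]] /existsNP[y /not_implyP[Vy nB]]].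
have [a [b [ab _ ex]]] := Vx; have [c [d [cd _ ey]]] := Vy.
rewrite ex in nA; rewrite ey in nB.
have [g [gA gab]] := phi_cont cA ab nA.
have [h [hB hcd]] := phi_cont cB cd nB.
have [a' [b']] : exists a b, ev2 a b (u * (g * h)) != 0.
  apply: ev2_nonroot; rewrite !mulf_neq0 //.
    by apply: contraNneq gab => ->; rewrite rmorph0.
  by apply: contraNneq hcd => ->; rewrite rmorph0.
rewrite !ev2M !mulf_eq0 !negb_or => /and3P[u' g' h'].
have [] := sub (phi a' b'); first by exists a', b'.
  by move=> /(gA _ _ u') e; rewrite e eqxx in g'.
by move=> /(hB _ _ u') e; rewrite e eqxx in h'.
Qed.

(** Points of the image are closed, being images of points of the plane, each cut out by two linear
    equations. Irreducibility then discards the points one at a time. *)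
Lemma irreducible_finite (C : set T) (L : seq (algC * algC)) : irreducible_closed C ->
  (forall m, C m -> exists ab : algC * algC, [/\ ab \in L, ev2 ab.1 ab.2 u != 0 & m = phi ab.1 ab.2]) ->
  exists x, C `<=` [set x].
Proof.
move=> [cC [x0 Cx0] irr]; elim: L => [|[a b] L IH] hL.
  by have [ab [] ] := hL _ Cx0.
pose A := surf_image [set ('X - a%:P)%:P; 'X - b%:P%:P].
pose B := [set m | exists ab : algC * algC, [/\ ab \in L, ev2 ab.1 ab.2 u != 0 & m = phi ab.1 ab.2]].
have cB : closed B.
  rewrite /B; elim: L {IH hL B} => [|[c d] L IH].
    rewrite (_ : [set m | _] = set0); first exact: closed0.
    by apply/seteqP; split=> m // [ab []].
  rewrite (_ : [set m | _] = surf_image [set ('X - c%:P)%:P; 'X - d%:P%:P] `|`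
     [set m | exists ab : algC * algC, [/\ ab \in L, ev2 ab.1 ab.2 u != 0 & m = phi ab.1 ab.2]]).
    by apply: closedU => //; apply: phi_closed.
  apply/seteqP; split=> m /=.
    move=> [ab []]; rewrite inE => /orP[/eqP -> /= ucd e|abL uab e]; last by right; exists ab.
    left; exists c, d; split=> // h' [] ->; rewrite ?ev2C ?hornerE ?subrr //.
    by rewrite ev2B ev2X ev2C hornerC subrr.
  move=> [[a' [b' [u' z e]]]|[ab [abL uab e]]].
    have /eqP := z _ (or_introl erefl); rewrite ev2C !hornerE subr_eq0 => /eqP ea.
    have /eqP := z _ (or_intror erefl); rewrite ev2B ev2X ev2C hornerC subr_eq0 => /eqP eb.
    by exists (c, d); rewrite inE eqxx -ea -eb.
  by exists ab; rewrite inE abL orbT.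
have [] := irr A B (@phi_closed _) cB.
- move=> m /hL[ab []]; rewrite inE => /orP[/eqP -> /= uab e|abL uab e]; last by right; exists ab.
  left; exists a, b; split=> // h' [] ->; rewrite ?ev2C ?hornerE ?subrr //.
  by rewrite ev2B ev2X ev2C hornerC subrr.
- move=> CA; exists (phi a b) => m /CA[a' [b' [u' z e]]].
  have /eqP := z _ (or_introl erefl); rewrite ev2C !hornerE subr_eq0 => /eqP ea.
  have /eqP := z _ (or_intror erefl); rewrite ev2B ev2X ev2C hornerC subr_eq0 => /eqP eb.
  by rewrite e ea eb.
- by move=> CB; apply: IH => m /CB.
Qed.

Lemma surf_no_chain : ~ has_chain (surf_image set0) 3.
Proof.
move=> [C [irrC ltC]].
have [C3i C3s] := irrC 3%N isT; have [C2i C2s] := irrC 2%N isT.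
have [C1i C1s] := irrC 1%N isT; have [C0i C0s] := irrC 0%N isT.
have [C23 nC32] := ltC 2%N isT; have [C12 nC21] := ltC 1%N isT.
have [C01 nC10] := ltC 0%N isT.
pose Q n := `[< exists h, [/\ h != 0, bidegree h = n & C 2%N `<=` surf_image [set h]] >].
have exQ : exists n, Q n.
  have /existsNP[m /not_implyP[Cm nCm]] := nC32.
  have [a [b [uab _ em]]] := C3s _ Cm.
  have [c2 _ _] := C2i; rewrite em in nCm.
  have [h [hC hab]] := phi_cont c2 uab nCm.
  exists (bidegree h); apply/asboolP; exists h; split=> //.
    by apply: contraNneq hab => ->; rewrite rmorph0.
  move=> m' Cm'; have [a' [b' [u' _ em']]] := C2s _ Cm'.
  by exists a', b'; split=> // _ ->; apply: hC => //; rewrite -em'.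
case: (ex_minnP exQ) => n /asboolP[h [h0 hn hC]] minn.
(* A factorization of [h] covers [C 2] by two images, closed because [phi] is a closed map. The
   irreducible set [C 2] lies in one of them, and minimality of the degree makes the other factor
   constant. *)
have h_irr h1 h2 : h = h1 * h2 -> bidegree h1 = 0%N \/ bidegree h2 = 0%N.
  move=> eh; have h10 : h1 != 0 by apply: contraNneq h0 => z; rewrite eh z mul0r.
  have h20 : h2 != 0 by apply: contraNneq h0 => z; rewrite eh z mulr0.
  have [c2 _ irr2] := C2i.
  have hsub : C 2%N `<=` surf_image [set h1] `|` surf_image [set h2].
    move=> m /hC[a [b [uab z em]]]; have /eqP := z _ erefl; rewrite eh ev2M mulf_eq0.
    by move=> /orP[] /eqP e; [left|right]; exists a, b; split=> // _ ->.
  have [s1|s2] := irr2 _ _ (@phi_closed _) (@phi_closed _) hsub.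
    right; have : (n <= bidegree h1)%N by apply: minn; apply/asboolP; exists h1.
    by rewrite -hn eh bidegreeM // -{2}[bidegree h1]addn0 leq_add2l leqn0 => /eqP.
  left; have : (n <= bidegree h2)%N by apply: minn; apply/asboolP; exists h2.
  by rewrite -hn eh bidegreeM // -{2}[bidegree h2]add0n leq_add2r leqn0 => /eqP.
have /existsNP[m /not_implyP[Cm nCm]] := nC21.
have [a [b [uab z em]]] := hC _ Cm; rewrite em in nCm.
have [c1 [x0 Cx0] _] := C1i; have [g [gC gab]] := phi_cont c1 uab nCm.
have [L hL] := irr_finite h0 h_irr (z _ erefl) gab.
have [|x Cx] := @irreducible_finite (C 1%N) L C1i.
  move=> m' Cm'; have [a' [b' [u' z' em']]] := hC _ (C12 _ Cm').
  by exists (a', b'); split=> //; apply: hL; [apply: z'|apply: gC => //; rewrite -em'].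
have [_ [y Cy] _] := C0i; apply: nC10 => m' Cm'.
by have -> : m' = y by rewrite (Cx _ Cm') -(Cx _ (C01 _ Cy)).
Qed.

End Surface.

Section Curve.
Variables (T : topologicalType) (phi : algC -> T) (u : {poly algC}).
Hypothesis u0 : u != 0.

Definition curve_image (S : set {poly algC}) : set T :=
  [set m | exists a, [/\ u.[a] != 0, forall h : {poly algC}, S h -> h.[a] = 0 & m = phi a]].

Hypothesis phi_cont : forall C a, closed C -> u.[a] != 0 -> ~ C (phi a) ->
  exists h : {poly algC}, (forall a, u.[a] != 0 -> C (phi a) -> h.[a] = 0) /\ h.[a] != 0.
Hypothesis phi_closed : forall S, closed (curve_image S).

Lemma curve_irreducible : irreducible_closed (curve_image set0).
Proof.
split; first exact: phi_closed.
  by have [a ua] := exists_nonroot u0; exists (phi a), a.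
move=> A B cA cB sub; apply: contrapT => /not_orP[/existsNP[x /not_implyP[Vx nA]] /existsNP[y /not_implyP[Vy nB]]].
have [a [ua _ ex]] := Vx; have [c [uc _ ey]] := Vy.
rewrite ex in nA; rewrite ey in nB.
have [g [gA ga]] := phi_cont cA ua nA.
have [h [hB hc]] := phi_cont cB uc nB.
have [a'] : exists a, (u * (g * h)).[a] != 0.
  apply: exists_nonroot; rewrite !mulf_neq0 //.
    by apply: contraNneq ga => ->; rewrite horner0.
  by apply: contraNneq hc => ->; rewrite horner0.
rewrite !hornerM !mulf_eq0 !negb_or => /and3P[u' g' h'].
have [] := sub (phi a'); first by exists a'.
  by move=> /(gA _ u') e; rewrite e eqxx in g'.
by move=> /(hB _ u') e; rewrite e eqxx in h'.
Qed.

Lemma curve_no_chain : ~ has_chain (curve_image set0) 2.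
Proof.
move=> [C [irrC ltC]].
have [C2i C2s] := irrC 2%N isT.
have [C1i C1s] := irrC 1%N isT; have [C0i C0s] := irrC 0%N isT.
have [C12 nC21] := ltC 1%N isT; have [C01 nC10] := ltC 0%N isT.
have /existsNP[m /not_implyP[Cm nCm]] := nC21.
have [a [ua _ em]] := C2s _ Cm; rewrite em in nCm.
have [c1 [x0 Cx0] irr] := C1i; have [g [gC ga]] := phi_cont c1 ua nCm.
have g0 : g != 0 by apply: contraNneq ga => ->; rewrite horner0.
have [L hL] := finite_roots g0.
suff [x Cx] : exists x, C 1%N `<=` [set x].
  have [_ [y Cy] _] := C0i; apply: nC10 => m' Cm'.
  by have -> : m' = y by rewrite (Cx _ Cm') -(Cx _ (C01 _ Cy)).
have {hL} : C 1%N `<=` curve_image [set \prod_(b <- L) ('X - b%:P)].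
  move=> m' Cm'; have [a' [u' _ em']] := C1s _ Cm'.
  exists a'; split=> // _ ->; apply/eqP; rewrite -/(root _ _) root_prod_XsubC.
  by apply: hL; apply: gC => //; rewrite -em'.
elim: L => [|b L IH] hL.
  have [a' [_ /(_ _ erefl)/eqP]] := hL _ Cx0.
  by rewrite big_nil hornerC oner_eq0.
have := irr (curve_image [set 'X - b%:P]) (curve_image [set \prod_(b <- L) ('X - b%:P)]).
case=> [||m' /hL[a' [u' z' em']]|Cb|]; try exact: phi_closed.
- have /eqP := z' _ erefl; rewrite big_cons hornerM mulf_eq0.
  by move=> /orP[]/eqP e; [left|right]; exists a'; split=> // _ ->.
- exists (phi b) => m' /Cb[a' [u' z' em']].
  by have /eqP := z' _ erefl; rewrite !hornerE subr_eq0 em' => /eqP ->.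
- exact: IH.
Qed.

End Curve.

(** * Binary forms and cubic maps *)

Lemma meval_homog n (R : comNzRingType) (p : {mpoly R[n]}) d c (v : 'I_n -> R) :
  p \is d.-homog -> p.@[fun i => c * v i] = c ^+ d * p.@[v].
Proof.
move=> /dhomogP hp; rewrite !mevalE mulr_sumr !big_seq; apply: eq_bigr => m /hp <-.
rewrite mulrCA; congr (_ * _); rewrite /= mdegE -prodrXr -big_split /=.
by apply: eq_bigr => i _; rewrite exprMn.
Qed.

Lemma ord2 (i : 'I_2) : i = 0 \/ i = 1.
Proof. by case: i => [[|[|]]] // h; [left|right]; apply: val_inj. Qed.

Definition vec (R : Type) (x y : R) : 'cV[R]_2 := \col_i (if i == 0 then x else y).

Lemma vec0 R (x y : R) : vec x y 0 0 = x. Proof. by rewrite mxE. Qed.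
Lemma vec1 R (x y : R) : vec x y 1 0 = y. Proof. by rewrite mxE. Qed.

Lemma vecP R (v : 'cV[R]_2) : v = vec (v 0 0) (v 1 0).
Proof. by apply/colP => i; rewrite mxE; case: (ord2 i) => ->. Qed.

Lemma vec2_inj (x y x' y' : algC) : vec x y = vec x' y' -> x = x' /\ y = y'.
Proof. by move=> e; split; [rewrite -(vec0 x y) e vec0 | rewrite -(vec1 x y) e vec1]. Qed.

Definition mat (R : Type) (a b c d : R) : 'M[R]_2 :=
  \matrix_(i, j) (if i == 0 then if j == 0 then a else b else if j == 0 then c else d).

Lemma mat_vec (R : pzSemiRingType) (a b c d x y : R) :
  mat a b c d *m vec x y = vec (a * x + b * y) (c * x + d * y).
Proof. by apply/colP => i; rewrite !mxE big_ord_recl big_ord1 !mxE; case: (ord2 i) => ->. Qed.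

Lemma scale_vec (R : pzRingType) (c x y : R) : c *: vec x y = vec (c * x) (c * y).
Proof. by apply/colP => i; rewrite !mxE; case: (ord2 i) => ->. Qed.

Lemma matP R (A : 'M[R]_2) : A = mat (A 0 0) (A 0 1) (A 1 0) (A 1 1).
Proof. by apply/matrixP => i j; rewrite mxE; case: (ord2 i) => ->; case: (ord2 j) => ->. Qed.

Lemma mat_mul (R : pzSemiRingType) (a b c d a' b' c' d' : R) :
  mat a b c d *m mat a' b' c' d' =
  mat (a * a' + b * c') (a * b' + b * d') (c * a' + d * c') (c * b' + d * d').
Proof. by apply/matrixP => i j; rewrite !mxE big_ord_recl big_ord1 !mxE; case: (ord2 i) => ->; case: (ord2 j) => ->. Qed.

Lemma scale_mat (R : pzRingType) (c x y z t : R) :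
  c *: mat x y z t = mat (c * x) (c * y) (c * z) (c * t).
Proof. by apply/matrixP => i j; rewrite !mxE; case: (ord2 i) => ->; case: (ord2 j) => ->. Qed.

Lemma mat_scalar (R : pzRingType) (c : R) : c%:M = mat c 0 0 c.
Proof. by apply/matrixP => i j; rewrite !mxE; case: (ord2 i) => ->; case: (ord2 j) => ->. Qed.

Lemma mat_inj (a b c d a' b' c' d' : algC) : mat a b c d = mat a' b' c' d' ->
  [/\ a = a', b = b', c = c' & d = d'].
Proof. by move=> /matrixP e; move: (e 0 0) (e 0 1) (e 1 0) (e 1 1); rewrite !mxE. Qed.

Lemma det_mat (R : comNzRingType) (a b c d : R) : \det (mat a b c d) = a * d - b * c.
Proof.
rewrite (expand_det_row _ 0) big_ord_recl big_ord1 /cofactor !det_mx11 !mxE /=.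
by rewrite expr0 expr1 mul1r mulN1r mulrN.
Qed.

Lemma mat_unit (F : fieldType) (a b c d : F) : (mat a b c d \in unitmx) = (a * d - b * c != 0).
Proof. by rewrite unitmxE unitfE det_mat. Qed.

Lemma vec_neq0 (x y : algC) : (vec x y != 0) = (x != 0) || (y != 0).
Proof.
apply/idP/idP; first by apply: contraR; rewrite negb_or !negbK => /andP[/eqP-> /eqP->]; apply/eqP/colP => i; rewrite !mxE if_same.
by move=> h; apply: contraL h => /eqP/colP e; have := e 0; have := e 1; rewrite !mxE /= => -> ->; rewrite eqxx.
Qed.

(** Pairs of forms are handled through their values on column vectors, where conjugation is a matrix
    identity. Nothing is lost, since the field is infinite: see [fv_inj]. *)
Definition fv (f : form2 * form2) (v : 'cV[algC]_2) : 'cV[algC]_2 :=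
  vec f.1.@[fun i => v i 0] f.2.@[fun i => v i 0].

Lemma lin_forms_eval A (v : 'cV[algC]_2) i :
  (tnth (lin_forms A) i).@[fun i => v i 0] = (A *m v) i 0.
Proof.
rewrite tnth_mktuple raddf_sum mxE; apply: eq_bigr => j _.
by rewrite /= mevalZ mevalXU mulrC mulrC.
Qed.

Lemma fv_precomp f A v : fv (precomp f A) v = fv f (A *m v).
Proof.
by rewrite /fv /precomp /= !comp_mpoly_meval; congr vec; apply: meval_eq => i; rewrite lin_forms_eval.
Qed.

Lemma fv_postcomp f B v : fv (postcomp B f) v = B *m fv f v.
Proof. by rewrite [B in RHS]matP mat_vec /fv /= !mevalD !mevalZ. Qed.

Lemma fv_conj f A v : fv (conj_pair f A) v = invmx A *m fv f (A *m v).
Proof. by rewrite fv_postcomp fv_precomp. Qed.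

Lemma fv_scale f c v : fv (c *: f.1, c *: f.2) v = c *: fv f v.
Proof. by rewrite /fv scale_vec /= !mevalZ. Qed.

Definition to_poly2 : {rmorphism form2 -> {poly {poly algC}}} :=
  mmap (polyC \o polyC) (fun i : 'I_2 => if i == 0 then 'X%:P else 'X).

Lemma to_poly2E (p : form2) :
  to_poly2 p = \sum_(m <- msupp p) (p@_m)%:P%:P * ('X%:P ^+ m 0%R * 'X ^+ m 1%R).
Proof.
rewrite /to_poly2 /= /mmap; apply: eq_bigr => m _; rewrite /mmap1 big_ord_recl big_ord1 /=.
by rewrite (_ : lift ord0 ord0 = 1 :> 'I_2) //; apply: val_inj.
Qed.

Lemma ev2_to_poly2 a b p : ev2 a b (to_poly2 p) = p.@[fun i => vec a b i 0].
Proof.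
rewrite to_poly2E mevalE (rmorph_sum (ev2 a b)); apply: eq_bigr => m _.
rewrite !ev2M (rmorphXn (ev2 a b)) (rmorphXn (ev2 a b) (m 1%R)) !ev2C ev2X !hornerE.
rewrite big_ord_recl big_ord1 vec0 (_ : lift ord0 ord0 = 1 :> 'I_2) ?vec1; last exact: val_inj.
exact: esym (mulrA _ _ _).
Qed.

Lemma to_poly2_coef (p : form2) (m : 'X_{1..2}) : (to_poly2 p)`_(m 1)`_(m 0) = p@_m.
Proof.
rewrite to_poly2E coef_sum coef_sum.
under eq_bigr => m' _.
  rewrite coefCM coefCM -polyC_exp coefCM coefXn -[(m 1 == _)%:R]polyC_natr coefMC coefXn -natrM mulnb.
  over.
have E (m' : 'X_{1..2}) : (m 0%R == m' 0%R) && (m 1%R == m' 1%R) = (m == m').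
  apply/andP/eqP => [[/eqP h0 /eqP h1]|-> //]; apply/mnmP => i; by case: (ord2 i) => ->.
under eq_bigr => m' _ do rewrite E.
have [mp|mp] := boolP (m \in msupp p); last first.
  rewrite memN_msupp_eq0 // big_seq big1 // => m' m'p.
  by rewrite (negPf (_ : m != m')) ?mulr0 //; apply: contraNneq mp => ->.
rewrite (bigD1_seq m) ?msupp_uniq //= eqxx mulr1 big1 ?addr0 // => m' nm.
by rewrite eq_sym (negPf nm) mulr0.
Qed.

Lemma form_eval_inj (p q : form2) :
  (forall x y, (x != 0) || (y != 0) -> p.@[fun i => vec x y i 0] = q.@[fun i => vec x y i 0]) -> p = q.
Proof.
move=> h; apply/eqP; rewrite -subr_eq0; apply/eqP.
have e : to_poly2 (p - q) = 0.
  apply/eqP; apply: contraT => n0.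
  (* The extra factor forces the first coordinate to be nonzero, so that the hypothesis on nonzero
     vectors applies. *)
  have [|a [b]] := @ev2_nonroot (('X%:P) * to_poly2 (p - q)).
    by rewrite mulf_neq0 // polyC_eq0 polyX_eq0.
  rewrite ev2M ev2C hornerX mulf_eq0 negb_or => /andP[a0].
  by rewrite ev2_to_poly2 mevalB h ?a0 // subrr eqxx.
by apply/mpolyP => m; rewrite -to_poly2_coef e !coef0 mcoeff0.
Qed.

Lemma fv_inj f g : (forall v, fv f v = fv g v) -> f = g.
Proof.
case: f g => [f1 f2] [g1 g2] h; congr pair; apply: form_eval_inj => x y _.
  by have [] := vec2_inj (h (vec x y)).
by have [] := vec2_inj (h (vec x y)).
Qed.

Lemma fvZ d f c v : f.1 \is d.-homog -> f.2 \is d.-homog -> fv f (c *: v) = c ^+ d *: fv f v.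
Proof.
move=> h1 h2; rewrite /fv scale_vec -!meval_homog //.
by congr vec; apply: meval_eq => i; rewrite mxE.
Qed.

Lemma poly_nonroot_const (p : {poly algC}) : (forall x, p.[x] != 0) -> forall x y, p.[x] = p.[y].
Proof.
move=> h; have [s|s] := eqVneq (size p) 1%N.
  by move=> x y; rewrite (size1_polyC (eq_leq s)) !hornerC.
by have /closed_rootP[x] := s; rewrite /root (negPf (h x)).
Qed.

(** On a horizontal or vertical line missing the origin the form is a polynomial in one variable
    without roots, hence constant. Such lines join any nonzero vector to (1, 0). *)
Lemma form_unit (h : form2) :
  (forall x y, (x != 0) || (y != 0) -> h.@[fun i => vec x y i 0] != 0) -> h \is a GRing.unit.
Proof.
move=> hn; pose c := h.@[fun i => vec 1 0 i 0].
have [Hx Hy] : (forall x x' y, y != 0 -> h.@[fun i => vec x y i 0] = h.@[fun i => vec x' y i 0]) /\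
   (forall x y y', x != 0 -> h.@[fun i => vec x y i 0] = h.@[fun i => vec x y' i 0]).
  split=> [x x' y y0|x y y' x0]; rewrite -!ev2_to_poly2.
    have E z : ev2 z y (to_poly2 h) = (to_poly2 h).[y%:P].[z].
      by have := horner_map (horner_eval z) (to_poly2 h) y%:P; rewrite /= {2}/horner_eval hornerC.
    rewrite !E; apply: poly_nonroot_const => z; rewrite -E ev2_to_poly2.
    by apply: hn; rewrite y0 orbT.
  rewrite !ev2E; apply: poly_nonroot_const => z; rewrite -ev2E ev2_to_poly2.
  by apply: hn; rewrite x0.
have -> : h = c%:MP.
  apply: form_eval_inj => x y xy; rewrite mevalC /c.
  have [y0|y0] := eqVneq y 0.
    rewrite y0 eqxx orbF in xy; rewrite y0 (Hy x 0 1 xy) (Hx x 1 1 (oner_neq0 _)).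
    exact: Hy (oner_neq0 _).
  by rewrite (Hx x 1 y y0); apply: Hy; apply: oner_neq0.
have c0 : c != 0 by apply: hn; rewrite oner_neq0.
apply/unitrP; exists (c^-1)%:MP.
by rewrite -!mpolyCM mulVf // mulfV.
Qed.

Definition mon d (j : 'I_d.+1) : 'X_{1..2} :=
  [multinom (if i == 0%R then val j else d - j)%N | i < 2].

Lemma mdeg_mon d (j : 'I_d.+1) : mdeg (mon j) = d.
Proof. by rewrite mdegE big_ord_recl big_ord1 !mnmE /= subnKC // -ltnS. Qed.

Lemma mon_inj d : injective (@mon d).
Proof. by move=> i j /mnmP/(_ 0); rewrite !mnmE /= => /val_inj. Qed.

Lemma homog_expand d (p : form2) : p \is d.-homog ->
  p = \sum_(j < d.+1) p@_(mon j) *: (X ^+ j * Y ^+ (d - j)).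
Proof.
move=> hp.
have XY (j : 'I_d.+1) : X ^+ j * Y ^+ (d - j) = 'X_[mon j].
  rewrite mpolyXE_id big_ord_recl big_ord1 !mnmE /=.
  by rewrite (_ : lift ord0 ord0 = 1 :> 'I_2) //; apply: val_inj.
apply/mpolyP => m; rewrite raddf_sum /=.
under eq_bigr => j _ do rewrite XY mcoeffZ mcoeffX.
have [dm|dm] := eqVneq (mdeg m) d; last first.
  rewrite (dhomog_nemf_coeff hp) // big1 // => j _.
  by rewrite (negPf (_ : mon j != m)) ?mulr0 //; apply: contraNneq dm => <-; rewrite mdeg_mon.
have m0 : (m 0%R < d.+1)%N by rewrite -dm mdegE big_ord_recl ltnS leq_addr.
have -> : m = mon (Ordinal m0).
  apply/mnmP => i; rewrite mnmE; case: (ord2 i) => -> //=.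
  rewrite -dm mdegE big_ord_recl big_ord1 addKn.
  by congr (m _); apply: val_inj.
rewrite (bigD1 (Ordinal m0)) //= eqxx mulr1 big1 ?addr0 // => j nj.
by rewrite (negPf (_ : mon j != _)) ?mulr0 //; apply: contraNneq nj => /mon_inj ->.
Qed.

Lemma homog_eval d (p : form2) x y : p \is d.-homog ->
  p.@[fun i => vec x y i 0] = \sum_(j < d.+1) p@_(mon j) * (x ^+ j * y ^+ (d - j)).
Proof.
move=> /homog_expand {1}->; rewrite raddf_sum; apply: eq_bigr => j _.
by rewrite /= mevalZ mevalM !rmorphXn /= !mevalXU vec0 vec1.
Qed.

Lemma homog_root_infty d (p : form2) : p \is d.-homog ->
  p.@[fun i => vec 1 0 i 0] = 0 -> exists q, p = Y * q.
Proof.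
move=> hp; rewrite (homog_eval _ _ hp) big_ord_recr /= subnn !expr1n mulr1 mulr1 big1 => [|j _]; last first.
  by rewrite expr0n subn_eq0 leqNgt ltn_ord !mulr0.
rewrite add0r => top; exists (\sum_(j < d) p@_(mon (widen_ord (leqnSn d) j)) *: (X ^+ j * Y ^+ (d - j.+1))).
rewrite {1}(homog_expand hp) big_ord_recr /= top scale0r addr0 mulr_sumr.
apply: eq_bigr => j _; rewrite -scalerAr mulrCA -exprS subnSK //.
Qed.

(** A common zero is moved to (1 : 0) by a linear substitution, where it means divisibility by [Y].
    Conversely a common factor without zeros is a unit by [form_unit]. *)
Lemma is_endoP d f : is_endo d f <->
  [/\ f.1 \is d.-homog, f.2 \is d.-homog & forall v, v != 0 -> fv f v != 0].
Proof.
split=> [[h1 h2 hc]|[h1 h2 hn]]; split=> //.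
  move=> v v0; apply/negP => /eqP fv0.
  have [A [uA Av]] : exists A, A \in unitmx /\ A *m vec 1 0 = v.
    have : (v 0 0 != 0) || (v 1 0 != 0) by rewrite -vec_neq0 -vecP.
    have [x0|x0 /= y0] := eqVneq (v 0 0) 0; [move=> /= y0; exists (mat (v 0 0) 1 (v 1 0) 0)|exists (mat (v 0 0) 0 (v 1 0) 1)].
      rewrite mat_unit mat_vec [v in RHS]vecP !mulr1 !mulr0 !addr0 sub0r oppr_eq0 mul1r.
      by split.
    by rewrite mat_unit mat_vec [v in RHS]vecP !mulr1 !mulr0 !addr0 mul0r subr0.
  have root i (p : form2) : p \is d.-homog -> p.@[fun i => v i 0] = 0 ->
      exists q, p = (Y \mPo lin_forms (invmx A)) * q.
    move=> hp hv; have [||q e] := @homog_root_infty d (p \mPo lin_forms A).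
    - exact: comp_lin_homog.
    - rewrite comp_mpoly_meval -[RHS]hv; apply: meval_eq => j.
      by rewrite lin_forms_eval Av.
    exists (q \mPo lin_forms (invmx A)).
    by rewrite -rmorphM /= -e comp_lin_formsM mulmxV // comp_lin_forms1.
  have [e1 e2] := vec2_inj (etrans fv0 (vecP 0)); rewrite !mxE in e1 e2.
  have /hc : common_factor (Y \mPo lin_forms (invmx A)) f by split; apply: root.
  move=> /(rmorph_unit (comp_mpoly (lin_forms A))).
  rewrite /= comp_lin_formsM mulVmx // comp_lin_forms1.
  move=> /(rmorph_unit (meval (fun i => vec 1 0 i 0))).
  by rewrite /= mevalXU vec1 unitr0.
move=> h [[p e1] [q e2]]; apply: form_unit => x y xy.
apply/negP => /eqP hz; have /hn : vec x y != 0 by rewrite vec_neq0.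
by rewrite /fv e1 e2 !mevalM hz !mul0r vec_neq0 eqxx.
Qed.

(** A certificate of ideal membership: [k] is the cofactor expressing the goal through the known
    equation, and [ring] checks it. [lincomb2] does the same with two equations. *)
Lemma lincomb1 (R : pzRingType) (k L M l r : R) : l = r -> L - M = k * (l - r) -> L = M.
Proof. by move=> -> /eqP; rewrite subrr mulr0 subr_eq0 => /eqP. Qed.

Lemma lincomb2 (R : pzRingType) (k k' L M l r l' r' : R) : l = r -> l' = r' ->
  L - M = k * (l - r) + k' * (l' - r') -> L = M.
Proof. by move=> -> -> /eqP; rewrite !subrr !mulr0 addr0 subr_eq0 => /eqP. Qed.

(** [g] is the conjugate of [f] by [A], lifted from the projective line to vectors. The scalar is
    recorded because, for an automorphism, it carries the sign that separates the two types of
    involutions. *)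
Definition conj_via (A : 'M[algC]_2) (c : algC) (f g : form2 * form2) :=
  forall v, fv f (A *m v) = c *: (A *m fv g v).

Definition moduli_class d (f : endo_lift d) : Moduli d := rat_class (\pi_(RatMap d) f).

Lemma conj_viaP d (f g : endo_lift d) (A : GL2) :
  \pi_(RatMap d) g = rat_conj (\pi_(RatMap d) f) (\pi_PGL2 A) <->
  exists2 c, c != 0 & conj_via A c f g.
Proof.
rewrite rat_conjE; split.
  move=> /esym/RatMap_eqP[c c0 e]; exists c^-1; first by rewrite invr_eq0.
  move=> v; rewrite e fv_scale /= fv_conj -!scalemxAr scalerA mulVf // scale1r.
  by rewrite mulmxA mulmxV ?mul1mx // GL2_unit.
move=> [c c0 e]; apply/esym/RatMap_eqP; exists c^-1; first by rewrite invr_eq0.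
apply: fv_inj => v; rewrite fv_scale /= fv_conj e -!scalemxAr scalerA mulVf // scale1r.
by rewrite mulmxA mulVmx ?mul1mx // GL2_unit.
Qed.

Lemma moduli_classP d (f g : endo_lift d) : moduli_class f = moduli_class g <->
  exists A c, [/\ A \in unitmx, c != 0 & conj_via A c f g].
Proof.
split.
  move=> /rat_classP[x]; rewrite -[x]reprK => /conj_viaP[c c0 h].
  by exists (repr x), c; split=> //; apply: GL2_unit.
move=> [A [c [uA c0 h]]]; apply/rat_classP; exists (\pi_PGL2 (MkGL2 uA)).
by apply/conj_viaP; exists c.
Qed.

Lemma rat_AutP d (f : endo_lift d) (A : GL2) :
  rat_Aut (\pi_(RatMap d) f) (\pi_PGL2 A) <-> exists2 c, c != 0 & conj_via A c f f.
Proof. by rewrite /rat_Aut /=; split=> [/esym/conj_viaP|/conj_viaP/esym]. Qed.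

Lemma moduli_class_surj d (m : Moduli d) : exists f : endo_lift d, m = moduli_class f.
Proof. by exists (repr (repr m)); rewrite /moduli_class /rat_class !reprK. Qed.

Lemma conj_via1 f : conj_via 1%:M 1 f f.
Proof. by move=> v; rewrite !mul1mx scale1r. Qed.

Lemma conj_via_comp A B c e f g h :
  conj_via A c f g -> conj_via B e g h -> conj_via (A *m B) (c * e) f h.
Proof. by move=> fg gh v; rewrite -mulmxA fg gh -scalemxAr !scalerA mulmxA. Qed.

Lemma conj_via_inv A c f g : A \in unitmx -> c != 0 ->
  conj_via A c f g -> conj_via (invmx A) c^-1 g f.
Proof.
move=> uA c0 h v; have := h (invmx A *m v); rewrite mulmxA mulmxV // mul1mx => ->.
by rewrite -scalemxAr scalerA mulVf // scale1r mulmxA mulVmx // mul1mx.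
Qed.

Lemma lift_conj_via d (f : endo_lift d) A : A \in unitmx ->
  exists g : endo_lift d, conj_via A 1 f g.
Proof.
move=> uA; exists (lift_conj f (MkGL2 uA)) => v.
by rewrite scale1r /= fv_conj mulmxA mulmxV // mul1mx.
Qed.

Lemma endo_fvZ d (f : endo_lift d) c v : fv f (c *: v) = c ^+ d *: fv f v.
Proof. by have [h1 h2 _] := endo_liftP f; apply: fvZ. Qed.

Lemma endo_fv_neq0 d (f : endo_lift d) v : v != 0 -> fv f v != 0.
Proof. by have /is_endoP[_ _] := endo_liftP f; apply. Qed.

Lemma unitmx_neq0 (A : 'M[algC]_2) v : A \in unitmx -> v != 0 -> A *m v != 0 :> 'cV_2.
Proof.
move=> uA; apply: contraNneq => h.
by rewrite -[v]mul1mx -(mulVmx uA) -mulmxA h mulmx0.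
Qed.

Lemma conj_via_neq0 d (f g : endo_lift d) A c : A \in unitmx -> conj_via A c f g -> c != 0.
Proof.
move=> uA h; have e : vec 1 0 != 0 :> 'cV[algC]_2 by rewrite vec_neq0 oner_neq0.
have := endo_fv_neq0 f (unitmx_neq0 uA e).
by rewrite h; apply: contraNneq => ->; rewrite scale0r.
Qed.

(** Degree 3 gives a factor k^3 on the left against k on the right. *)
Lemma conj_via_scale (f g : endo_lift 3) A c k : k != 0 ->
  conj_via (k *: A) c f g <-> conj_via A (c / k ^+ 2) f g.
Proof.
move=> k0; have k30 : k ^+ 3 != 0 by rewrite expf_neq0.
split=> h v; have := h v; rewrite -!scalemxAl endo_fvZ => e.
  apply: (scalerI k30); rewrite e !scalerA; congr (_ *: _); field.
  by rewrite k0.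
rewrite e !scalerA; congr (_ *: _); field.
by rewrite k0.
Qed.

Definition cub (a b c d x y : algC) := a * x ^+ 3 + b * x ^+ 2 * y + c * x * y ^+ 2 + d * y ^+ 3.

Lemma cub_inj a b c d a' b' c' d' :
  (forall x y, cub a b c d x y = cub a' b' c' d' x y) -> [/\ a = a', b = b', c = c' & d = d'].
Proof.
move=> h.
have ea : a = a' by have := h 1 0; rewrite /cub !expr1n !expr0n /= !mulr0 !addr0 !mulr1.
have ed : d = d' by have := h 0 1; rewrite /cub !expr1n !expr0n /= !mulr0 !mul0r !add0r !mulr1.
have two : 2 != 0 :> algC by rewrite pnatr_eq0.
have h1 := h 1 1; have h2 := h 1 (-1); rewrite /cub -ea -ed in h1 h2.
split=> //; apply: (mulIf two).
  by apply: (lincomb2 (k := 1) (k' := -1) h1 h2); ring.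
by apply: (lincomb2 (k := 1) (k' := 1) h1 h2); ring.
Qed.

Lemma endo3_cub (f : endo_lift 3) : exists p3 p2 p1 p0 q3 q2 q1 q0, forall x y,
  fv f (vec x y) = vec (cub p3 p2 p1 p0 x y) (cub q3 q2 q1 q0 x y).
Proof.
have [h1 h2 _] := endo_liftP f.
have E p : p \is 3.-homog -> forall x y, p.@[fun i => vec x y i 0] =
    cub p@_(mon (ord_max : 'I_4)) p@_(mon (inord 2 : 'I_4)) p@_(mon (inord 1 : 'I_4)) p@_(mon (ord0 : 'I_4)) x y.
  move=> hp x y; rewrite (homog_eval _ _ hp) !big_ord_recr big_ord0 /= add0r.
  have e k (i j : 'I_4) : i = k :> nat -> j = k :> nat -> p@_(mon i) = p@_(mon j).
    by move=> ei ej; congr (p@_(mon _)); apply: val_inj; rewrite /= ei ej.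
  rewrite (e 1%N (inord 1) (widen_ord (leqnSn 3) (widen_ord (leqnSn 2) ord_max))) ?inordK //.
  rewrite (e 2%N (inord 2) (widen_ord (leqnSn 3) ord_max)) ?inordK //.
  rewrite (e 0%N ord0 (widen_ord (leqnSn 3) (widen_ord (leqnSn 2) (widen_ord (leqnSn 1) ord_max)))) //.
  by rewrite /cub; ring.
do 8!eexists; move=> x y; rewrite /fv; congr vec; exact: E.
Qed.

Definition pair1 (ab : algC * algC) : form2 * form2 :=
  (X ^+ 3 + ab.1 *: (X * Y ^+ 2), ab.2 *: (X ^+ 2 * Y) + Y ^+ 3).
Definition pair2 (ab : algC * algC) : form2 * form2 :=
  (ab.1 *: (X ^+ 2 * Y) + Y ^+ 3, X ^+ 3 + ab.2 *: (X * Y ^+ 2)).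
Definition pair3 (a : algC) : form2 * form2 :=
  (X ^+ 3 + a *: Y ^+ 3, a *: (X ^+ 2 * Y)).

Lemma XY_homog i j : X ^+ i * Y ^+ j \is (i + j).-homog.
Proof.
by apply: dhomogM; rewrite -[X in X.-homog]mul1n; apply: dhomogMn; rewrite dhomogX /= mdeg1.
Qed.

Lemma X3_homog : X ^+ 3 \is 3.-homog.
Proof. by have := XY_homog 3 0; rewrite expr0 mulr1. Qed.
Lemma Y3_homog : Y ^+ 3 \is 3.-homog.
Proof. by have := XY_homog 0 3; rewrite expr0 mul1r. Qed.
Lemma X2Y_homog : X ^+ 2 * Y \is 3.-homog.
Proof. exact: (XY_homog 2 1). Qed.
Lemma XY2_homog : X * Y ^+ 2 \is 3.-homog.
Proof. exact: (XY_homog 1 2). Qed.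

Definition cubic_homog := (X3_homog, Y3_homog, X2Y_homog, XY2_homog).

Lemma fv_pair1 a b x y :
  fv (pair1 (a, b)) (vec x y) = vec (x ^+ 3 + a * (x * y ^+ 2)) (b * (x ^+ 2 * y) + y ^+ 3).
Proof. by rewrite /fv /= !(mevalD, mevalZ, mevalM, rmorphXn) /= !mevalXU vec0 vec1. Qed.

Lemma fv_pair2 a b x y :
  fv (pair2 (a, b)) (vec x y) = vec (a * (x ^+ 2 * y) + y ^+ 3) (x ^+ 3 + b * (x * y ^+ 2)).
Proof. by rewrite /fv /= !(mevalD, mevalZ, mevalM, rmorphXn) /= !mevalXU vec0 vec1. Qed.

Lemma fv_pair3 a x y :
  fv (pair3 a) (vec x y) = vec (x ^+ 3 + a * y ^+ 3) (a * (x ^+ 2 * y)).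
Proof. by rewrite /fv /= !(mevalD, mevalZ, mevalM, rmorphXn) /= !mevalXU vec0 vec1. Qed.

Lemma pair1_endo a b : a * b != 1 -> is_endo 3 (pair1 (a, b)).
Proof.
move=> ab; apply/is_endoP; split; rewrite ?rpredD ?rpredZ ?cubic_homog // => v.
rewrite [v]vecP fv_pair1 !vec_neq0; move: (v 0 0) (v 1 0) => x y.
apply: contraTT; rewrite !negb_or !negbK => /andP[/eqP h1 /eqP h2].
have [y0|y0] := eqVneq y 0.
  by move: h1; rewrite y0 expr0n /= !mulr0 addr0 => /eqP; rewrite expf_eq0 /= => ->.
have [x0|x0] := eqVneq x 0.
  by move: h2; rewrite x0 expr0n /= mul0r mulr0 add0r => /eqP; rewrite expf_eq0 /= (negPf y0).
case/eqP: ab; apply: (mulIf (_ : x ^+ 2 * y ^+ 2 != 0)); first by rewrite mulf_neq0 ?expf_neq0.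
have h1' : x ^+ 2 = - a * y ^+ 2.
  by apply: (mulfI x0); apply: (lincomb1 (k := 1) h1); ring.
have h2' : y ^+ 2 = - b * x ^+ 2.
  by apply: (mulfI y0); apply: (lincomb1 (k := 1) h2); ring.
by apply: (lincomb2 (k := b * x ^+ 2) (k' := - x ^+ 2) h1' h2'); ring.
Qed.

Lemma pair2_endo a b : a * b != 1 -> is_endo 3 (pair2 (a, b)).
Proof.
move=> ab; apply/is_endoP; split; rewrite ?rpredD ?rpredZ ?cubic_homog // => v.
rewrite [v]vecP fv_pair2 !vec_neq0; move: (v 0 0) (v 1 0) => x y.
apply: contraTT; rewrite !negb_or !negbK => /andP[/eqP h1 /eqP h2].
have [y0|y0] := eqVneq y 0.
  by move: h2; rewrite y0 expr0n /= !mulr0 addr0 => /eqP; rewrite expf_eq0 /= => ->.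
have [x0|x0] := eqVneq x 0.
  by move: h1; rewrite x0 expr0n /= mul0r mulr0 add0r => /eqP; rewrite expf_eq0 /= (negPf y0).
case/eqP: ab; apply: (mulIf (_ : x ^+ 2 * y ^+ 2 != 0)); first by rewrite mulf_neq0 ?expf_neq0.
have h1' : y ^+ 2 = - a * x ^+ 2.
  by apply: (mulfI y0); apply: (lincomb1 (k := 1) h1); ring.
have h2' : x ^+ 2 = - b * y ^+ 2.
  by apply: (mulfI x0); apply: (lincomb1 (k := 1) h2); ring.
by apply: (lincomb2 (k := b * y ^+ 2) (k' := - y ^+ 2) h1' h2'); ring.
Qed.

Lemma pair3_endo a : a != 0 -> is_endo 3 (pair3 a).
Proof.
move=> a0; apply/is_endoP; split; rewrite ?rpredD ?rpredZ ?cubic_homog // => v.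
rewrite [v]vecP fv_pair3 !vec_neq0; move: (v 0 0) (v 1 0) => x y.
apply: contraTT; rewrite !negb_or !negbK => /andP[/eqP h1].
rewrite mulf_eq0 (negPf a0) /= mulf_eq0 expf_eq0 /= => /orP[/eqP x0|/eqP y0].
  by move: h1 => /eqP; rewrite x0 expr0n add0r mulf_eq0 (negPf a0) expf_eq0 eqxx.
by move: h1 => /eqP; rewrite y0 expr0n mulr0 addr0 expf_eq0 /= eqxx => ->.
Qed.

(** * Normal forms of automorphisms *)

Lemma eigenvector (A : 'M[algC]_2) : exists (v : 'cV[algC]_2) c, v != 0 /\ A *m v = c *: v.
Proof.
rewrite [A]matP; move: (A 0 0) (A 0 1) (A 1 0) (A 1 1) => a b c d.
(* [e] is a root of the characteristic polynomial by the quadratic formula. An eigenvector is read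
   from a nonzero row of A - e; if there is none, A is scalar. *)
pose r := sqrtC ((a - d) ^+ 2 + 4 * b * c); pose e := (a + d + r) / 2.
have r2 : r ^+ 2 = (a - d) ^+ 2 + 4 * b * c by rewrite sqrtCK.
have two : 2 != 0 :> algC by rewrite pnatr_eq0.
have de : (a - e) * (d - e) = b * c.
  by apply: (lincomb1 (k := 4^-1) r2); rewrite /e; field.
have [h|/norP[/negPn/eqP h1 /negPn/eqP h2]] := boolP ((b != 0) || (a - e != 0)).
  exists (vec b (e - a)), e; rewrite vec_neq0 -opprB oppr_eq0 h mat_vec scale_vec; split=> //.
  by congr vec; [ring|apply: (lincomb1 (k := -1) de); ring].
have [h|/norP[/negPn/eqP h3 /negPn/eqP h4]] := boolP ((c != 0) || (d - e != 0)).
  exists (vec (e - d) c), e; rewrite vec_neq0 orbC -opprB oppr_eq0 h mat_vec scale_vec; split=> //.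
  by congr vec; [apply: (lincomb1 (k := -1) de); ring|ring].
exists (vec 1 0), e; rewrite vec_neq0 oner_neq0 mat_vec scale_vec; split=> //.
by rewrite h3; congr vec; [apply: (lincomb1 (k := 1) h2)|]; ring.
Qed.

Lemma mat_triangular (A : 'M[algC]_2) : exists (g : 'M[algC]_2) c x d,
  g \in unitmx /\ A *m g = g *m mat c x 0 d.
Proof.
have [v [c [v0 Av]]] := eigenvector A.
have [g [ug gv]] : exists g : 'M[algC]_2, g \in unitmx /\ g *m vec 1 0 = v.
  have : (v 0 0 != 0) || (v 1 0 != 0) by rewrite -vec_neq0 -vecP.
  have [x0|x0 /= y0] := eqVneq (v 0 0) 0; [move=> /= y0; exists (mat (v 0 0) 1 (v 1 0) 0)|exists (mat (v 0 0) 0 (v 1 0) 1)].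
    rewrite mat_unit mat_vec [v in RHS]vecP !mulr1 !mulr0 !addr0 sub0r oppr_eq0 mul1r.
    by split.
  by rewrite mat_unit mat_vec [v in RHS]vecP !mulr1 !mulr0 !addr0 mul0r subr0.
have : invmx g *m A *m g *m vec 1 0 = c *: vec 1 0.
  by rewrite -2!mulmxA gv Av -scalemxAr -gv mulmxA mulVmx // mul1mx.
set B := invmx g *m A *m g => Be.
have [e1 e2] : B 0 0 = c /\ B 1 0 = 0.
  move: Be; rewrite [B in B *m _]matP mat_vec scale_vec !mulr1 !mulr0 !addr0.
  exact: vec2_inj.
exists g, c, (B 0 1), (B 1 1); split=> //.
by rewrite -e1 -e2 -matP /B !mulmxA mulmxV // mul1mx.
Qed.

Lemma mat_normal (A : 'M[algC]_2) : A \in unitmx ->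
  [\/ exists c, A = c%:M,
      exists (g : 'M[algC]_2) c l, [/\ g \in unitmx, c != 0, l != 0, l != 1 & A *m g = c *: (g *m mat l 0 0 1)]
    | exists (g : 'M[algC]_2) c, [/\ g \in unitmx, c != 0 & A *m g = c *: (g *m mat 1 1 0 1)]].
Proof.
move=> uA; have [g [c [x [d [ug Ag]]]]] := mat_triangular A.
have : mat c x 0 d \in unitmx by have := unitmx_mul A g; rewrite Ag unitmx_mul ug uA.
rewrite mat_unit mulr0 subr0 mulf_eq0 negb_or => /andP[c0 d0].
have [cd|cd] := eqVneq c d; last first.
  have dc : d - c != 0 by rewrite subr_eq0 eq_sym.
  constructor 2; exists (g *m mat 1 (x / (d - c)) 0 1), d, (c / d); split=> //.
  - by rewrite unitmx_mul ug mat_unit mulr0 subr0 mulr1 oner_neq0.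
  - by rewrite mulf_neq0 ?invr_eq0.
  - by apply: contraNneq cd => /(congr1 ( *%R^~ d)); rewrite divfK // mul1r => ->.
  rewrite mulmxA Ag -!mulmxA !scalemxAr; congr (_ *m _).
  by rewrite !scale_mat !mat_mul; congr mat; field; rewrite ?d0 ?dc.
have [x0|x0] := eqVneq x 0.
  constructor 1; exists d; rewrite -[A]mulmx1 -(mulmxV ug) mulmxA Ag cd x0 -mat_scalar.
  by rewrite scalar_mxC -mulmxA mulmxV // mulmx1.
constructor 3; exists (g *m mat 1 0 0 (d / x)), d; split=> //.
  by rewrite unitmx_mul ug mat_unit mulr0 subr0 mul1r mulf_neq0 ?invr_eq0.
rewrite mulmxA Ag -!mulmxA !scalemxAr; congr (_ *m _).
by rewrite !scale_mat !mat_mul cd; congr mat; field; rewrite ?x0.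
Qed.

Lemma conj_via_aut (f f' : endo_lift 3) A B g k c e : g \in unitmx -> k != 0 ->
  conj_via g e f f' -> A *m g = k *: (g *m B) -> conj_via A c f f -> conj_via B (c / k ^+ 2) f' f'.
Proof.
move=> ug k0 ff' Ag fA; have e0 := conj_via_neq0 ug ff'.
have := conj_via_comp (conj_via_comp (conj_via_inv ug e0 ff') fA) ff'.
rewrite -mulmxA Ag -scalemxAr mulmxA mulVmx // mul1mx => /(conj_via_scale _ _ _ _ k0).
by rewrite (mulrAC _ c) mulVf // mul1r.
Qed.

Definition nf1 (f : form2 * form2) (a b c d : algC) := forall x y,
  fv f (vec x y) = vec (a * x ^+ 3 + b * (x * y ^+ 2)) (c * (x ^+ 2 * y) + d * y ^+ 3).
Definition nf2 (f : form2 * form2) (a b c d : algC) := forall x y,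
  fv f (vec x y) = vec (a * (x ^+ 2 * y) + b * y ^+ 3) (c * x ^+ 3 + d * (x * y ^+ 2)).
Definition nf3 (f : form2 * form2) (a b c : algC) := forall x y,
  fv f (vec x y) = vec (a * x ^+ 3 + b * y ^+ 3) (c * (x ^+ 2 * y)).

Lemma cub10 a b c d : cub a b c d 1 0 = a. Proof. by rewrite /cub; ring. Qed.
Lemma cub01 a b c d : cub a b c d 0 1 = d. Proof. by rewrite /cub; ring. Qed.

(** Invariance under z |-> z + 1 forces the coefficients of x^3 in both components to vanish, so the
    fixed point (1 : 0) would be a common zero. Characteristic 0 enters through the integers 2 and
    3. *)
Lemma unipotent_aut (f : endo_lift 3) c : ~ conj_via (mat 1 1 0 1) c f f.
Proof.
move=> h; have [p3 [p2 [p1 [p0 [q3 [q2 [q1 [q0 fE]]]]]]]] := endo3_cub f.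
have two : 2 != 0 :> algC by rewrite pnatr_eq0.
have three : 3 != 0 :> algC by rewrite pnatr_eq0.
have [hp hq] : (forall x y, cub p3 (3 * p3 + p2) (3 * p3 + 2 * p2 + p1) (p3 + p2 + p1 + p0) x y =
     cub (c * (p3 + q3)) (c * (p2 + q2)) (c * (p1 + q1)) (c * (p0 + q0)) x y) /\
  (forall x y, cub q3 (3 * q3 + q2) (3 * q3 + 2 * q2 + q1) (q3 + q2 + q1 + q0) x y =
     cub (c * q3) (c * q2) (c * q1) (c * q0) x y).
  split=> x y; have := h (vec x y); rewrite mat_vec !mul1r mul0r add0r !fE mat_vec scale_vec => e; have [e1 e2] := vec2_inj e.
    by apply: (lincomb1 (k := 1) e1); rewrite /cub; ring.
  by apply: (lincomb1 (k := 1) e2); rewrite /cub; ring.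
have [a3 a2 a1 a0] := cub_inj hp; have [b3 b2 b1 b0] := cub_inj hq.
have nz x y : (x != 0) || (y != 0) -> (cub p3 p2 p1 p0 x y != 0) || (cub q3 q2 q1 q0 x y != 0).
  by rewrite -!vec_neq0 -fE; apply: endo_fv_neq0.
have [c1|c1] := eqVneq c 1.
  rewrite c1 in a3 a2 a1 a0 b3 b2 b1 b0.
  have z3 : q3 = 0 by apply: (mulfI three); apply: (lincomb1 (k := 1) b2); ring.
  have z2 : q2 = 0 by apply: (mulfI two); rewrite z3 in b1; apply: (lincomb1 (k := 1) b1); ring.
  have t3 : p3 = 0 by apply: (mulfI three); rewrite z2 in a2; apply: (lincomb1 (k := 1) a2); ring.
  by have := nz 1 0; rewrite oner_neq0 !cub10 t3 z3 eqxx => /(_ isT).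
have zero (q r : algC) : r = 0 -> r + q = c * q -> q = 0.
  move=> -> /eqP; rewrite add0r -[q in X in X == _]mul1r -subr_eq0 -mulrBl mulf_eq0 subr_eq0 eq_sym (negPf c1).
  by move=> /eqP.
have z3 : q3 = 0 by apply: (zero _ 0); rewrite ?add0r.
have z2 : q2 = 0 by apply: (zero _ (3 * q3)); rewrite ?z3 ?mulr0 //; move: b2; rewrite z3 mulr0.
have z1 : q1 = 0 by apply: (zero _ (3 * q3 + 2 * q2)); rewrite ?z3 ?z2 ?mulr0 ?addr0 //; move: b1; rewrite z3 z2 !mulr0 addr0.
have t3 : p3 = 0 by apply: (zero _ 0); rewrite ?add0r // {1}a3 z3 addr0.
by have := nz 1 0; rewrite oner_neq0 !cub10 t3 z3 eqxx => /(_ isT).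
Qed.

(** The coefficient of x^i survives in the numerator only if l^i = cl, in the denominator only if
    l^i = c. Since (1 : 0) and (0 : 1) are not common zeros, a coefficient of x^3 and one of y^3
    survive. Their positions give four combinations: l^2 = 1 ([nf1]), l^3 = 1 twice ([nf3] and its
    mirror image under exchange of coordinates), and l^4 = 1, which splits into [nf2] and the map
    1/z^3 up to scaling. *)
Lemma diag_aut (f : endo_lift 3) l c : l != 0 -> l != 1 -> conj_via (mat l 0 0 1) c f f ->
  [\/ [/\ l = -1, c = 1 & exists a b c d, nf1 f a b c d],
      [/\ l = -1, c = -1 & exists a b c d, nf2 f a b c d],
      l ^+ 3 = 1 /\ exists a b c, nf3 f a b c
    | l ^+ 3 = 1 /\ (exists a b c, forall x y, fv f (vec x y) = vec (c * (x * y ^+ 2)) (a * x ^+ 3 + b * y ^+ 3))]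
  \/ [/\ l ^+ 4 = 1, l ^+ 2 != 1 & exists b c, nf2 f 0 b c 0].
Proof.
move=> l0 l1 h; have [p3 [p2 [p1 [p0 [q3 [q2 [q1 [q0 fE]]]]]]]] := endo3_cub f.
have [hp hq] : (forall x y, cub (l ^+ 3 * p3) (l ^+ 2 * p2) (l * p1) p0 x y =
     cub (c * l * p3) (c * l * p2) (c * l * p1) (c * l * p0) x y) /\
  (forall x y, cub (l ^+ 3 * q3) (l ^+ 2 * q2) (l * q1) q0 x y =
     cub (c * q3) (c * q2) (c * q1) (c * q0) x y).
  split=> x y; have := h (vec x y); rewrite mat_vec !mul1r !mul0r add0r addr0 !fE mat_vec scale_vec => e; have [e1 e2] := vec2_inj e.
    by apply: (lincomb1 (k := 1) e1); rewrite /cub; ring.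
  by apply: (lincomb1 (k := 1) e2); rewrite /cub; ring.
have [a3 a2 a1 a0] := cub_inj hp; have [b3 b2 b1 b0] := cub_inj hq.
have nz x y : (x != 0) || (y != 0) -> (cub p3 p2 p1 p0 x y != 0) || (cub q3 q2 q1 q0 x y != 0).
  by rewrite -!vec_neq0 -fE; apply: endo_fv_neq0.
have n3 : (p3 != 0) || (q3 != 0).
  by have := nz 1 0; rewrite oner_neq0 !cub10; apply.
have n0 : (p0 != 0) || (q0 != 0).
  by have := nz 0 1; rewrite oner_neq0 orbT !cub01; apply.
rewrite -[p0 in X in X = _]mul1r in a0; rewrite -[q0 in X in X = _]mul1r in b0.
have kill (q r s : algC) : r * q = s * q -> r != s -> q = 0.
  by move=> /eqP; rewrite -subr_eq0 -mulrBl mulf_eq0 subr_eq0 => /orP[->|/eqP].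
have onen : -1 != 1 :> algC by rewrite eq_sym -subr_eq0 opprK -mulr2n pnatr_eq0.
have l2N : l ^+ 2 = 1 -> l = -1.
  by move=> /eqP; rewrite sqrf_eq1 (negPf l1) => /eqP.
have [p30|p30] := eqVneq p3 0; last first.
  have ec : c = l ^+ 2.
    by apply: (mulIf (mulf_neq0 l0 p30)); apply: (lincomb1 (k := -1) a3); ring.
  have [p00|p00] := eqVneq p0 0; last first.
    have el : l ^+ 3 = 1 by apply: (mulIf p00); rewrite a0 ec; ring.
    have l2 : l ^+ 2 != 1.
      by apply/eqP => e2; case/eqP: l1; rewrite -el exprS e2 mulr1.
    left; constructor 3; split=> //; exists p3, p0, q2 => x y; rewrite fE /cub.
    have cl : c * l = 1 by rewrite ec -exprSr.
    rewrite cl in a2 a1 a0; rewrite ec in b3 b2 b1 b0.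
    rewrite (kill _ _ _ a2 l2) (kill _ _ _ a1 l1).
    rewrite (kill _ _ _ b3) ?(kill _ _ _ b1) ?(kill _ _ _ b0) 1?eq_sym ?el //; first by congr vec; ring.
    by rewrite -[X in _ != X]mulr1 (inj_eq (mulfI l0)).
  rewrite p00 eqxx in n0.
  have c1 : c = 1 by apply: (mulIf n0); rewrite -b0.
  have el : l = -1 by apply: l2N; rewrite -ec.
  left; constructor 1; split=> //; exists p3, p1, q2, q0 => x y; rewrite fE /cub.
  rewrite c1 el in a2 b3 b1; rewrite p00 (kill _ _ _ a2) ?(kill _ _ _ b3) ?(kill _ _ _ b1) //.
  - by congr vec; ring.
  - by rewrite exprS sqrrN expr1n mulr1.
  - by rewrite sqrrN expr1n mul1r eq_sym.
rewrite p30 eqxx in n3.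
have ec : c = l ^+ 3 by apply: (mulIf n3).
have [p00|p00] := eqVneq p0 0.
  rewrite p00 eqxx in n0.
  have c1 : c = 1 by apply: (mulIf n0); rewrite -b0.
  have el : l ^+ 3 = 1 by rewrite -ec.
  have l2 : l ^+ 2 != 1.
    by apply/eqP => e2; case/eqP: l1; rewrite -el exprS e2 mulr1.
  left; constructor 4; split=> //; exists q3, q0, p1 => x y; rewrite fE /cub.
  rewrite c1 in a2 b2 b1; rewrite p30 p00 (kill _ _ _ a2) ?(kill _ _ _ b2) ?(kill _ _ _ b1) //.
    by congr vec; ring.
  by rewrite mul1r -[X in _ != X]mulr1 (inj_eq (mulfI l0)).
have el : l ^+ 4 = 1 by apply: (mulIf p00); rewrite a0 ec; ring.
have [/l2N eN|l2] := eqVneq (l ^+ 2) 1.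
  have cN : c = -1 by rewrite ec eN exprS sqrrN expr1n mulr1.
  left; constructor 2; split=> //; exists p2, p0, q3, q1 => x y; rewrite fE /cub.
  rewrite cN eN in a1 b2 b0.
  rewrite p30 (kill _ _ _ a1) ?(kill _ _ _ b2) ?(kill _ _ _ b0) 1?eq_sym //.
  - by congr vec; ring.
  - by rewrite sqrrN expr1n.
  - by rewrite mulrNN mulr1 eq_sym.
right; split=> //; exists p0, q3 => x y; rewrite fE /cub.
have cl : c * l = 1 by rewrite ec -exprSr.
have l3 : l ^+ 3 != 1.
  by apply/eqP => e3; case/eqP: l1; rewrite -el exprS e3 mulr1.
rewrite cl in a2 a1; rewrite ec in b2 b1 b0.
have l32 : l ^+ 2 != l ^+ 3 by rewrite [X in _ != X]exprSr -{1}[l ^+ 2]mulr1 (inj_eq (mulfI (expf_neq0 2 l0))) eq_sym.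
have l31 : l != l ^+ 3 by rewrite exprS -{1}[l]mulr1 (inj_eq (mulfI l0)) eq_sym.
have l30 : 1 != l ^+ 3 by rewrite eq_sym.
rewrite p30 (kill _ _ _ a2 l2) (kill _ _ _ a1 l1) (kill _ _ _ b2 l32) (kill _ _ _ b1 l31) (kill _ _ _ b0 l30).
by congr vec; ring.
Qed.

Lemma class_of_pairP d (f : endo_lift d) F : class_of_pair F (moduli_class f) <->
  is_endo d F /\ exists A c, [/\ A \in unitmx, c != 0 & conj_via A c f F].
Proof.
split=> [[g <- /moduli_classP h]|[hF h]]; first by split=> //; apply: endo_liftP.
by exists (mk_lift hF) => //; apply/moduli_classP.
Qed.

Lemma class_of_pair_eq d F (m m' : Moduli d) : class_of_pair F m -> class_of_pair F m' -> m = m'.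
Proof. by move=> [f ef ->] [g eg ->]; rewrite (_ : f = g) //; apply: val_inj; rewrite /= ef. Qed.

Lemma onen : -1 != 1 :> algC.
Proof. by rewrite eq_sym -subr_eq0 opprK -mulr2n pnatr_eq0. Qed.

(* The eigenvalue -1 has neither order 3 nor order 4. *)
Lemma neg_diag_aut (f : endo_lift 3) e : conj_via (mat (-1) 0 0 1) e f f ->
  (e = 1 /\ exists a b c d, nf1 f a b c d) \/ (e = -1 /\ exists a b c d, nf2 f a b c d).
Proof.
have N0 : -1 != 0 :> algC by rewrite oppr_eq0 oner_neq0.
have N3 : (-1 : algC) ^+ 3 <> 1.
  by rewrite exprS sqrrN expr1n mulr1 => /eqP; rewrite (negPf onen).
move=> /(diag_aut N0 onen)[[[_ -> h]|[_ -> h]|[/N3]|[/N3]]|[_ + _]] //; [by left|by right|].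
by rewrite sqrrN expr1n eqxx.
Qed.

Lemma nf1_class (f : endo_lift 3) a b c d : nf1 f a b c d ->
  [/\ a != 0, d != 0, b * c != a * d & class_of_pair (pair1 (b / d, c / a)) (moduli_class f)].
Proof.
move=> fE.
have nz x y := @endo_fv_neq0 3 f (vec x y).
have a0 : a != 0.
  have e10 : fv f (vec 1 0) = vec a 0 by rewrite fE; congr vec; ring.
  by have := nz 1 0; rewrite e10 !vec_neq0 oner_neq0 eqxx /= orbF; apply.
have d0 : d != 0.
  have e01 : fv f (vec 0 1) = vec 0 d by rewrite fE; congr vec; ring.
  by have := nz 0 1; rewrite e01 !vec_neq0 oner_neq0 eqxx /=; apply.
have bc : b * c != a * d.
  apply/eqP => bc; pose x := sqrtC (- b / a).
  have x2 : x ^+ 2 = - b / a by rewrite sqrtCK.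
  have := nz x 1; rewrite fE !vec_neq0 oner_neq0 orbT => /(_ isT)/orP[]/eqP; apply.
    by rewrite expr1n mulr1 exprS x2; field.
  by rewrite x2 expr1n !mulr1; apply: (lincomb1 (k := - a^-1) bc); field.
split=> //; apply/class_of_pairP; split.
  apply: pair1_endo; apply: contra bc => /eqP/(congr1 ( *%R (a * d))) e.
  by apply/eqP; apply: (lincomb1 (k := 1) e); field; rewrite a0 d0.
pose t := sqrtC (d / a).
have t2 : t ^+ 2 = d / a by rewrite sqrtCK.
have t0 : t != 0 by rewrite -sqrf_eq0 t2 mulf_neq0 ?invr_eq0.
exists (mat t 0 0 1), d; split=> //; first by rewrite mat_unit mulr1 mulr0 subr0.
move=> v; rewrite [v]vecP mat_vec !mul0r addr0 add0r mul1r fE fv_pair1 mat_vec scale_vec.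
move: (v 0 0) (v 1 0) => x y; congr vec.
  by apply: (lincomb1 (k := a * t * x ^+ 3) t2); field; rewrite a0 d0.
by apply: (lincomb1 (k := c * x ^+ 2 * y) t2); field; rewrite a0 d0.
Qed.

(** The root [s] is left to the caller because both signs are legitimate: the parameters of the
    second surface are determined only up to a common sign. *)
Lemma nf2_class (f : endo_lift 3) a b c d s : nf2 f a b c d -> s ^+ 2 = b * c ->
  [/\ b != 0, c != 0, a * d != b * c & class_of_pair (pair2 (a / s, d / s)) (moduli_class f)].
Proof.
move=> fE s2.
have nz x y := @endo_fv_neq0 3 f (vec x y).
have c0 : c != 0.
  have e10 : fv f (vec 1 0) = vec 0 c by rewrite fE; congr vec; ring.
  by have := nz 1 0; rewrite e10 !vec_neq0 oner_neq0 eqxx /=; apply.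
have b0 : b != 0.
  have e01 : fv f (vec 0 1) = vec b 0 by rewrite fE; congr vec; ring.
  by have := nz 0 1; rewrite e01 !vec_neq0 oner_neq0 eqxx /= orbF; apply.
have ad : a * d != b * c.
  apply/eqP => ad; pose x := sqrtC (- d / c).
  have x2 : x ^+ 2 = - d / c by rewrite sqrtCK.
  have := nz x 1; rewrite fE !vec_neq0 oner_neq0 orbT => /(_ isT)/orP[]/eqP; apply.
    by rewrite x2 expr1n !mulr1; apply: (lincomb1 (k := - c^-1) ad); field.
  by rewrite expr1n mulr1 exprS x2; field.
have s0 : s != 0 by rewrite -sqrf_eq0 s2 mulf_neq0.
split=> //; apply/class_of_pairP; split.
  apply: pair2_endo; apply: contra ad => /eqP/(congr1 ( *%R (s ^+ 2))) e.
  by apply/eqP; rewrite -s2; apply: (lincomb1 (k := 1) e); field.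
(* With this choice t^4 = b / c, which makes the two extreme coefficients agree after rescaling. *)
pose t := sqrtC (b / s).
have t2 : t ^+ 2 = b / s by rewrite sqrtCK.
have t0 : t != 0 by rewrite -sqrf_eq0 t2 mulf_neq0 ?invr_eq0.
exists (mat t 0 0 1), (b / t); split=> //; first by rewrite mat_unit mulr1 mulr0 subr0.
  by rewrite mulf_neq0 ?invr_eq0.
move=> v; rewrite [v]vecP mat_vec !mul0r addr0 add0r mul1r fE fv_pair2 mat_vec scale_vec.
move: (v 0 0) (v 1 0) => x y; congr vec.
  by apply: (lincomb1 (k := a * x ^+ 2 * y) t2); field; rewrite t0 s0.
have bs : b = t ^+ 2 * s by rewrite t2 divfK.
have e4 : c * t ^+ 4 = b.
  apply: (mulIf b0); rewrite {2}bs -[4%N]/(2 + 2)%N exprD t2.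
  by apply: (lincomb1 (k := - b ^+ 2 / s ^+ 2) s2); field.
have e2 : d * t ^+ 2 = d * b / s by rewrite t2 mulrA.
by apply: (mulfI t0); apply: (lincomb2 (k := x ^+ 3) (k' := x * y ^+ 2) e4 e2); field; rewrite t0 s0.
Qed.

Lemma nf3_class (f : endo_lift 3) a b c : nf3 f a b c ->
  [/\ a != 0, b != 0, c != 0 & class_of_pair (pair3 (c / a)) (moduli_class f)].
Proof.
move=> fE.
have nz x y := @endo_fv_neq0 3 f (vec x y).
have a0 : a != 0.
  have e10 : fv f (vec 1 0) = vec a 0 by rewrite fE; congr vec; ring.
  by have := nz 1 0; rewrite e10 !vec_neq0 oner_neq0 eqxx /= orbF; apply.
have b0 : b != 0.
  have e01 : fv f (vec 0 1) = vec b 0 by rewrite fE; congr vec; ring.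
  by have := nz 0 1; rewrite e01 !vec_neq0 oner_neq0 eqxx /= orbF; apply.
have c0 : c != 0.
  apply/eqP => c0; pose x := 3.-root (- b / a).
  have x3 : x ^+ 3 = - b / a by rewrite rootCK.
  have := nz x 1; rewrite fE !vec_neq0 oner_neq0 orbT => /(_ isT).
  by rewrite c0 mul0r eqxx orbF x3 expr1n mulr1 mulrC divfK // addNr eqxx.
split=> //; apply/class_of_pairP; split; first by apply: pair3_endo; rewrite mulf_neq0 ?invr_eq0.
pose t := 3.-root (b / c).
have t3 : t ^+ 3 = b / c by rewrite rootCK.
have t0 : t != 0 by apply: contraTneq (mulf_neq0 b0 (invr_neq0 c0)) => e; rewrite -t3 e expr0n eqxx.
exists (mat t 0 0 1), (a * t ^+ 2); split=> //; first by rewrite mat_unit mulr1 mulr0 subr0.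
  by rewrite mulf_neq0 ?expf_neq0.
move=> v; rewrite [v]vecP mat_vec !mul0r addr0 add0r mul1r fE fv_pair3 mat_vec scale_vec.
move: (v 0 0) (v 1 0) => x y; congr vec; last by field.
by apply: (lincomb1 (k := - c * y ^+ 3) t3); field; rewrite a0 c0.
Qed.

Lemma aut_unique d (f : endo_lift d) A c c' : A \in unitmx ->
  conj_via A c f f -> conj_via A c' f f -> c = c'.
Proof.
move=> uA h h'; have e : vec 1 0 != 0 :> 'cV[algC]_2 by rewrite vec_neq0 oner_neq0.
have := unitmx_neq0 uA (endo_fv_neq0 f e); have := h (vec 1 0); rewrite h' => /eqP.
rewrite -subr_eq0 -scalerBl scaler_eq0 subr_eq0 => /orP[/eqP -> //|/eqP ->].
by rewrite eqxx.
Qed.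

(** * Types of involutions *)

(* An involution A of PGL_2, with A^2 = s, satisfies f(Av) = s A f(v) or
   f(Av) = - s A f(v), according to whether f fixes or exchanges the two fixed
   points of A. *)
Definition involution (e : algC) (f : form2 * form2) (A : 'M[algC]_2) :=
  exists s, [/\ s != 0, A *m A = s%:M, (forall c, A <> c%:M) & conj_via A (e * s) f f].

Lemma involution_traceless (A : 'M[algC]_2) s : A *m A = s%:M -> (forall c, A <> c%:M) ->
  A 1 1 = - A 0 0.
Proof.
rewrite [A]matP mat_mul !mat_scalar !mxE /=; move: (A 0 0) (A 0 1) (A 1 0) (A 1 1) => x y z w.
move=> /mat_inj[h1 h2 h3 h4] nA.
have [/eqP|xw] := eqVneq (x + w) 0; first by rewrite addrC addr_eq0 => /eqP.
have y0 : y = 0 by apply: (mulfI xw); apply: (lincomb1 (k := 1) h2); ring.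
have z0 : z = 0 by apply: (mulfI xw); apply: (lincomb1 (k := 1) h3); ring.
case: (nA x); rewrite y0 z0 mat_scalar; congr mat.
apply/esym/eqP; rewrite -subr_eq0; apply/eqP; apply: (mulfI xw).
by rewrite y0 z0 in h1 h4; apply: (lincomb2 (k := 1) (k' := -1) h1 h4); ring.
Qed.

Lemma square_unit (A : 'M[algC]_2) s : s != 0 -> A *m A = s%:M -> A \in unitmx.
Proof.
move=> s0 AA; have : (s%:M : 'M[algC]_2) \in unitmx by rewrite unitmxE det_scalar unitfE expf_neq0.
by rewrite -AA unitmx_mul andbb.
Qed.

Lemma involution_diag (A : 'M[algC]_2) s : s != 0 -> A *m A = s%:M -> (forall c, A <> c%:M) ->
  exists g c, [/\ g \in unitmx, c != 0, c ^+ 2 = s & A *m g = c *: (g *m mat (-1) 0 0 1)].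
Proof.
move=> s0 AA nA; have uA := square_unit s0 AA.
have sq g c B : g \in unitmx -> A *m g = c *: (g *m B) -> c ^+ 2 *: (B *m B) = s%:M.
  move=> ug Ag; have : A *m A *m g = c ^+ 2 *: (g *m (B *m B)).
    by rewrite -mulmxA Ag -scalemxAr (mulmxA A g) Ag -scalemxAl scalerA -mulmxA expr2.
  rewrite AA -scalar_mxC scalemxAr => /(congr1 (mulmx (invmx g))).
  by rewrite !mulmxA mulVmx // !mul1mx.
have [[c /nA]|[g [c [l [ug c0 l0 l1 Ag]]]]|[g [c [ug c0 Ag]]]] // := mat_normal uA.
  exists g, c; have := sq _ _ _ ug Ag; rewrite mat_mul scale_mat mat_scalar => /mat_inj[].
  move=> e1 _ _ e2; split=> //; first by rewrite -e2; ring.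
  suff /eqP : l ^+ 2 = 1 by rewrite sqrf_eq1 (negPf l1) => /eqP <-.
  apply: (mulfI (expf_neq0 2 c0)); apply: (lincomb2 (k := 1) (k' := -1) e1 e2); ring.
have := sq _ _ _ ug Ag; rewrite mat_mul scale_mat mat_scalar => /mat_inj[_ /eqP + _ _].
by rewrite mulf_eq0 expf_eq0 /= (negPf c0) !mul1r -mulr2n pnatr_eq0.
Qed.

Lemma involution_nf (f : endo_lift 3) A e : involution e f A -> e ^+ 2 = 1 ->
  exists f' : endo_lift 3, moduli_class f = moduli_class f' /\
   ((e = 1 /\ exists a b c d, nf1 f' a b c d) \/ (e = -1 /\ exists a b c d, nf2 f' a b c d)).
Proof.
move=> [s [s0 AA nA fA]] e2.
have [g [c [ug c0 c2 Ag]]] := involution_diag s0 AA nA.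
have [f' ff'] := lift_conj_via f ug; exists f'; split.
  by apply/moduli_classP; exists g, 1; rewrite oner_neq0.
have := conj_via_aut ug c0 ff' Ag fA; by rewrite c2 mulfK // => /neg_diag_aut.
Qed.

Lemma involution_conj (f f' : endo_lift 3) A e g c : g \in unitmx -> conj_via g c f f' ->
  involution e f A -> involution e f' (invmx g *m A *m g).
Proof.
move=> ug ff' [s [s0 AA nA fA]]; set B := invmx g *m A *m g.
have gB : A *m g = g *m B by rewrite /B !mulmxA mulmxV // mul1mx.
exists s; split=> //.
- apply: (can_inj (mulKmx ug)); rewrite mulmxA -gB -mulmxA -gB mulmxA AA.
  by rewrite scalar_mxC.
- move=> k ek; apply: (nA k); apply: (can_inj (mulmxK ug)).
  by rewrite gB ek scalar_mxC.
- have := conj_via_aut ug (oner_neq0 _) ff' (_ : A *m g = 1 *: (g *m B)) fA.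
  by rewrite expr1n divr1; apply; rewrite scale1r.
Qed.

Definition dmat : 'M[algC]_2 := mat (-1) 0 0 1.
Definition jmat : 'M[algC]_2 := mat 0 1 1 0.

Lemma dmat_nonscalar c : dmat <> c%:M.
Proof. by rewrite mat_scalar => /mat_inj[<- _ _ /eqP]; rewrite eq_sym (negPf onen). Qed.
Lemma jmat_nonscalar c : jmat <> c%:M.
Proof. by rewrite mat_scalar => /mat_inj[_ /eqP]; rewrite oner_eq0. Qed.
Lemma dmat2 : dmat *m dmat = 1%:M.
Proof. by rewrite mat_mul mat_scalar; congr mat; ring. Qed.
Lemma jmat2 : jmat *m jmat = 1%:M.
Proof. by rewrite mat_mul mat_scalar; congr mat; ring. Qed.
Lemma dmat_jmat : dmat *m jmat = - (jmat *m dmat).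
Proof. by rewrite !mat_mul -scaleN1r scale_mat; congr mat; ring. Qed.

Lemma pair1_involution a b : involution 1 (pair1 (a, b)) dmat.
Proof.
exists 1; split; rewrite ?oner_neq0 ?dmat2 //; first exact: dmat_nonscalar.
by move=> v; rewrite [v]vecP mat_vec !fv_pair1 mat_vec scale_vec; congr vec; ring.
Qed.

Lemma pair2_involution a b : involution (-1) (pair2 (a, b)) dmat.
Proof.
exists 1; split; rewrite ?oner_neq0 ?dmat2 //; first exact: dmat_nonscalar.
by move=> v; rewrite [v]vecP mat_vec !fv_pair2 mat_vec scale_vec; congr vec; ring.
Qed.

Lemma pair2_swap_involution a : involution 1 (pair2 (a, a)) jmat.
Proof.
exists 1; split; rewrite ?oner_neq0 ?jmat2 //; first exact: jmat_nonscalar.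
by move=> v; rewrite [v]vecP mat_vec !fv_pair2 mat_vec scale_vec; congr vec; ring.
Qed.

Lemma eqN0 (V : lmodType algC) (v : V) : v = - v -> v = 0.
Proof.
move=> /eqP; rewrite -subr_eq0 opprK -mulr2n -scaler_nat scaler_eq0 pnatr_eq0 /=.
by move=> /eqP.
Qed.

Definition pairK2 (a : algC) : form2 * form2 :=
  (a *: (X ^+ 2 * Y) - Y ^+ 3, X ^+ 3 - a *: (X * Y ^+ 2)).

Lemma fv_pairK2 a x y :
  fv (pairK2 a) (vec x y) = vec (a * (x ^+ 2 * y) - y ^+ 3) (x ^+ 3 - a * (x * y ^+ 2)).
Proof. by rewrite /fv /= !(mevalB, mevalZ, mevalM, rmorphXn) /= !mevalXU vec0 vec1. Qed.

(** All Klein four-groups of PGL_2 are conjugate: once [A] is diagonal, anticommutation makes [B]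
    antidiagonal, and rescaling one basis vector makes it a multiple of [jmat]. *)
Lemma V4_basis (A B : 'M[algC]_2) s t : s != 0 -> t != 0 -> A *m A = s%:M -> B *m B = t%:M ->
  A *m B = - (B *m A) ->
  exists g c k, [/\ g \in unitmx, c ^+ 2 = s, k ^+ 2 = t,
     A *m g = c *: (g *m dmat) & B *m g = k *: (g *m jmat)].
Proof.
move=> s0 t0 AA BB AB.
have uB := square_unit t0 BB; have uA := square_unit s0 AA.
have nA c : A <> c%:M.
  move=> ec; move: AB; rewrite {1}ec -scalar_mxC -ec => /eqN0 BA0.
  have AB0 : A *m B = 0 by rewrite ec -scalar_mxC -ec.
  by have := unitmx_mul A B; rewrite uA uB AB0 unitr0.
have [g [c [ug c0 c2 Ag]]] := involution_diag s0 AA nA.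
pose B' := invmx g *m B *m g.
have gB : B *m g = g *m B' by rewrite /B' !mulmxA mulmxV // mul1mx.
have BB' : B' *m B' = t%:M.
  by apply: (can_inj (mulKmx ug)); rewrite mulmxA -gB -mulmxA -gB mulmxA BB scalar_mxC.
have DB : dmat *m B' = - (B' *m dmat).
  apply: (can_inj (mulKmx ug)); apply: (scalerI c0); rewrite mulmxN scalerN.
  rewrite [g *m (B' *m _)]mulmxA -gB -mulmxA [in RHS]scalemxAr -Ag mulmxA scalemxAl -Ag.
  by rewrite -mulmxA -gB !mulmxA AB mulNmx.
move: BB' DB gB; rewrite [B']matP; move: (B' 0 0) (B' 0 1) (B' 1 0) (B' 1 1) => x p q w.
rewrite !mat_mul mat_scalar -scaleN1r scale_mat => /mat_inj[e1 _ _ _] /mat_inj[d1 _ _ d2] gB.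
have x0 : x = 0 by apply: (@eqN0 algC^o); apply: (lincomb1 (k := -1) d1); ring.
have w0 : w = 0 by apply: (@eqN0 algC^o); apply: (lincomb1 (k := 1) d2); ring.
rewrite x0 w0 mul0r add0r in e1 gB.
have q0 : q != 0 by apply: contraNneq t0 => z; rewrite -e1 z mulr0.
have p0 : p != 0 by apply: contraNneq t0 => z; rewrite -e1 z mul0r.
(* Scaling the first basis vector by [r] turns the off-diagonal entries into p / r and q r, which
   this choice makes equal. *)
pose r := sqrtC (p / q); have r2 : r ^+ 2 = p / q by rewrite sqrtCK.
have r0 : r != 0 by rewrite -sqrf_eq0 r2 mulf_neq0 ?invr_eq0.
exists (g *m mat r 0 0 1), c, (q * r); split=> //.
- by rewrite unitmx_mul ug mat_unit mulr0 subr0 mulr1.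
- by rewrite exprMn r2 -e1; field.
- rewrite mulmxA Ag -scalemxAl -!mulmxA; congr (_ *: (_ *m _)).
  by rewrite !mat_mul; congr mat; ring.
- rewrite mulmxA gB -!mulmxA scalemxAr; congr (_ *m _); rewrite !mat_mul scale_mat; congr mat; try ring.
  by apply: (lincomb1 (k := - q) r2); field.
Qed.

(** The square of AB is - s t, while the scalars multiply to e e' s t; comparing the two gives the
    sign. *)
Lemma involution_mul f (A B : 'M[algC]_2) e e' : involution e f A -> involution e' f B ->
  A *m B = - (B *m A) -> involution (- e * e') f (A *m B).
Proof.
move=> [s [s0 AA nA fA]] [t [t0 BB nB fB]] AB; exists (- (s * t)); split.
- by rewrite oppr_eq0 mulf_neq0.
- rewrite mulmxA -(mulmxA A) -[B *m A]opprK -AB mulmxN mulNmx !mulmxA AA -mulmxA BB.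
  by rewrite -scalar_mxM raddfN.
- move=> c ec; have uA := square_unit s0 AA; have uB := square_unit t0 BB.
  have h : A *m (A *m B) = - (A *m B *m A) by rewrite {1}AB mulmxN mulmxA.
  rewrite ec scalar_mxC -ec in h; have h0 := eqN0 h.
  by have := unitmx_mul (A *m B) A; rewrite h0 unitmx_mul uA uB unitr0.
- by have := conj_via_comp fA fB; rewrite (_ : e * s * (e' * t) = - e * e' * - (s * t)) //; ring.
Qed.

(** In the basis of [V4_basis] the involution [A] leaves the form [nf2], and the exchange of
    coordinates ties its coefficients in pairs up to the sign [e]. The two signs lead to the two
    curves. *)
Lemma V4_nf (f : endo_lift 3) A B e : involution (-1) f A -> involution e f B ->
  A *m B = - (B *m A) -> exists f' : endo_lift 3, moduli_class f = moduli_class f' /\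
  exists a b, [/\ b != 0, a ^+ 2 != b ^+ 2 & nf2 f' (e * a) (e * b) b a].
Proof.
move=> [s [s0 AA nA fA]] [t [t0 BB nB fB]] AB.
have [g [c [k [ug c2 k2 Ag Bg]]]] := V4_basis s0 t0 AA BB AB.
have c0 : c != 0 by rewrite -sqrf_eq0 c2.
have k0 : k != 0 by rewrite -sqrf_eq0 k2.
have [f' ff'] := lift_conj_via f ug; exists f'; split.
  by apply/moduli_classP; exists g, 1; rewrite oner_neq0.
have := conj_via_aut ug k0 ff' Bg fB; rewrite k2 mulfK // => hJ.
have iD : involution (-1) f' dmat.
  exists 1; rewrite oner_neq0 dmat2; split=> //; first exact: dmat_nonscalar.
  by have := conj_via_aut ug c0 ff' Ag fA; rewrite c2 mulfK // mulr1.
have [s' [s'0 DD _ hD]] := iD.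
have e1 : s' = 1.
  by move: DD; rewrite dmat2 !mat_scalar => /mat_inj[<-].
rewrite e1 mulr1 in hD.
have [[/eqP]|[_ [a [b [p [q nf]]]]]] := neg_diag_aut hD.
  by rewrite (negPf onen).
have [b0 p0 ad _] := nf2_class nf (sqrtCK _).
have J x y : a * (y ^+ 2 * x) + b * x ^+ 3 = e * (p * x ^+ 3 + q * (x * y ^+ 2)) /\
   p * y ^+ 3 + q * (y * x ^+ 2) = e * (a * (x ^+ 2 * y) + b * y ^+ 3).
  have := hJ (vec x y); rewrite mat_vec !mul0r !mul1r addr0 add0r !nf mat_vec scale_vec.
  by rewrite !mul0r !mul1r addr0 add0r => /vec2_inj.
have eb : b = e * p by have [h _] := J 1 0; apply: (lincomb1 (k := 1) h); ring.
have ea : a = e * q.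
  by have [h _] := J 1 1; apply: (lincomb2 (k := 1) (k' := -1) h eb); ring.
have ee : e ^+ 2 = 1.
  apply: (mulIf p0); have [_ h] := J 0 1; rewrite eb in h; apply: (lincomb1 (k := -1) h); ring.
exists q, p; split=> //; last by move=> x y; rewrite nf ea eb.
apply: contra ad => /eqP h; apply/eqP; rewrite ea eb; apply: (lincomb1 (k := e) h); ring.
Qed.

Lemma V4_pairK1 (f : endo_lift 3) A B : involution (-1) f A -> involution 1 f B ->
  A *m B = - (B *m A) -> exists a, a ^+ 2 != 1 /\ class_of_pair (pair2 (a, a)) (moduli_class f).
Proof.
move=> iA iB AB; have [f' [-> [a [b [b0 ab nf]]]]] := V4_nf iA iB AB.
rewrite !mul1r in nf; have [_ _ _ h] := nf2_class nf (expr2 _).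
by exists (a / b); split=> //; rewrite expr_div_n -[1](divff (expf_neq0 2 b0)) (inj_eq (divIf (expf_neq0 2 b0))).
Qed.

Lemma pairK2_endo a : a ^+ 2 != 1 -> is_endo 3 (pairK2 a).
Proof.
move=> a2.
have : is_endo 3 (pair2 (- a, - a)) by apply: pair2_endo; rewrite mulrNN -expr2.
move=> /is_endoP[h1 h2 h]; apply/is_endoP; split; rewrite ?rpredB ?rpredZ ?cubic_homog // => v v0.
have /h : v != 0 by [].
by rewrite [v]vecP fv_pairK2 fv_pair2 !vec_neq0; rewrite -[X in _ -> (X != 0) || _]opprK oppr_eq0 opprB addrC mulNr mulNr.
Qed.

Lemma V4_pairK2 (f : endo_lift 3) A B : involution (-1) f A -> involution (-1) f B ->
  A *m B = - (B *m A) -> exists a, a ^+ 2 != 1 /\ class_of_pair (pairK2 a) (moduli_class f).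
Proof.
move=> iA iB AB; have [f' [-> [a [b [b0 ab nf]]]]] := V4_nf iA iB AB.
have a2 : (- a / b) ^+ 2 != 1.
  by rewrite expr_div_n sqrrN -[1](divff (expf_neq0 2 b0)) (inj_eq (divIf (expf_neq0 2 b0))).
exists (- a / b); split=> //; apply/class_of_pairP; split; first exact: pairK2_endo.
exists 1%:M, b; split; rewrite ?unitmx1 // => v; rewrite !mul1mx [v]vecP nf fv_pairK2 scale_vec.
by congr vec; field.
Qed.

Lemma diag_power (C : 'M[algC]_2) g k l : g \in unitmx -> C *m g = k *: (g *m mat l 0 0 1) ->
  (l ^+ 2 = 1 -> C *m C = (k ^+ 2)%:M) /\ (l ^+ 3 = 1 -> C *m C *m C = (k ^+ 3)%:M).
Proof.
move=> ug Cg.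
have C2 : C *m C *m g = k ^+ 2 *: (g *m mat (l ^+ 2) 0 0 1).
  rewrite -mulmxA Cg -scalemxAr (mulmxA C) Cg -scalemxAl scalerA -mulmxA mat_mul.
  by congr (_ *: (_ *m _)); congr mat; ring.
have C3 : C *m C *m C *m g = k ^+ 3 *: (g *m mat (l ^+ 3) 0 0 1).
  rewrite -mulmxA Cg -scalemxAr (mulmxA (C *m C)) C2 -scalemxAl scalerA -mulmxA mat_mul.
  by congr (_ *: (_ *m _)); congr mat; ring.
by split=> e; apply: (can_inj (mulmxK ug)); rewrite ?C2 ?C3 e -(mat_scalar 1) mulmx1 mul_scalar_mx.
Qed.

(** Order 4 is confined to the class of 1/z^3. This is what limits the products of two involutions
    below. *)
Lemma aut_order (f : endo_lift 3) C c : C \in unitmx -> conj_via C c f f ->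
  [\/ exists k, C = k%:M, exists k, C *m C = k%:M, exists k, C *m C *m C = k%:M
    | class_of_pair (pair2 (0, 0)) (moduli_class f)].
Proof.
move=> uC fC; have [[k ek]|[g [k [l [ug k0 l0 l1 Cg]]]]|[g [k [ug k0 Cg]]]] := mat_normal uC.
- by constructor 1; exists k.
- have [f' ff'] := lift_conj_via f ug.
  have [h2 h3] := diag_power ug Cg.
  have := diag_aut l0 l1 (conj_via_aut ug k0 ff' Cg fC).
  move=> [[[el _ _]|[el _ _]|[el _]|[el _]]|[_ _ [b [p nf]]]].
  + by constructor 2; exists (k ^+ 2); apply: h2; rewrite el sqrrN expr1n.
  + by constructor 2; exists (k ^+ 2); apply: h2; rewrite el sqrrN expr1n.
  + by constructor 3; exists (k ^+ 3); apply: h3.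
  + by constructor 3; exists (k ^+ 3); apply: h3.
  constructor 4; have [_ _ _] := nf2_class nf (sqrtCK _).
  rewrite !mul0r (_ : moduli_class f = moduli_class f') //.
  by apply/moduli_classP; exists g, 1; rewrite oner_neq0.
- have [f' ff'] := lift_conj_via f ug.
  by have /unipotent_aut := conj_via_aut ug k0 ff' Cg fC.
Qed.

Lemma involution_scale (f : endo_lift 3) A k e : k != 0 -> involution e f (k *: A) -> involution e f A.
Proof.
move=> k0 [s [s0 AA nA fA]]; exists (s / k ^+ 2); split.
- by rewrite mulf_neq0 ?invr_eq0 ?expf_neq0.
- apply: (scalerI (expf_neq0 2 k0)); rewrite scale_scalar_mx mulrC divfK ?expf_neq0 //.
  by rewrite -AA -scalemxAl -scalemxAr scalerA.
- move=> c ec; apply: (nA (k * c)); rewrite ec scale_scalar_mx //.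
- by move/(conj_via_scale _ _ _ _ k0): fA; rewrite mulrA.
Qed.

Lemma involution_type (f : endo_lift 3) A : involution 1 f A -> involution (-1) f A -> False.
Proof.
move=> [s [s0 AA _ fA]] [t [t0 BB _ fB]]; have uA := square_unit s0 AA.
have st : s = t by have := AA; rewrite BB !mat_scalar => /mat_inj[].
have := aut_unique uA fA fB; rewrite -st mul1r mulN1r => /(@eqN0 algC^o) z.
by rewrite z eqxx in s0.
Qed.

(** Conjugating twice gives r^2 = 1. If r = 1 the matrices are simultaneously diagonal, and two
    diagonal involutions agree up to a scalar, which is excluded. *)
Lemma proj_commute (A B : 'M[algC]_2) s t r : s != 0 -> t != 0 -> A *m A = s%:M -> B *m B = t%:M ->
  (forall k, A <> k%:M) -> (forall k, B <> k%:M) -> (forall k, B <> k *: A) ->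
  A *m B = r *: (B *m A) -> A *m B = - (B *m A).
Proof.
move=> s0 t0 AA BB nA nB clash e2; have uB := square_unit t0 BB.
have r2 : r ^+ 2 = 1.
  have e3 : s *: B = (r ^+ 2 * s) *: B.
    have <- : A *m (A *m B) = s *: B by rewrite mulmxA AA mul_scalar_mx.
    rewrite {1}e2 -scalemxAr mulmxA e2 -scalemxAl scalerA -mulmxA AA scalar_mxC mul_scalar_mx.
    by rewrite scalerA expr2.
  have /eqP := e3; rewrite -subr_eq0 -scalerBl scaler_eq0 => /orP[/eqP e4|/eqP B0].
    by apply: (mulIf s0); apply: (lincomb1 (k := -1) e4); ring.
  by rewrite B0 unitr0 in uB.
move/eqP: r2; rewrite sqrf_eq1 => /orP[]/eqP rE; last by rewrite e2 rE scaleN1r.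
exfalso; rewrite rE scale1r in e2.
have [g [c [ug c0 c2 Ag]]] := involution_diag s0 AA nA.
pose B' := invmx g *m B *m g.
have gB : B *m g = g *m B' by rewrite /B' !mulmxA mulmxV // mul1mx.
have BB' : B' *m B' = t%:M.
  by apply: (can_inj (mulKmx ug)); rewrite mulmxA -gB -mulmxA -gB mulmxA BB scalar_mxC.
have DB : dmat *m B' = B' *m dmat.
  apply: (can_inj (mulKmx ug)); apply: (scalerI c0).
  rewrite [g *m (B' *m _)]mulmxA -gB -mulmxA [in RHS]scalemxAr -Ag mulmxA scalemxAl -Ag.
  by rewrite -mulmxA -gB !mulmxA e2.
move: BB' DB gB; rewrite [B']matP; move: (B' 0 0) (B' 0 1) (B' 1 0) (B' 1 1) => x p q w.
rewrite !mat_mul mat_scalar => /mat_inj[e1 _ _ e4] /mat_inj[_ d1 d2 _] gB.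
have p0 : p = 0 by apply: (@eqN0 algC^o); apply: (lincomb1 (k := -1) d1); ring.
have q0 : q = 0 by apply: (@eqN0 algC^o); apply: (lincomb1 (k := 1) d2); ring.
rewrite p0 q0 in e1 e4 gB.
have /eqP : x ^+ 2 = w ^+ 2 by apply: (lincomb2 (k := 1) (k' := -1) e1 e4); ring.
rewrite eqf_sqr => /orP[]/eqP xw.
  apply: (nB w); apply: (can_inj (mulmxK ug)).
  by rewrite gB xw -mat_scalar scalar_mxC.
apply: (clash (w / c)); apply: (can_inj (mulmxK ug)).
rewrite -scalemxAl Ag scalerA divfK // gB xw scalemxAr scale_mat; congr (_ *m _).
by congr mat; ring.
Qed.

(* If AB had order 3 in PGL_2, it would conjugate A to B, up to a scalar. *)
Lemma involution_mixed (f : endo_lift 3) A B : involution 1 f A -> involution (-1) f B ->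
  A *m B = - (B *m A) \/ class_of_pair (pair2 (0, 0)) (moduli_class f).
Proof.
move=> iA iB; have [s [s0 AA nA fA]] := iA; have [t [t0 BB nB fB]] := iB.
have uA := square_unit s0 AA; have uB := square_unit t0 BB.
have uAB : A *m B \in unitmx by rewrite unitmx_mul uA.
have clash k : B = k *: A -> False.
  move=> eB; have k0 : k != 0.
    by apply: contraTneq uB => z; rewrite eB z scale0r unitr0.
  by apply: (involution_type iA); apply: (involution_scale k0); rewrite -eB.
have [[k ek]|[k ek]|[k ek]|] := aut_order uAB (conj_via_comp fA fB); last by right.
- exfalso; apply: (clash (k / s)); apply: (scalerI s0).
  rewrite scalerA mulrC divfK // -mul_scalar_mx -AA -mulmxA ek scalar_mxC mul_scalar_mx //.
- have uk : (k%:M : 'M[algC]_2) \in unitmx by rewrite -ek unitmx_mul uAB.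
  have k0 : k != 0 by apply: contraTneq uk => ->; rewrite raddf0 unitr0.
  have st0 : s * t != 0 by rewrite mulf_neq0.
  have e2 : A *m B = (k / (s * t)) *: (B *m A).
    (* Since (AB)^2 is scalar, this identity makes AB and BA proportional. *)
    have e : (A *m B) *m (A *m B) *m (B *m A) = (s * t) *: (A *m B).
      rewrite -!mulmxA (mulmxA B B) BB mul_scalar_mx -!scalemxAr AA.
      by rewrite (scalar_mxC s B) mul_scalar_mx -!scalemxAr scalerA mulrC.
    by apply: (scalerI st0); rewrite -e ek mul_scalar_mx scalerA [s * t * _]mulrC divfK.
  left; exact: proj_commute s0 t0 AA BB nA nB clash e2.
- exfalso; have uk : (k%:M : 'M[algC]_2) \in unitmx by rewrite -ek !unitmx_mul uA uB.
  have k0 : k != 0 by apply: contraTneq uk => ->; rewrite raddf0 unitr0.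
  have ABA : (A *m B *m A) *m (A *m B *m A) = (s ^+ 2 * t)%:M.
    rewrite -!mulmxA (mulmxA A A) AA mul_scalar_mx -!scalemxAr (mulmxA B B) BB mul_scalar_mx -!scalemxAr AA.
    by rewrite !scale_scalar_mx; congr (_%:M); ring.
  (* ABA squares to a scalar, and its product with BAB is (AB)^3; hence BAB and ABA are
     proportional, which says that AB conjugates one involution to a multiple of the other. *)
  have BAB : (s ^+ 2 * t) *: (B *m A *m B) = k *: (A *m B *m A).
    have e : A *m B *m A *m (B *m A *m B) = k%:M by rewrite -ek !mulmxA.
    by rewrite -!mul_scalar_mx -ABA -mulmxA e scalar_mxC.
  have kE : (k / (s ^+ 2 * t)) != 0 by rewrite mulf_neq0 // invr_eq0 mulf_neq0 ?expf_neq0.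
  apply: (involution_type iA); apply: (involution_scale kE).
  have := involution_conj uAB (conj_via_comp fA fB) iB.
  congr involution; apply: (can_inj (mulKmx uAB)); rewrite !mulmxA mulmxV // mul1mx.
  rewrite -scalemxAr.
  have st0 : s ^+ 2 * t != 0 by rewrite mulf_neq0 ?expf_neq0.
  by apply: (scalerI st0); rewrite scalerA [s ^+ 2 * t * _]mulrC divfK // -BAB mulmxA.
Qed.

(** * Loci characterized by types of involutions *)

Definition pair_family (I : Type) (D : set I) (F : I -> form2 * form2) : set (Moduli 3) :=
  [set m | exists2 t, D t & class_of_pair (F t) m].

Definition locusS1 := pair_family [set ab | ab.1 * ab.2 != 1] pair1.
Definition locusS2 := pair_family [set ab | ab.1 * ab.2 != 1] pair2.
Definition locusK1 := pair_family [set a | a != 1 /\ a != -1] (fun a => pair2 (a, a)).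
Definition locusK2 := pair_family [set a | a != 1 /\ a != -1] pairK2.
Definition locus3 := pair_family [set a | a != 0] pair3.
Definition locus4 : set (Moduli 3) := [set m | class_of_pair (pair2 (0, 0)) m].

Lemma sqr_neq1 (a : algC) : a ^+ 2 != 1 <-> a != 1 /\ a != -1.
Proof. by rewrite sqrf_eq1 negb_or; split=> /andP. Qed.

Lemma involution_transport (f g : endo_lift 3) : moduli_class f = moduli_class g ->
  exists2 h, h \in unitmx & forall e A, involution e f A -> involution e g (invmx h *m A *m h).
Proof.
by move=> /moduli_classP[h [c [uh c0 fg]]]; exists h => // e A; apply: involution_conj.
Qed.

Lemma anticomm_conj (h A B : 'M[algC]_2) : h \in unitmx -> A *m B = - (B *m A) ->
  (invmx h *m A *m h) *m (invmx h *m B *m h) = - ((invmx h *m B *m h) *m (invmx h *m A *m h)).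
Proof.
move=> uh AB.
have E C D : (invmx h *m C *m h) *m (invmx h *m D *m h) = invmx h *m (C *m D) *m h.
  by rewrite -!mulmxA (mulmxA h) mulmxV // mul1mx.
by rewrite !E AB mulmxN mulNmx.
Qed.

Lemma locusS1P (f : endo_lift 3) : locusS1 (moduli_class f) <-> exists A, involution 1 f A.
Proof.
split.
  move=> [[a b] /= ab [g eg /esym fg]]; have := pair1_involution a b; rewrite -eg => ig.
  by have [h _ /(_ _ _ ig) ?] := involution_transport fg; eexists; eauto.
move=> [A iA]; have [g [-> [[_ [a [b [c [d nf]]]]]|[/eqP]]]] := involution_nf iA (expr1n _ _).
  have [a0 d0 bc cl] := nf1_class nf; exists (b / d, c / a) => //=.
  apply: contra bc => /eqP/(congr1 ( *%R (a * d))) e.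
  by apply/eqP; apply: (lincomb1 (k := 1) e); field; rewrite a0 d0.
by rewrite eq_sym (negPf onen).
Qed.

Lemma locusS2P (f : endo_lift 3) : locusS2 (moduli_class f) <-> exists A, involution (-1) f A.
Proof.
split.
  move=> [[a b] /= ab [g eg /esym fg]]; have := pair2_involution a b; rewrite -eg => ig.
  by have [h _ /(_ _ _ ig) ?] := involution_transport fg; eexists; eauto.
move=> [A iA]; have e2 : (-1 : algC) ^+ 2 = 1 by rewrite sqrrN expr1n.
have [g [-> [[/eqP]|[_ [a [b [c [d nf]]]]]]]] := involution_nf iA e2; first by rewrite (negPf onen).
have [b0 c0 ad cl] := nf2_class nf (sqrtCK _); exists (a / sqrtC (b * c), d / sqrtC (b * c)) => //=.
have s0 : sqrtC (b * c) != 0 by rewrite -sqrf_eq0 sqrtCK mulf_neq0.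
apply: contra ad => /eqP/(congr1 ( *%R (sqrtC (b * c) ^+ 2))) e.
by apply/eqP; rewrite -[RHS](sqrtCK (b * c)); apply: (lincomb1 (k := 1) e); field.
Qed.

Lemma locusK1P (f : endo_lift 3) : locusK1 (moduli_class f) <->
  exists A B, [/\ involution (-1) f A, involution 1 f B & A *m B = - (B *m A)].
Proof.
split.
  move=> [a _ [g eg /esym fg]]; have := pair2_swap_involution a; have := pair2_involution a a.
  rewrite -eg => iA iB; have [h uh H] := involution_transport fg.
  exists (invmx h *m dmat *m h), (invmx h *m jmat *m h); split; try exact: H.
  by apply: anticomm_conj => //; apply: dmat_jmat.
move=> [A [B [iA iB AB]]]; have [a [a2 cl]] := V4_pairK1 iA iB AB.
by exists a => //=; apply/sqr_neq1.
Qed.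

Lemma pairK2_involution a : involution (-1) (pairK2 a) dmat /\ involution (-1) (pairK2 a) jmat.
Proof.
split; exists 1; split; rewrite ?oner_neq0 ?dmat2 ?jmat2 //; try exact: dmat_nonscalar; try exact: jmat_nonscalar.
  by move=> v; rewrite [v]vecP mat_vec !fv_pairK2 mat_vec scale_vec; congr vec; ring.
by move=> v; rewrite [v]vecP mat_vec !fv_pairK2 mat_vec scale_vec; congr vec; ring.
Qed.

Lemma locusK2P (f : endo_lift 3) : locusK2 (moduli_class f) <->
  exists A B, [/\ involution (-1) f A, involution (-1) f B & A *m B = - (B *m A)].
Proof.
split.
  move=> [a _ [g eg /esym fg]]; have := pairK2_involution a.
  rewrite -eg => -[iA iB]; have [h uh H] := involution_transport fg.
  exists (invmx h *m dmat *m h), (invmx h *m jmat *m h); split; try exact: H.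
  by apply: anticomm_conj => //; apply: dmat_jmat.
move=> [A [B [iA iB AB]]]; have [a [a2 cl]] := V4_pairK2 iA iB AB.
by exists a => //=; apply/sqr_neq1.
Qed.

Lemma locus4_K1 : locus4 `<=` locusK1.
Proof. by move=> m hm; exists 0 => //=; apply/sqr_neq1; rewrite expr0n eq_sym oner_neq0. Qed.

Lemma locus4_K2 : locus4 `<=` locusK2.
Proof.
move=> m [f ef ->]; exists 0; first by apply/sqr_neq1; rewrite expr0n eq_sym oner_neq0.
have : nf2 f 0 1 1 0 by move=> x y; rewrite ef fv_pair2; congr vec; ring.
move=> nf; apply/class_of_pairP; split; first by apply: pairK2_endo; rewrite expr0n eq_sym oner_neq0.
(* Since t^4 = -1, rescaling by [t] turns 1/z^3 into -1/z^3, the member a = 0 of the second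
   curve. *)
pose t : algC := sqrtC 'i; have t2 : t ^+ 2 = 'i by rewrite sqrtCK.
have t0 : t != 0 by rewrite -sqrf_eq0 t2 neq0Ci.
exists (mat t 0 0 1), (t ^+ 3); split; rewrite ?expf_neq0 ?mat_unit ?mulr0 ?subr0 ?mulr1 // => v.
have t4 : t ^+ 4 = -1 by rewrite -[4%N]/(2 * 2)%N exprM t2 sqrCi.
rewrite [v]vecP mat_vec nf fv_pairK2 mat_vec scale_vec; move: (v 0 0) (v 1 0) => x y; congr vec; last by ring.
by apply: (lincomb1 (k := y ^+ 3) t4); ring.
Qed.

Lemma locusS12 : locusS1 `&` locusS2 = locusK1.
Proof.
apply/seteqP; split=> m; have [f ->] := moduli_class_surj m.
  move=> [/locusS1P[A iA] /locusS2P[B iB]].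
  have [AB|h] := involution_mixed iA iB; last exact: locus4_K1.
  by apply/locusK1P; exists B, A; rewrite AB opprK.
by move=> /locusK1P[A [B [iA iB _]]]; split; [apply/locusS1P; exists B|apply/locusS2P; exists A].
Qed.

Lemma locusK2_S2 : locusK2 `<=` locusS2.
Proof.
move=> m; have [f ->] := moduli_class_surj m.
by move=> /locusK2P[A [B [iA iB _]]]; apply/locusS2P; exists A.
Qed.

(** Off [locus4], an involution [C] of type + would anticommute with the three involutions A, B and
    AB of type -. But anticommuting with A and with B implies commuting with AB. *)
Lemma locusK12 : locusK1 `&` locusK2 = locus4.
Proof.
apply/seteqP; split=> m; last by move=> h; split; [apply: locus4_K1|apply: locus4_K2].
have [f ->] := moduli_class_surj m.
move=> [/locusK1P[_ [C [_ iC _]]] /locusK2P[A [B [iA iB AB]]]].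
have iAB : involution (-1) f (A *m B) by have := involution_mul iA iB AB; rewrite opprK mul1r.
have [CA|//] := involution_mixed iC iA; have [CB|//] := involution_mixed iC iB.
have [CAB|//] := involution_mixed iC iAB; exfalso.
have : C *m (A *m B) = A *m B *m C.
  by rewrite mulmxA CA mulNmx -(mulmxA A C) CB mulmxN opprK mulmxA.
rewrite {1}CAB => /esym/eqN0 h0.
have [s [s0 ss _ _]] := iC; have [t [t0 tt _ _]] := iAB.
by have := unitmx_mul (A *m B) C; rewrite h0 (square_unit s0 ss) (square_unit t0 tt) unitr0.
Qed.

(** This is where -3 comes from. For a traceless matrix with rows (x, y) and (z, -x), the images of
    the two basis vectors give y^2 = -a x z, z y = -(1 + a) x^2 and a z^3 = (a - 1) x^3. Eliminating
    y and z leaves (1 + a)^2 + a - 1 = 0, that is a (a + 3) = 0. The type [e] never enters. *)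
Lemma pair3_involution_eq a B e : a != 0 -> involution e (pair3 a) B -> a = -3.
Proof.
move=> a0 [s [s0 BB /(involution_traceless BB)]]; move: BB; rewrite [B]matP mat_mul mat_scalar !mxE /=.
move: (B 0 0) (B 0 1) (B 1 0) (B 1 1) => x y z w /mat_inj[h1 _ _ _] ->; set mu := e * s => hB.
have /vec2_inj[E1 E2] : vec (x ^+ 3 + a * z ^+ 3) (a * (x ^+ 2 * z)) = vec (mu * x) (mu * z).
  have := hB (vec 1 0); rewrite mat_vec !fv_pair3 mat_vec scale_vec => /vec2_inj[e1 e2].
  by congr vec; [apply: (lincomb1 (k := 1) e1)|apply: (lincomb1 (k := 1) e2)]; ring.
have /vec2_inj[E3 E4] : vec (y ^+ 3 - a * x ^+ 3) (- a * (y ^+ 2 * x)) = vec (mu * x * a) (mu * z * a).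
  have := hB (vec 0 1); rewrite mat_vec !fv_pair3 mat_vec scale_vec => /vec2_inj[e1 e2].
  by congr vec; [apply: (lincomb1 (k := 1) e1)|apply: (lincomb1 (k := 1) e2)]; ring.
(* With z = 0 the involution fixes (1 : 0); the equations make it diagonal and require [mu] to be
   both x^2 and -x^2. *)
have [z0|z0] := eqVneq z 0.
  rewrite z0 in h1 E1 E2 E3 E4.
  have x0 : x != 0 by apply: contraNneq s0 => x0; rewrite -h1 x0 !(mul0r, mulr0) addr0.
  have y0 : y = 0.
    have /eqP : a * x * y ^+ 2 = 0 by apply: (lincomb1 (k := -1) E4); ring.
    by rewrite mulf_eq0 expf_eq0 /= mulf_eq0 (negPf a0) (negPf x0) => /eqP.
  rewrite y0 in E3.
  have m1 : mu = x ^+ 2 by apply: (mulIf x0); apply: (lincomb1 (k := -1) E1); ring.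
  have /(@eqN0 algC^o) : mu = - mu.
    apply: (mulIf (mulf_neq0 x0 a0)); rewrite {2}m1; apply: (lincomb1 (k := -1) E3); ring.
  by rewrite m1 => /eqP; rewrite expf_eq0 /= (negPf x0).
have mE : mu = a * x ^+ 2 by apply: (mulIf z0); apply: (lincomb1 (k := -1) E2); ring.
rewrite mE in E1 E3 E4.
have az : a * z ^+ 3 = (a - 1) * x ^+ 3 by apply: (lincomb1 (k := 1) E1); ring.
have x0 : x != 0.
  apply/eqP => x0; move: az; rewrite x0 expr0n mulr0 => /eqP.
  by rewrite mulf_eq0 expf_eq0 /= (negPf a0) (negPf z0).
have y2 : y ^+ 2 = - a * x * z.
  by apply: (mulfI (mulf_neq0 a0 x0)); apply: (lincomb1 (k := -1) E4); ring.
have zy : z * y = - (1 + a) * x ^+ 2.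
  apply: (mulfI (mulf_neq0 a0 x0)); apply: (lincomb2 (k := -1) (k' := y) E3 y2); ring.
have : a * (a + 3) = 0.
  apply: (mulfI (expf_neq0 4 x0)); rewrite mulr0.
  have zy2 : z ^+ 2 * y ^+ 2 = (1 + a) ^+ 2 * x ^+ 4 by rewrite -exprMn zy; ring.
  rewrite y2 in zy2.
  by apply: (lincomb2 (k := -1) (k' := - x) zy2 az); ring.
by move=> /eqP; rewrite mulf_eq0 (negPf a0) addr_eq0 => /eqP.
Qed.

(** The polynomial map z^3 + z; it witnesses that the intersection curve is a proper subset of the
    first surface. *)
Lemma pair1_10_notin : forall m, class_of_pair (pair1 (1, 0)) m -> ~ locusS2 m.
Proof.
move=> m [f ef ->] /locusS2P[B]; rewrite ef => -[s [s0 BB /(involution_traceless BB)]].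
move: BB; rewrite [B]matP mat_mul mat_scalar !mxE /=.
move: (B 0 0) (B 0 1) (B 1 0) (B 1 1) => x y z w /mat_inj[h1 _ _ _] ->; rewrite mulN1r => hB.
have E X Y : (z * X - x * Y) ^+ 3 = - s * (z * (X ^+ 3 + X * Y ^+ 2) - x * Y ^+ 3) /\
   (x * X + y * Y) ^+ 3 + (x * X + y * Y) * (z * X - x * Y) ^+ 2 =
   - s * (x * (X ^+ 3 + X * Y ^+ 2) + y * Y ^+ 3).
  have := hB (vec X Y); rewrite mat_vec !fv_pair1 mat_vec scale_vec => /vec2_inj[e1 e2].
  by split; [apply: (lincomb1 (k := 1) e2)|apply: (lincomb1 (k := 1) e1)]; ring.
have [E1 E2] := E 1 0; have [E3 E4] := E 0 1; have [E5 _] := E 1 1.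
have xs : x * s = 0.
  have x3 : x ^+ 3 = - s * x by apply: (lincomb1 (k := -1) E3); ring.
  have xz : x * z ^+ 2 = 0 by apply: (lincomb2 (k := 1) (k' := -1) E2 x3); ring.
  have [z0|z0] := eqVneq z 0.
    have sE : s = x ^+ 2 by rewrite -h1 z0; ring.
    by apply: (@eqN0 algC^o); rewrite {1}sE; apply: (lincomb1 (k := 1) x3); ring.
  by have /eqP := xz; rewrite mulf_eq0 expf_eq0 /= (negPf z0) orbF => /eqP ->; rewrite mul0r.
have x0 : x = 0 by have /eqP := xs; rewrite mulf_eq0 (negPf s0) orbF => /eqP.
rewrite x0 in E1 E5 h1.
have z0 : z != 0 by apply: contraNneq s0 => z0; rewrite -h1 z0; apply/eqP; ring.
have z3 : z ^+ 3 = 0 by apply: (lincomb2 (k := 2) (k' := -1) E1 E5); ring.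
by move/eqP: z3; rewrite expf_eq0 /= (negPf z0).
Qed.

(* The pencil spanned by the two coordinates of 1/z^3 contains cubes of linear
   forms, a property invariant under conjugation which fails for a = 2 in both
   families of maps with a four-group of automorphisms. *)
Lemma locus4_cube (f : endo_lift 3) : locus4 (moduli_class f) ->
  exists p q l m, (l != 0) || (m != 0) /\ forall x y,
    (l * x + m * y) ^+ 3 = p * (fv f (vec x y)) 0 0 + q * (fv f (vec x y)) 1 0.
Proof.
move=> /class_of_pairP[_ [A [c [uA c0 h]]]].
have uB : invmx A \in unitmx by rewrite unitmx_inv.
have := conj_via_inv uA c0 h; move: uB; rewrite [invmx A]matP.
move: (invmx A 0 0) (invmx A 0 1) (invmx A 1 0) (invmx A 1 1) => p q l m.
rewrite mat_unit => uB hB; exists (c^-1 * p), (c^-1 * q), l, m; split.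
  apply: contraNT uB; rewrite negb_or !negbK => /andP[/eqP -> /eqP ->].
  by rewrite !mulr0 subrr.
move=> x y; have := hB (vec x y); rewrite mat_vec fv_pair2 [fv f _]vecP mat_vec scale_vec.
rewrite vec0 vec1; move: (fv f _ 0 0) (fv f _ 1 0) => F G /vec2_inj[e _].
by apply: (lincomb1 (k := 1) e); ring.
Qed.

(** The signs [r] = 1 and -1 serve the two curves at a = 2. Comparing coefficients gives 2 r l^2 = 3
    m^2 and 2 r m^2 = 3 l^2 when l and m are nonzero, whence 4 l^2 = 9 l^2. *)
Lemma cube_pencil (p q l m r s : algC) : r ^+ 2 = 1 -> (l != 0) || (m != 0) ->
  (forall x y, (l * x + m * y) ^+ 3 =
     p * (2 * (x ^+ 2 * y) + r * y ^+ 3) + q * (x ^+ 3 + r * 2 * (x * y ^+ 2))) -> False.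
Proof.
move=> r2 lm h.
have [] := @cub_inj (l ^+ 3) (3 * l ^+ 2 * m) (3 * l * m ^+ 2) (m ^+ 3) q (2 * p) (2 * r * q) (r * p).
  by move=> x y; apply: (lincomb1 (k := 1) (h x y)); rewrite /cub; ring.
move=> e3 e2 e1 e0.
have five : 5 != 0 :> algC by rewrite pnatr_eq0.
have three : 3 != 0 :> algC by rewrite pnatr_eq0.
have two : 2 != 0 :> algC by rewrite pnatr_eq0.
have a1 : l * (2 * r * l ^+ 2 - 3 * m ^+ 2) = 0 by apply: (lincomb2 (k := 2 * r) (k' := -1) e3 e1); ring.
have a2 : m * (2 * r * m ^+ 2 - 3 * l ^+ 2) = 0.
  have e2' : 3 * r * l ^+ 2 * m = 2 * m ^+ 3 by rewrite e0; apply: (lincomb1 (k := r) e2); ring.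
  by apply: (lincomb2 (k := - r) (k' := 3 * l ^+ 2 * m) e2' r2); ring.
have [l0|l0] := eqVneq l 0.
  rewrite l0 eqxx /= in lm; have r0 : r != 0 by apply: contra_eqN r2 => /eqP ->; rewrite expr0n eq_sym oner_neq0.
  move: a2; rewrite l0 => a2; have /eqP : 2 * r * m ^+ 3 = 0 by apply: (lincomb1 (k := 1) a2); ring.
  by rewrite mulf_eq0 expf_eq0 /= (negPf lm) orbF mulf_eq0 (negPf two) (negPf r0).
have b1 : 2 * r * l ^+ 2 = 3 * m ^+ 2 by apply/eqP; rewrite -subr_eq0; apply/eqP/(mulfI l0); rewrite a1 mulr0.
have [m0|m0] := eqVneq m 0.
  have r0 : r != 0 by apply: contra_eqN r2 => /eqP ->; rewrite expr0n eq_sym oner_neq0.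
  by move/eqP: b1; rewrite m0 expr0n mulr0 mulf_eq0 expf_eq0 /= (negPf l0) orbF mulf_eq0 (negPf two) (negPf r0).
have b2 : 2 * r * m ^+ 2 = 3 * l ^+ 2 by apply/eqP; rewrite -subr_eq0; apply/eqP/(mulfI m0); rewrite a2 mulr0.
have /eqP : 5 * l ^+ 2 = 0.
  have c1 : 4 * r ^+ 2 * l ^+ 2 = 9 * l ^+ 2 by apply: (lincomb2 (k := 2 * r) (k' := 3) b1 b2); ring.
  by rewrite r2 in c1; apply: (lincomb1 (k := -1) c1); ring.
by rewrite mulf_eq0 expf_eq0 /= (negPf five) (negPf l0).
Qed.

Lemma four_neq1 : 2 ^+ 2 != 1 :> algC.
Proof. by rewrite -subr_eq0 (_ : 2 ^+ 2 - 1 = 3) ?pnatr_eq0 //; ring. Qed.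

Lemma locusK1_not4 : exists2 m, locusK1 m & ~ locus4 m.
Proof.
have h2 : is_endo 3 (pair2 (2, 2)) by apply: pair2_endo; rewrite -expr2 four_neq1.
exists (moduli_class (mk_lift h2)).
  by exists 2; [apply/sqr_neq1/four_neq1|exists (mk_lift h2)].
move=> /locus4_cube[p [q [l [m [lm h]]]]].
apply: (@cube_pencil p q l m 1 0 (expr1n _ _) lm) => x y.
by rewrite h fv_pair2 vec0 vec1; ring.
Qed.

Lemma locusK2_not4 : exists2 m, locusK2 m & ~ locus4 m.
Proof.
have h2 := pairK2_endo four_neq1.
exists (moduli_class (mk_lift h2)).
  by exists 2; [apply/sqr_neq1/four_neq1|exists (mk_lift h2)].
move=> /locus4_cube[p [q [l [m [lm h]]]]].
have r2 : (-1 : algC) ^+ 2 = 1 by rewrite sqrrN expr1n.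
apply: (@cube_pencil p q l m (-1) 0 r2 lm) => x y.
by rewrite h fv_pairK2 vec0 vec1; ring.
Qed.

(** * Closed families in the moduli space *)

Definition ev_coords d (f : endo_lift d) : {rmorphism {mpoly algC[d.+1 + d.+1]} -> algC} :=
  meval (coords f 0).

Lemma scale_lift d (f : endo_lift d) c : c != 0 ->
  exists2 g : endo_lift d, lift_val g = (c *: f.1, c *: f.2) & moduli_class g = moduli_class f.
Proof.
move=> c0; have h : is_endo d (c *: f.1, c *: f.2).
  have /is_endoP[h1 h2 hn] := endo_liftP f; apply/is_endoP; split; rewrite ?rpredZ // => v v0.
  by rewrite fv_scale scaler_eq0 negb_or c0 hn.
exists (mk_lift h) => //; rewrite /moduli_class; congr rat_class.
by apply/esym/RatMap_eqP; exists c.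
Qed.

Lemma coords_scale d (f g : endo_lift d) c : lift_val g = (c *: f.1, c *: f.2) ->
  coords g = c *: coords f.
Proof.
move=> e; apply/rowP => i; rewrite !mxE; case: (split i) => j; rewrite !mxE e /=.
  by rewrite mcoeffZ.
by rewrite mcoeffZ.
Qed.

Lemma poly_const0 N (a : 'I_N -> algC) : (forall c, c != 0 -> \sum_(k < N) c ^+ k * a k = 0) ->
  forall k, a k = 0.
Proof.
move=> h k; pose P := \poly_(i < N) (if insub i is Some j then a j else 0).
have PE c : P.[c] = \sum_(k < N) c ^+ k * a k.
  by rewrite horner_poly; apply: eq_bigr => i _; rewrite valK mulrC.
have P0 : P = 0.
  apply/eqP; apply: contraT => Pn.
  have [|c] := @exists_nonroot ('X * P); first by rewrite mulf_neq0 ?polyX_eq0.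
  rewrite hornerM hornerX PE mulf_eq0 negb_or => /andP[c0].
  by rewrite h // eqxx.
by have := congr1 (fun p : {poly _} => p`_k) P0; rewrite coef_poly ltn_ord coef0 valK.
Qed.

(** The lifts of a class are stable under scaling, so the homogeneous components of a separating
    polynomial still vanish on [Z], and one of them separates; closedness demands homogeneous
    equations. *)
Lemma closed_separated d (Z : set (Moduli d)) :
  poly_separated (@ev_coords d) setT [set f | Z (moduli_class f)] -> closed Z.
Proof.
move=> sepZ; apply/Moduli_closedE.
exists [set P | (exists k, P \is k.-homog) /\
   forall f : endo_lift d, Z (moduli_class f) -> P.@[coords f 0] = 0].
split; first by move=> P [].
apply/seteqP; split=> f.
  by move=> /= Zf P [_]; apply; rewrite /moduli_class reprK.
move=> fz; apply: contrapT => /= nZ.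
have [|r [rZ rf]] := sepZ (repr f) I; first by rewrite /= /moduli_class reprK.
have rE (v : 'I_(d.+1 + d.+1) -> algC) : r.@[v] = \sum_(k < msize r) (pihomog mdeg k r).@[v].
  by rewrite {1}(pihomog_partitionE (leqnn (msize r))) raddf_sum.
move/negP: rf; apply; rewrite /ev_coords /= rE big1 // => k _.
apply: fz; split; first by exists k; apply: pihomogP.
move=> g Zg; apply: (@poly_const0 _ (fun k => (pihomog mdeg k r).@[coords g 0])) => c c0.
have [g' eg mg] := scale_lift g c0.
have := rZ g' I; rewrite /= mg => /(_ Zg); rewrite /ev_coords /= rE => h.
rewrite -[RHS]h; apply: eq_bigr => i _; rewrite -(meval_homog _ _ (pihomogP _ _ _)).
by apply: meval_eq => j; rewrite (coords_scale eg) [RHS]mxE.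
Qed.

(** [zeros] tests the chosen representative of a map; homogeneity transfers the test to every
    lift. *)
Lemma closed_eval d (C : set (Moduli d)) : closed C -> exists S : set {mpoly algC[d.+1 + d.+1]},
  forall f : endo_lift d, C (moduli_class f) <-> forall P, S P -> P.@[coords f 0] = 0.
Proof.
move=> /Moduli_closedE[S [hS e]]; exists S => f.
have [c c0 fc] := RatMap_repr f.
have -> : C (moduli_class f) = (@rat_class d @^-1` C) (\pi_(RatMap d) f) by [].
rewrite e /zeros /=; have E P : S P -> P.@[coords (repr (\pi_(RatMap d) f)) 0] = 0 <-> P.@[coords f 0] = 0.
  move=> /hS[k hk]; rewrite (coords_scale fc).
  have -> : P.@[(c *: coords f) 0] = c ^+ k * P.@[coords f 0].
    by rewrite -meval_homog //; apply: meval_eq => j; rewrite [LHS]mxE.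
  split=> [/eqP|->]; last by rewrite mulr0.
  by rewrite mulf_eq0 expf_eq0 (negPf c0) andbF => /eqP.
by split=> h P SP; apply/(E P SP)/h.
Qed.

Lemma coords_cub (f : endo_lift 3) p3 p2 p1 p0 q3 q2 q1 q0 :
  (forall x y, fv f (vec x y) = vec (cub p3 p2 p1 p0 x y) (cub q3 q2 q1 q0 x y)) ->
  forall i, coords f 0 i = nth 0 [:: p0; p1; p2; p3; q0; q1; q2; q3] i.
Proof.
move=> h; have [h1 h2 _] := endo_liftP f.
pose i0 : 'I_4 := ord0; pose i1 : 'I_4 := Ordinal (isT : 1 < 4)%N.
pose i2 : 'I_4 := Ordinal (isT : 2 < 4)%N; pose i3 : 'I_4 := ord_max.
have E p : p \is 3.-homog -> forall x y, p.@[fun i => vec x y i 0] =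
    cub p@_(mon i3) p@_(mon i2) p@_(mon i1) p@_(mon i0) x y.
  move=> hp x y; rewrite (homog_eval _ _ hp) !big_ord_recr big_ord0 /= add0r.
  have e (i j : 'I_4) : i = j :> nat -> p@_(mon i) = p@_(mon j).
    by move=> ei; congr (p@_(mon _)); apply: val_inj.
  rewrite (e i1 (widen_ord (leqnSn 3) (widen_ord (leqnSn 2) ord_max))) //.
  rewrite (e i2 (widen_ord (leqnSn 3) ord_max)) // (e i0 (widen_ord (leqnSn 3) (widen_ord (leqnSn 2) (widen_ord (leqnSn 1) ord_max)))) //.
  by rewrite /cub; ring.
have [e3 e2 e1 e0] : [/\ f.1@_(mon i3) = p3, f.1@_(mon i2) = p2, f.1@_(mon i1) = p1 & f.1@_(mon i0) = p0].
  apply: cub_inj => x y; rewrite -E //; by have /vec2_inj[] := h x y.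
have [f3 f2 f1 f0] : [/\ f.2@_(mon i3) = q3, f.2@_(mon i2) = q2, f.2@_(mon i1) = q1 & f.2@_(mon i0) = q0].
  apply: cub_inj => x y; rewrite -E //; by have /vec2_inj[] := h x y.
have D (j : 'I_4) : [\/ j = i0, j = i1, j = i2 | j = i3].
  by case: j => [[|[|[|[|]]]]] // hj; [constructor 1|constructor 2|constructor 3|constructor 4]; apply: val_inj.
move=> i; rewrite -(splitK i); case: (split i) => j /=.
  by rewrite row_mxEl mxE; case: (D j) => -> /=.
by rewrite row_mxEr mxE; case: (D j) => -> /=.
Qed.

(** [v] lists the coefficients of the family as functions of the parameter, and substituting them
    into an equation of [C] pulls it back. *)
Lemma param_continuous (R : comNzRingType) (I : Type) (ev : I -> {rmorphism R -> algC})
    (k : {rmorphism algC -> R}) (phi : I -> Moduli 3) (v : seq R) (U : set I) :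
  (forall c t, ev t (k c) = c) ->
  (forall t, U t -> exists2 f : endo_lift 3, phi t = moduli_class f &
     forall i, coords f 0 i = ev t (nth 0 v i)) ->
  forall C t, closed C -> U t -> ~ C (phi t) ->
  exists h, (forall t, U t -> C (phi t) -> ev t h = 0) /\ ev t h != 0.
Proof.
move=> kE H C t /closed_eval[S SE] Ut nC.
pose h (P : {mpoly algC[4 + 4]}) : R := mmap k (fun i => nth 0 v i) P.
have hE P t' (f : endo_lift 3) : (forall i, coords f 0 i = ev t' (nth 0 v i)) -> ev t' (h P) = P.@[coords f 0].
  move=> e; have -> : h P = \sum_(m <- msupp P) k P@_m * \prod_(i < 4 + 4) nth 0 v i ^+ m i by [].
  rewrite rmorph_sum mevalE; apply: eq_bigr => m _.
  rewrite rmorphM kE rmorph_prod; congr (_ * _).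
  by apply: eq_bigr => i _; rewrite rmorphXn e.
have [f fE fv] := H _ Ut; rewrite fE in nC.
have [P [SP Pf]] : exists P, S P /\ P.@[coords f 0] <> 0.
  apply: contrapT => h'; apply: nC; apply/SE => P SP; apply: contrapT => n; apply: h'; by exists P.
exists (h P); split; last by rewrite (hE _ _ _ fv); apply/eqP.
move=> t' Ut'; have [g -> gv] := H _ Ut' => /SE/(_ _ SP).
by rewrite (hE _ _ _ gv).
Qed.

Section Regular.
Variables (R : comNzRingType) (Y : Type) (ev : Y -> {rmorphism R -> algC}).

Definition regular (phi : Y -> algC) := exists r, forall y, ev y r = phi y.

Hypothesis cst : exists2 cst : algC -> R, True & forall c y, ev y (cst c) = c.

Lemma regular_cst c : regular (fun=> c).
Proof. by have [k _ kE] := cst; exists (k c). Qed.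

Lemma regularD f g : regular f -> regular g -> regular (fun y => f y + g y).
Proof. by move=> [r rE] [s sE]; exists (r + s) => y; rewrite rmorphD rE sE. Qed.

Lemma regularM f g : regular f -> regular g -> regular (fun y => f y * g y).
Proof. by move=> [r rE] [s sE]; exists (r * s) => y; rewrite rmorphM rE sE. Qed.

Lemma regularN f : regular f -> regular (fun y => - f y).
Proof. by move=> [r rE]; exists (- r) => y; rewrite rmorphN rE. Qed.

Lemma regularB f g : regular f -> regular g -> regular (fun y => f y - g y).
Proof. by move=> hf hg; apply: regularD => //; apply: regularN. Qed.

Lemma regularX f n : regular f -> regular (fun y => f y ^+ n).
Proof. by move=> [r rE]; exists (r ^+ n) => y; rewrite rmorphXn rE. Qed.

Lemma regular_sum (I : Type) (s : seq I) (f : I -> Y -> algC) :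
  (forall i, regular (f i)) -> regular (fun y => \sum_(i <- s) f i y).
Proof.
move=> h; elim: s => [|i s [r rE]].
  by exists 0 => y; rewrite big_nil rmorph0.
by have [q qE] := h i; exists (q + r) => y; rewrite rmorphD big_cons rE qE.
Qed.

Definition regular_mx m n (A : Y -> 'M[algC]_(m, n)) := forall i j, regular (fun y => A y i j).

Lemma regular_mx_cst m n (A : 'M_(m, n)) : regular_mx (fun=> A).
Proof. by move=> i j; apply: regular_cst. Qed.

Lemma regular_mulmx m n p (A : Y -> 'M_(m, n)) (B : Y -> 'M_(n, p)) :
  regular_mx A -> regular_mx B -> regular_mx (fun y => A y *m B y).
Proof.
move=> rA rB i j; have [r rE] : regular (fun y => \sum_(k <- index_enum 'I_n) A y i k * B y k j).
  by apply: regular_sum => k; apply: regularM.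
by exists r => y; rewrite rE mxE.
Qed.

Lemma regular_scalemx m n c (A : Y -> 'M_(m, n)) :
  regular c -> regular_mx A -> regular_mx (fun y => c y *: A y).
Proof. by move=> rc rA i j; have [r rE] := regularM rc (rA i j); exists r => y; rewrite mxE rE. Qed.

Lemma regular_subm m n (A B : Y -> 'M_(m, n)) :
  regular_mx A -> regular_mx B -> regular_mx (fun y => A y - B y).
Proof. by move=> rA rB i j; have [r rE] := regularB (rA i j) (rB i j); exists r => y; rewrite !mxE rE. Qed.

Lemma regular_mat a b c d : regular a -> regular b -> regular c -> regular d ->
  regular_mx (fun y => mat (a y) (b y) (c y) (d y)).
Proof.
move=> [ra aE] [rb bE] [rc cE] [rd dE] i j.
by case: (ord2 i) => ->; case: (ord2 j) => ->; [exists ra|exists rb|exists rc|exists rd] => y; rewrite mxE.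
Qed.

End Regular.

(** Two vectors (u0, u1) and (w0, w1), spanning the candidate fixed lines of an automorphism, over a
    lift. *)
Notation Y4 := (algC * (algC * (algC * (algC * endo_lift 3))))%type.
Definition ev_lines2 := ev_poly (ev_poly (@ev_coords 3)).
Definition ev_lines4 := ev_poly (ev_poly ev_lines2).

Lemma cst0 : exists2 cst : algC -> {mpoly algC[4 + 4]}, True &
  forall c (y : endo_lift 3), ev_coords y (cst c) = c.
Proof. by exists (fun c => c%:MP) => // c y; rewrite /ev_coords /= mevalC. Qed.

Lemma cst_poly (R : comNzRingType) (Y : Type) (ev : Y -> {rmorphism R -> algC}) :
  (exists2 cst : algC -> R, True & forall c y, ev y (cst c) = c) ->
  exists2 cst : algC -> {poly R}, True & forall c y, ev_poly ev y (cst c) = c.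
Proof. by move=> [k _ kE]; exists (fun c => (k c)%:P) => // c [t y]; rewrite ev_polyC kE. Qed.

Lemma cst2 : exists2 cst : algC -> _, True & forall c y, ev_lines2 y (cst c) = c.
Proof. exact/cst_poly/cst_poly/cst0. Qed.

Lemma cst4 : exists2 cst : algC -> _, True & forall c y, ev_lines4 y (cst c) = c.
Proof. exact/cst_poly/cst_poly/cst2. Qed.

(** The line of u is eliminated first, over the base of pairs (w, f) with w nonzero, and then the
    line of w. *)
Lemma two_lines_elimination (T : set Y4) :
  (forall c u0 u1 y, c != 0 -> T (u0, (u1, y)) -> T (c * u0, (c * u1, y))) ->
  (forall c u0 u1 w0 w1 f, c != 0 -> T (u0, (u1, (w0, (w1, f)))) -> T (u0, (u1, (c * w0, (c * w1, f))))) ->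
  (forall u0 u1 w0 w1 f, T (u0, (u1, (w0, (w1, f)))) -> (u0, u1) != (0, 0) /\ (w0, w1) != (0, 0)) ->
  (forall u0 u1 w0 w1 f, (u0, u1) != (0, 0) -> (w0, w1) != (0, 0) ->
     ~ T (u0, (u1, (w0, (w1, f)))) ->
     exists phi, [/\ regular ev_lines4 phi, forall y, T y -> phi y = 0
        & phi (u0, (u1, (w0, (w1, f)))) != 0]) ->
  poly_separated (@ev_coords 3) setT
    [set f | exists u0 u1 w0 w1, T (u0, (u1, (w0, (w1, f))))].
Proof.
move=> Tu Tw T0 Tsep.
pose dom : set (algC * (algC * endo_lift 3)) := [set y | (y.1, y.2.1) != (0, 0)].
have s1 : poly_separated ev_lines2 dom
    [set y | exists s t, (s, t) != (0, 0) /\ T (s, (t, y))].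
  apply: projective_elimination cst2 => [c s t y c0|s t [w0 [w1 f]] st dy nT]; first exact: Tu.
  have [phi [[r rE] phiT phin]] := Tsep _ _ _ _ _ st dy nT.
  by exists r; split=> [s' t' y' _ _ /phiT|]; rewrite -/ev_lines4 rE.
have s2 : poly_separated (@ev_coords 3) setT
    [set f | exists s t, (s, t) != (0, 0) /\
       [set y | exists s' t', (s', t') != (0, 0) /\ T (s', (t', y))] (s, (t, f))].
  apply: projective_elimination cst0 => [c s t f c0 [u0 [u1 [u Th]]]|s t f st _ nT].
    by exists u0, u1; split=> //; apply: Tw.
  have [r [rz rn]] := s1 (s, (t, f)) st nT; exists r; split=> // s' t' f' st' _ Th.
  exact: (rz (s', (t', f'))).
move=> f _ nf; have [||r [rz rn]] := s2 f => //.
  by move=> [s [t [st [u0 [u1 [u Th]]]]]]; apply: nf; exists u0, u1, s, t.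
exists r; split=> // g _ [u0 [u1 [w0 [w1 Tg]]]]; apply: rz => //.
by have [u w] := T0 _ _ _ _ _ Tg; exists w0, w1; split=> //; exists u0, u1.
Qed.

Definition frame (y : Y4) : 'M[algC]_2 :=
  let: (u0, (u1, (w0, (w1, _)))) := y in mat u0 w0 u1 w1.
(** The adjugate of [frame]. Unlike the inverse it is polynomial in the coordinates and still makes
    sense when the two lines coincide. *)
Definition coframe (y : Y4) : 'M[algC]_2 :=
  let: (u0, (u1, (w0, (w1, _)))) := y in mat w1 (- w0) (- u1) u0.
Definition fdet (y : Y4) : algC := \det (frame y).
Definition flift (y : Y4) : endo_lift 3 := y.2.2.2.2.

Definition framed (y : Y4) (v : 'cV[algC]_2) := coframe y *m fv (flift y) (frame y *m v).

Lemma frameK y : coframe y *m frame y = (fdet y)%:M.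
Proof.
case: y => u0 [u1 [w0 [w1 f]]]; rewrite /fdet /= det_mat mat_mul mat_scalar.
by congr mat; ring.
Qed.

Lemma coframeK y : frame y *m coframe y = (fdet y)%:M.
Proof.
case: y => u0 [u1 [w0 [w1 f]]]; rewrite /fdet /= det_mat mat_mul mat_scalar.
by congr mat; ring.
Qed.

Lemma regular_proj : [/\ regular ev_lines4 (fun y => y.1), regular ev_lines4 (fun y => y.2.1),
  regular ev_lines4 (fun y => y.2.2.1) & regular ev_lines4 (fun y => y.2.2.2.1)].
Proof.
split; [exists 'X|exists ('X%:P)|exists ('X%:P%:P)|exists ('X%:P%:P%:P)];
  by case=> u0 [u1 [w0 [w1 f]]]; rewrite /ev_lines4 /ev_lines2 ?ev_polyC ev_polyX.
Qed.

Lemma regular_coords i : regular ev_lines4 (fun y => coords (flift y) 0 i).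
Proof.
exists (('X_i)%:P%:P%:P%:P); case=> u0 [u1 [w0 [w1 f]]].
by rewrite /ev_lines4 /ev_lines2 !ev_polyC /ev_coords /= mevalXU.
Qed.

Lemma regular_frame : regular_mx ev_lines4 frame.
Proof.
have [h1 h2 h3 h4] := regular_proj.
move=> i j; have [r rE] := regular_mat h1 h3 h2 h4 i j; exists r => -[u0 [u1 [w0 [w1 f]]]].
exact: rE.
Qed.

Lemma regular_coframe : regular_mx ev_lines4 coframe.
Proof.
have [h1 h2 h3 h4] := regular_proj.
move=> i j; have [r rE] := regular_mat h4 (regularN h3) (regularN h2) h1 i j; exists r => -[u0 [u1 [w0 [w1 f]]]].
exact: rE.
Qed.

Lemma regular_fdet : regular ev_lines4 fdet.
Proof.
have [h1 h2 h3 h4] := regular_proj.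
have [r rE] := regularB (regularM h1 h4) (regularM h3 h2); exists r => y.
by rewrite rE /fdet; case: y => u0 [u1 [w0 [w1 f]]]; rewrite det_mat.
Qed.

Lemma regular_fv (v : Y4 -> 'cV[algC]_2) : regular_mx ev_lines4 v ->
  regular_mx ev_lines4 (fun y => fv (flift y) (v y)).
Proof.
move=> rv i j; rewrite [j]ord1 {j}.
have main (k : 'I_4 -> 'I_(4 + 4)) (q : Y4 -> {mpoly algC[2]}) :
   (forall y, q y \is 3.-homog) -> (forall y j, (q y)@_(mon j) = coords (flift y) 0 (k j)) ->
   regular ev_lines4 (fun y => (q y).@[fun i => v y i 0]).
  move=> hq qE.
  have [r rE] : regular ev_lines4 (fun y => \sum_(j <- index_enum 'I_4)
      coords (flift y) 0 (k j) * (v y 0 0 ^+ j * v y 1 0 ^+ (3 - j))).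
    apply: regular_sum => m; apply: regularM; first exact: regular_coords.
    by apply: regularM; apply: regularX; apply: rv.
  exists r => y; rewrite rE [v y in RHS]vecP (homog_eval _ _ (hq y)).
  by apply: eq_bigr => m _; rewrite qE.
have hl y := endo_liftP (flift y).
case: (ord2 i) => ->.
  have [|y j|r rE] := @main (lshift 4) (fun y => (lift_val (flift y)).1).
  - by move=> y; have [] := hl y.
  - by rewrite row_mxEl mxE.
  by exists r => y; rewrite rE vec0.
have [|y j|r rE] := @main (@rshift 4 4) (fun y => (lift_val (flift y)).2).
- by move=> y; have [] := hl y.
- by rewrite row_mxEr mxE.
by exists r => y; rewrite rE vec1.
Qed.

Lemma regular_framed v : regular_mx ev_lines4 (framed^~ v).
Proof.
apply: regular_mulmx; first exact: regular_coframe.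
apply: regular_fv; apply: regular_mulmx; first exact: regular_frame.
exact: (regular_mx_cst cst4).
Qed.

Section Equivariant.
Variables (om la : algC) (Q : ('cV[algC]_2 -> 'cV[algC]_2) -> Prop).
Hypothesis om1 : om != 1.
Let diag := mat om 0 0 1.

Definition equivariant (y : Y4) := forall v, framed y (diag *m v) = la *: (diag *m framed y v).

Definition framed_locus := [set y : Y4 | fdet y != 0 /\ Q (framed y)].

Let autm (y : Y4) := frame y *m diag *m coframe y.

(* This equation persists when the two lines collide, where it reads
   f o A = 0 with A <> 0, and so excludes the collision. *)
Lemma equivariant_aut y v : fdet y != 0 -> equivariant y ->
  fv (flift y) (autm y *m v) = (la * fdet y ^+ 2) *: (autm y *m fv (flift y) v).
Proof.
move=> D0 eq; apply: (scalerI D0).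
have -> : fdet y *: fv (flift y) (autm y *m v) = frame y *m (coframe y *m fv (flift y) (autm y *m v)).
  by rewrite mulmxA coframeK mul_scalar_mx.
have -> : coframe y *m fv (flift y) (autm y *m v) = framed y (diag *m (coframe y *m v)).
  by rewrite /framed /autm !mulmxA.
rewrite eq /framed (mulmxA (frame y)) coframeK mul_scalar_mx endo_fvZ.
rewrite -!scalemxAr !scalerA /autm !mulmxA.
by congr (_ *: _); ring.
Qed.

(** At a collision [autm] equals om - 1 times the product of the column (u0, u1) and the row (w1,
    -w0), a nonzero matrix of rank one. *)
Lemma autm_neq0 u0 u1 w0 w1 f : (u0, u1) != (0, 0) -> (w0, w1) != (0, 0) ->
  fdet (u0, (u1, (w0, (w1, f)))) = 0 -> exists v : 'cV[algC]_2, autm (u0, (u1, (w0, (w1, f)))) *m v != 0.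
Proof.
rewrite /fdet /autm /= det_mat => u w D0.
have om10 : om - 1 != 0 by rewrite subr_eq0.
have E x y : mat u0 w0 u1 w1 *m diag *m mat w1 (- w0) (- u1) u0 *m vec x y =
   (om - 1) *: vec (u0 * (w1 * x - w0 * y)) (u1 * (w1 * x - w0 * y)).
  rewrite !mat_mul mat_vec scale_vec; congr vec.
    by apply: (lincomb1 (k := x) D0); ring.
  by apply: (lincomb1 (k := y) D0); ring.
have [w1z|w1n] := eqVneq w1 0.
  exists (vec 0 1); rewrite E scaler_eq0 negb_or om10 vec_neq0 w1z mul0r sub0r mulr1 !mulrN !oppr_eq0.
  have w0n : w0 != 0 by move: w; rewrite w1z xpair_eqE eqxx andbT.
  by rewrite !mulf_eq0 (negPf w0n) !orbF; move: u; rewrite xpair_eqE negb_and.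
exists (vec 1 0); rewrite E scaler_eq0 negb_or om10 vec_neq0 mulr0 subr0 mulr1.
by rewrite !mulf_eq0 (negPf w1n) !orbF; move: u; rewrite xpair_eqE negb_and.
Qed.

Lemma framed_scale a b u0 u1 w0 w1 f v :
  framed (a * u0, (a * u1, (b * w0, (b * w1, f)))) v =
  mat b 0 0 a *m framed (u0, (u1, (w0, (w1, f)))) (mat a 0 0 b *m v).
Proof.
rewrite /framed /flift /= !mulmxA !mat_mul.
by congr (mat _ _ _ _ *m fv _ (mat _ _ _ _ *m _)); ring.
Qed.

Hypothesis Q_equivariant : forall h, Q h -> forall v, h (diag *m v) = la *: (diag *m h v).
Hypothesis Q_scale : forall h a b, a != 0 -> b != 0 -> Q h ->
  Q (fun v => mat b 0 0 a *m h (mat a 0 0 b *m v)).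
Hypothesis Q_sep : forall y, fdet y != 0 -> equivariant y -> ~ Q (framed y) ->
  exists phi, [/\ regular ev_lines4 phi, forall y, framed_locus y -> phi y = 0 & phi y != 0].

Lemma vec_comp_neq0 (v : 'cV[algC]_2) : v != 0 -> exists i, v i 0 != 0.
Proof.
rewrite {1}[v]vecP vec_neq0 => /orP[h|h]; [by exists 0|by exists 1].
Qed.

(** A frame can fail in three ways, each with its own separating equation: the lines collide, the
    diagonal matrix is not an automorphism with scalar [la], or only the parameters are wrong. The
    last case is the hypothesis [Q_sep]. *)
Lemma framed_locus_sep u0 u1 w0 w1 f : (u0, u1) != (0, 0) -> (w0, w1) != (0, 0) ->
  ~ framed_locus (u0, (u1, (w0, (w1, f)))) ->
  exists phi, [/\ regular ev_lines4 phi, forall y, framed_locus y -> phi y = 0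
    & phi (u0, (u1, (w0, (w1, f)))) != 0].
Proof.
move=> u w; set y := (u0, _) => nT.
have rdiag : regular_mx ev_lines4 (fun=> diag) by apply: (regular_mx_cst cst4).
have rcst (v : 'cV[algC]_2) : regular_mx ev_lines4 (fun=> v) by apply: (regular_mx_cst cst4).
have [D0|D0] := eqVneq (fdet y) 0.
  have [v Av] := autm_neq0 u w D0.
  have [i fi] := vec_comp_neq0 (endo_fv_neq0 (flift y) Av).
  exists (fun y => (fv (flift y) (autm y *m v) - (la * fdet y ^+ 2) *: (autm y *m fv (flift y) v)) i 0).
  split; last by rewrite D0 expr0n mulr0 scale0r subr0.
    have rA : regular_mx ev_lines4 autm.
      by apply: regular_mulmx regular_coframe; apply: regular_mulmx rdiag; apply: regular_frame.
    apply: regular_subm; first by apply: regular_fv; apply: regular_mulmx.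
    apply: regular_scalemx.
      by apply: regularM; [apply: regular_cst cst4 _|apply/regularX/regular_fdet].
    by apply: regular_mulmx => //; apply: regular_fv.
  by move=> y' [D0' /Q_equivariant eq']; rewrite equivariant_aut // subrr mxE.
have nQ : ~ Q (framed y) by move=> q; apply: nT.
have [eq|/existsNP[v neq]] := pselect (equivariant y); first exact: Q_sep.
have [|i hi] := @vec_comp_neq0 (framed y (diag *m v) - la *: (diag *m framed y v)).
  by rewrite subr_eq0; apply/eqP.
exists (fun y => (framed y (diag *m v) - la *: (diag *m framed y v)) i 0); split=> //.
  apply: regular_subm; first exact: regular_framed.
  apply: regular_scalemx; first exact: (regular_cst cst4).
  by apply: regular_mulmx => //; apply: regular_framed.
by move=> y' [D0' /Q_equivariant ->]; rewrite subrr mxE.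
Qed.

Lemma framed_locus_separated : poly_separated (@ev_coords 3) setT
  [set f | exists u0 u1 w0 w1, framed_locus (u0, (u1, (w0, (w1, f))))].
Proof.
have scale a b u0 u1 w0 w1 f : a != 0 -> b != 0 -> framed_locus (u0, (u1, (w0, (w1, f)))) ->
    framed_locus (a * u0, (a * u1, (b * w0, (b * w1, f)))).
  move=> a0 b0 [D0 q]; split.
    move: D0; rewrite /fdet /= !det_mat => D0.
    by rewrite (_ : _ - _ = a * b * (u0 * w1 - w0 * u1)) ?mulf_neq0 //; ring.
  rewrite (_ : framed _ = fun v => mat b 0 0 a *m framed (u0, (u1, (w0, (w1, f)))) (mat a 0 0 b *m v)).
    exact: Q_scale.
  by apply/funext => v; rewrite framed_scale.
apply: two_lines_elimination.
- move=> c u0 u1 [w0 [w1 f]] c0 /(scale _ _ _ _ _ _ _ c0 (oner_neq0 _)).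
  by rewrite !mul1r.
- move=> c u0 u1 w0 w1 f c0 /(scale _ _ _ _ _ _ _ (oner_neq0 _) c0).
  by rewrite !mul1r.
- move=> u0 u1 w0 w1 f []; rewrite /fdet /= det_mat => D0 _; split.
    by apply: contraNneq D0 => -[-> ->]; rewrite mul0r mulr0 subr0.
  by apply: contraNneq D0 => -[-> ->]; rewrite mul0r mulr0 subr0.
- exact: framed_locus_sep.
Qed.

End Equivariant.

Lemma framed_conj (f : endo_lift 3) F g c : conj_via g c f F ->
  framed (g 0 0, (g 1 0, (g 0 1, (g 1 1, f)))) = fun v => (\det g * c) *: fv F v.
Proof.
move=> h; set y := (g 0 0, _); apply/funext => v; have eg : frame y = g by rewrite [RHS]matP.
rewrite /framed eg -[flift y]/f h -{1}eg -scalemxAr mulmxA frameK /fdet eg mul_scalar_mx.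
by rewrite scalerA mulrC.
Qed.

Lemma pair3_1_endo : is_endo 3 (pair3 1).
Proof. exact: pair3_endo (oner_neq0 _). Qed.

(** A total function, so that a family becomes a map defined on all parameters. The default class
    serves only parameters for which the pair is not an endomorphism. *)
Definition moduli_of (F : form2 * form2) : Moduli 3 :=
  if pselect (is_endo 3 F) is left h then moduli_class (mk_lift h)
  else moduli_class (mk_lift pair3_1_endo).

Lemma moduli_ofP F m : is_endo 3 F -> class_of_pair F m <-> m = moduli_of F.
Proof.
move=> h; rewrite /moduli_of; case: pselect => // h'; split=> [hm|->]; last by exists (mk_lift h').
by apply: class_of_pair_eq hm _; exists (mk_lift h').
Qed.

Lemma framed_locusP (f : endo_lift 3) (Q : ('cV[algC]_2 -> 'cV[algC]_2) -> Prop) :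
  (exists u0 u1 w0 w1, framed_locus Q (u0, (u1, (w0, (w1, f))))) <->
  exists (f' : endo_lift 3) k, [/\ moduli_class f = moduli_class f', k != 0 & Q (fun v => k *: fv f' v)].
Proof.
split.
  move=> [u0 [u1 [w0 [w1 [D0 q]]]]]; pose g := mat u0 w0 u1 w1.
  have ug : g \in unitmx by rewrite unitmxE unitfE.
  have [f' ff'] := lift_conj_via f ug; exists f', (\det g * 1); split.
  - by apply/moduli_classP; exists g, 1; rewrite oner_neq0.
  - by rewrite mulr1.
  by have := framed_conj ff'; rewrite /g !mxE /= => <-.
move=> [f' [k [/moduli_classP[g [c [ug c0 ff']]] k0 q]]].
have D0 : \det g * c != 0 by rewrite mulf_neq0 // -unitfE -unitmxE.
pose r := k / (\det g * c); have r0 : r != 0 by rewrite mulf_neq0 ?invr_eq0.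
(* Scaling the frame by [s] multiplies the framed map by s^4, three factors from the cubic and one
   from the adjugate; a fourth root thus realizes any prescribed scalar. *)
have [s s4] : exists s, s ^+ 4 = r by exists (4.-root r); rewrite rootCK.
have s0 : s != 0 by apply: contraNneq r0 => z; rewrite -s4 z expr0n.
have us : s *: g \in unitmx by rewrite unitmxZ ?unitfE.
have h : conj_via (s *: g) (c * s ^+ 2) f f' by apply/conj_via_scale => //; rewrite mulfK ?expf_neq0.
have := framed_conj h; set y := (_, _) => e.
exists ((s *: g) 0 0), ((s *: g) 1 0), ((s *: g) 0 1), ((s *: g) 1 1); rewrite -/y; split; last first.
  rewrite e (_ : \det (s *: g) * (c * s ^+ 2) = k) //.
  by rewrite detZ; transitivity (s ^+ 4 * (\det g * c)); [ring|rewrite s4 divfK].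
by rewrite /fdet /y /= -matP -unitfE -unitmxE.
Qed.

Lemma ev2_sum (h : {poly {poly algC}}) : exists N, forall a b,
  ev2 a b h = \sum_(j <- index_enum 'I_N) \sum_(i <- index_enum 'I_N) h`_j`_i * a ^+ i * b ^+ j.
Proof.
pose n := size h; pose m := \max_(i < n) size (h`_i)%R; exists (n + m)%N => a b.
rewrite ev2E (@horner_coef_wide _ (n + m)); last first.
  by rewrite (leq_trans (size_poly _ _)) // leq_addr.
apply: eq_bigr => j _; rewrite coef_map /= /horner_eval (@horner_coef_wide _ (n + m)) ?mulr_suml //.
have [jn|jn] := ltnP j n; last by rewrite nth_default // size_poly0.
by rewrite (leq_trans _ (leq_addl _ _)) //; apply: (leq_bigmax (Ordinal jn)).
Qed.

Lemma equivariant_lift (y : Y4) om la : fdet y != 0 -> equivariant om la y ->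
  exists f' : endo_lift 3, framed y = (fun v => fdet y *: fv f' v) /\
    conj_via (mat om 0 0 1) la f' f'.
Proof.
case: y => u0 [u1 [w0 [w1 f]]] D0 eq; pose g := mat u0 w0 u1 w1.
have ug : g \in unitmx by rewrite unitmxE unitfE.
have [f' ff'] := lift_conj_via f ug; exists f'.
have E : framed (u0, (u1, (w0, (w1, f)))) = fun v => fdet (u0, (u1, (w0, (w1, f)))) *: fv f' v.
  by have := framed_conj ff'; rewrite /g !mxE /= mulr1.
split=> // v; apply: (scalerI D0); have := eq v; rewrite E => ->.
by rewrite -scalemxAr !scalerA mulrC.
Qed.

(** * Closedness of the parametrizations *)

Definition u2 : {poly {poly algC}} := 1 - 'X%:P * 'X.

Lemma ev2_u2 a b : ev2 a b u2 = 1 - a * b.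
Proof. by rewrite /u2 ev2B ev2M ev2X (ev2C _ _ 'X) hornerX (rmorph1 (ev2 a b)). Qed.

Lemma u2_neq0 : u2 != 0.
Proof.
apply: contraTneq (oner_neq0 algC) => e; have := ev2_u2 0 0.
by rewrite e (rmorph0 (ev2 0 0)) mulr0 subr0 => <-; rewrite eqxx.
Qed.

Lemma u2P a b : (ev2 a b u2 != 0) = (a * b != 1).
Proof. by rewrite ev2_u2 subr_eq0 eq_sym. Qed.

Definition phi1 a b := moduli_of (pair1 (a, b)).
Definition phi2 a b := moduli_of (pair2 (a, b)).
Definition phi3 a := moduli_of (pair3 a).

Lemma nf1_equivariant (h : 'cV[algC]_2 -> 'cV[algC]_2) a b c d :
  (forall x y, h (vec x y) = vec (a * x ^+ 3 + b * (x * y ^+ 2)) (c * (x ^+ 2 * y) + d * y ^+ 3)) ->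
  forall v, h (mat (-1) 0 0 1 *m v) = 1 *: (mat (-1) 0 0 1 *m h v).
Proof. by move=> E v; rewrite [v]vecP mat_vec !E mat_vec scale_vec; congr vec; ring. Qed.

Lemma nf2_equivariant (h : 'cV[algC]_2 -> 'cV[algC]_2) a b c d :
  (forall x y, h (vec x y) = vec (a * (x ^+ 2 * y) + b * y ^+ 3) (c * x ^+ 3 + d * (x * y ^+ 2))) ->
  forall v, h (mat (-1) 0 0 1 *m v) = -1 *: (mat (-1) 0 0 1 *m h v).
Proof. by move=> E v; rewrite [v]vecP mat_vec !E mat_vec scale_vec; congr vec; ring. Qed.

Section Closed1.
Variable S : set {poly {poly algC}}.
Let Delta p q := ev2 p q u2 != 0 /\ forall h, S h -> ev2 p q h = 0.
Let Q (h : 'cV[algC]_2 -> 'cV[algC]_2) := exists p q a d, Delta p q /\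
  forall x y, h (vec x y) = vec (a * x ^+ 3 + p * d * (x * y ^+ 2)) (q * a * (x ^+ 2 * y) + d * y ^+ 3).

(** The parameters are the ratios p = be / de and q = ga / al of coefficients, which are read off
    from the values of [framed] at (1, 0), (0, 1) and (1, 1). Multiplying h(p, q) by de^N al^N
    clears denominators and gives a polynomial in the frame and in [f]. *)
Let Q_sep y : fdet y != 0 -> equivariant (-1) 1 y -> ~ Q (framed y) ->
  exists phi, [/\ regular ev_lines4 phi, forall y, framed_locus Q y -> phi y = 0 & phi y != 0].
Proof.
move=> D0 eq nQ; have [f' [fE fa]] := equivariant_lift D0 eq.
have [[_ [a [b [c [d nf]]]]]|[/eqP]] := neg_diag_aut fa; last by rewrite eq_sym (negPf onen).
have [a0 d0 bc _] := nf1_class nf; set D := fdet y in D0 fE.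
have uv : ev2 (b / d) (c / a) u2 != 0.
  rewrite u2P; apply: contra bc => /eqP/(congr1 ( *%R (a * d))) e.
  by apply/eqP; apply: (lincomb1 (k := 1) e); field; rewrite a0 d0.
have [h [Sh hn]] : exists h, S h /\ ev2 (b / d) (c / a) h != 0.
  apply: contrapT => n; apply: nQ; exists (b / d), (c / a), (D * a), (D * d); split.
    by split=> // h Sh; apply: contrapT => /eqP hn; apply: n; exists h.
  by move=> x y'; rewrite fE nf scale_vec; congr vec; field; rewrite ?a0 ?d0.
have [N hE] := ev2_sum h.
pose al (y : Y4) := framed y (vec 1 0) 0 0; pose de (y : Y4) := framed y (vec 0 1) 1 0.
pose be (y : Y4) := framed y (vec 1 1) 0 0 - al y; pose ga (y : Y4) := framed y (vec 1 1) 1 0 - de y.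
have hom (t : Y4) p q : be t = p * de t -> ga t = q * al t ->
   \sum_(j <- index_enum 'I_N) \sum_(i <- index_enum 'I_N)
     h`_j`_i * (be t ^+ i * de t ^+ (N - i)) * (ga t ^+ j * al t ^+ (N - j)) =
   (de t ^+ N * al t ^+ N) * ev2 p q h.
  move=> -> ->; rewrite hE mulr_sumr; apply: eq_bigr => j _; rewrite mulr_sumr; apply: eq_bigr => i _.
  have -> : al t ^+ N = al t ^+ j * al t ^+ (N - j) by rewrite -exprD subnKC // ltnW.
  have -> : de t ^+ N = de t ^+ i * de t ^+ (N - i) by rewrite -exprD subnKC // ltnW.
  by rewrite !exprMn; ring.
exists (fun y => \sum_(j <- index_enum 'I_N) \sum_(i <- index_enum 'I_N)
     h`_j`_i * (be y ^+ i * de y ^+ (N - i)) * (ga y ^+ j * al y ^+ (N - j))); split.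
- have rf v i : regular ev_lines4 (fun y => framed y v i 0) by apply: regular_framed.
  have ral : regular ev_lines4 al by apply: rf.
  have rde : regular ev_lines4 de by apply: rf.
  have rbe : regular ev_lines4 be by apply: regularB; apply: rf.
  have rga : regular ev_lines4 ga by apply: regularB; apply: rf.
  apply: regular_sum => j; apply: regular_sum => i; apply: regularM.
    by apply: regularM; [exact: (regular_cst cst4)|apply: regularM; apply: regularX].
  by apply: regularM; apply: regularX.
- move=> y' [D' [p [q [a' [d' [[_ z] E]]]]]]; rewrite (hom _ p q) ?z ?mulr0 //.
    by rewrite /be /al /de !E !vec0 !vec1; ring.
  by rewrite /ga /al /de !E !vec0 !vec1; ring.
have [eal ede] : al y = D * a /\ de y = D * d.
  by rewrite /al /de fE !nf !scale_vec vec0 vec1; split; ring.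
rewrite (hom _ (b / d) (c / a)).
- by rewrite !mulf_neq0 ?expf_neq0 // ?eal ?ede mulf_neq0.
- by rewrite /be eal ede fE nf scale_vec vec0; field.
- by rewrite /ga eal ede fE nf scale_vec vec1; field.
Qed.

Lemma phi1_closed : closed (surf_image phi1 u2 S).
Proof.
apply: closed_separated.
rewrite (_ : [set f | _] = [set f | exists u0 u1 w0 w1, framed_locus Q (u0, (u1, (w0, (w1, f))))]).
  apply: (@framed_locus_separated (-1) 1) => //; first exact: onen.
  - by move=> h [p [q [a [d [_ E]]]]]; apply: nf1_equivariant E.
  move=> h a b a0 b0 [p [q [c [d [Dl E]]]]].
  exists p, q, (b * a ^+ 3 * c), (a * b ^+ 3 * d); split=> // x y.
  by rewrite mat_vec E mat_vec; congr vec; ring.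
apply/seteqP; split=> f /=.
  move=> [a [b [uab z e]]]; apply/framed_locusP.
  have := uab; rewrite u2P => ab; have [_ /(_ e)[g eg ->]] := @moduli_ofP (pair1 (a, b)) (moduli_class f) (pair1_endo ab).
  exists g, 1; split=> //; first exact: oner_neq0.
  exists a, b, 1, 1; split=> // x y; rewrite eg fv_pair1 scale_vec; congr vec; ring.
move=> /framed_locusP[g [k [-> k0 [p [q [a [d [[upq z] E]]]]]]]].
have nf : nf1 g (a / k) (p * (d / k)) (q * (a / k)) (d / k).
  move=> x y; apply: (scalerI k0); rewrite E scale_vec.
  by congr vec; field.
have [a0 d0 _] := nf1_class nf; rewrite !mulfK // => h.
exists p, q; split=> //; apply/moduli_ofP => //; apply: pair1_endo.
by rewrite -u2P.
Qed.
End Closed1.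

Section Closed2.
Variable S : set {poly {poly algC}}.
Let Delta p q := ev2 p q u2 != 0 /\ forall h, S h -> ev2 p q h = 0.
Let Q (h : 'cV[algC]_2 -> 'cV[algC]_2) := exists p q s b c, [/\ Delta p q, s ^+ 2 = b * c &
  forall x y, h (vec x y) = vec (p * s * (x ^+ 2 * y) + b * y ^+ 3) (c * x ^+ 3 + q * s * (x * y ^+ 2))].

(* The parameters (p, q) of the normal form are only determined up to a common
   sign, the choice of a square root s of b * c; the product of the values of h
   at (p, q) and (-p, -q) is a polynomial in the coefficients. *)
Let Q_sep y : fdet y != 0 -> equivariant (-1) (-1) y -> ~ Q (framed y) ->
  exists phi, [/\ regular ev_lines4 phi, forall y, framed_locus Q y -> phi y = 0 & phi y != 0].
Proof.
move=> D0 eq nQ; have [f' [fE fa]] := equivariant_lift D0 eq.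
have [[/eqP]|[_ [a [b [c [d nf]]]]]] := neg_diag_aut fa; first by rewrite (negPf onen).
pose s := sqrtC (b * c); have s2 : s ^+ 2 = b * c by rewrite sqrtCK.
have [b0 c0 ad _] := nf2_class nf s2; set D := fdet y in D0 fE.
have s0 : s != 0 by rewrite -sqrf_eq0 s2 mulf_neq0.
have ns r : r ^+ 2 = b * c -> exists h, S h /\ ev2 (a / r) (d / r) h != 0.
  move=> r2; have r0 : r != 0 by rewrite -sqrf_eq0 r2 mulf_neq0.
  have uv : ev2 (a / r) (d / r) u2 != 0.
    rewrite u2P; apply: contra ad => /eqP/(congr1 ( *%R (r ^+ 2))) e.
    by apply/eqP; rewrite -r2; apply: (lincomb1 (k := 1) e); field.
  apply: contrapT => n; apply: nQ; exists (a / r), (d / r), (D * r), (D * b), (D * c); split.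
  - by split=> // h Sh; apply: contrapT => /eqP hn; apply: n; exists h.
  - by rewrite exprMn r2; ring.
  by move=> x y'; rewrite fE nf scale_vec; congr vec; field.
(* One equation must be nonzero at both sign choices. If each of [g1], [g2] fails at the point where
   the other works, their sum works at both. *)
have [h [hD h1 h2]] : exists h, [/\ forall p q, Delta p q -> ev2 p q h = 0,
    ev2 (a / s) (d / s) h != 0 & ev2 (a / - s) (d / - s) h != 0].
  have [g1 [Sg1 n1]] := ns s s2; have [|g2 [Sg2 n2]] := ns (- s); first by rewrite sqrrN.
  have [z1|z1] := eqVneq (ev2 (a / - s) (d / - s) g1) 0; last first.
    by exists g1; split=> // p q [_]; apply.
  have [z2|z2] := eqVneq (ev2 (a / s) (d / s) g2) 0; last first.
    by exists g2; split=> // p q [_]; apply.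
  exists (g1 + g2); rewrite !ev2D z1 z2 addr0 add0r; split=> // p q [_ z].
  by rewrite ev2D !z // addr0.
have [N hE] := ev2_sum h.
pose be (y : Y4) := framed y (vec 0 1) 0 0; pose ga (y : Y4) := framed y (vec 1 0) 1 0.
pose al (y : Y4) := framed y (vec 1 1) 0 0 - be y; pose de (y : Y4) := framed y (vec 1 1) 1 0 - ga y.
(* With r^2 = be ga, p = al / r and q = de / r, the homogenization of h(p, q) is ev + r od, split by
   the parity of i + j. Its norm ev^2 - be ga od^2 no longer involves the square root. *)
pose ev (y : Y4) := \sum_(j <- index_enum 'I_N) \sum_(i <- index_enum 'I_N)
  (if odd (i + j) then 0 else h`_j`_i) * (al y ^+ i * de y ^+ j) * (be y * ga y) ^+ (N - (i + j)./2).
pose od (y : Y4) := \sum_(j <- index_enum 'I_N) \sum_(i <- index_enum 'I_N)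
  (if odd (i + j) then h`_j`_i else 0) * (al y ^+ i * de y ^+ j) * (be y * ga y) ^+ (N - uphalf (i + j)).
have hom (t : Y4) p q r : r ^+ 2 = be t * ga t -> al t = p * r -> de t = q * r ->
   ev t + r * od t = r ^+ (2 * N) * ev2 p q h.
  move=> r2 ea ed; rewrite /ev /od ea ed -r2 hE !mulr_sumr -big_split; apply: eq_bigr => j _ /=.
  rewrite !mulr_sumr -big_split; apply: eq_bigr => i _ /=; rewrite -!exprM.
  have ij : (i + j < 2 * N)%N by rewrite mul2n -addnn -addSn leq_add // ltnW.
  have half := odd_double_half (i + j).
  have [od1|ev1] := boolP (odd (i + j)).
    rewrite od1 add1n in half.
    have -> : (r ^+ (2 * N))%R = r * r ^+ i * r ^+ j * r ^+ (2 * (N - uphalf (i + j))).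
      by rewrite -exprS -!exprD; congr (_ ^+ _); rewrite uphalf_half od1; lia.
    by rewrite !exprMn; ring.
  rewrite (negPf ev1) add0n in half.
  have -> : (r ^+ (2 * N))%R = r ^+ i * r ^+ j * r ^+ (2 * (N - (i + j)./2)).
    by rewrite -!exprD; congr (_ ^+ _); lia.
  by rewrite !exprMn; ring.
have norm (t : Y4) p q r : r ^+ 2 = be t * ga t -> al t = p * r -> de t = q * r ->
   ev t ^+ 2 - be t * ga t * od t ^+ 2 = r ^+ (4 * N) * (ev2 p q h * ev2 (- p) (- q) h).
  move=> r2 ea ed; have e1 := hom _ _ _ _ r2 ea ed.
  have e2 : ev t - r * od t = r ^+ (2 * N) * ev2 (- p) (- q) h.
    have := hom t (- p) (- q) (- r); rewrite sqrrN !mulrNN => /(_ r2 ea ed).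
    by rewrite mulNr exprM sqrrN -exprM.
  have -> : r ^+ (4 * N) = r ^+ (2 * N) * r ^+ (2 * N) by rewrite -exprD -mulnDl.
  by transitivity ((ev t + r * od t) * (ev t - r * od t)); [rewrite -r2; ring|rewrite e1 e2; ring].
exists (fun y => ev y ^+ 2 - be y * ga y * od y ^+ 2); split.
- have rf v i : regular ev_lines4 (fun y => framed y v i 0) by apply: regular_framed.
  have rbe : regular ev_lines4 be by apply: rf.
  have rga : regular ev_lines4 ga by apply: rf.
  have ral : regular ev_lines4 al by apply: regularB; first exact: rf.
  have rde : regular ev_lines4 de by apply: regularB; first exact: rf.
  have rev : regular ev_lines4 ev.
    apply: regular_sum => j; apply: regular_sum => i; apply: regularM.
      by apply: regularM; [exact: (regular_cst cst4)|apply: regularM; apply: regularX].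
    by apply: regularX; apply: regularM.
  have rod : regular ev_lines4 od.
    apply: regular_sum => j; apply: regular_sum => i; apply: regularM.
      by apply: regularM; [exact: (regular_cst cst4)|apply: regularM; apply: regularX].
    by apply: regularX; apply: regularM.
  apply: regularB; first exact: regularX.
  by apply: regularM; [apply: regularM|apply: regularX].
- move=> y' [D' [p [q [r [b' [c' [Dl r2 E]]]]]]].
  have [eb ec] : be y' = b' /\ ga y' = c' by rewrite /be /ga !E vec0 vec1; split; ring.
  rewrite (norm _ p q r) ?(hD p q Dl) ?mul0r ?mulr0 // ?eb ?ec //.
    by rewrite /al eb E vec0; ring.
  by rewrite /de ec E vec1; ring.
have [eb ec] : be y = D * b /\ ga y = D * c.
  by rewrite /be /ga fE !nf !scale_vec vec0 vec1; split; ring.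
rewrite (norm _ (a / s) (d / s) (D * s)).
- by rewrite !mulf_neq0 ?expf_neq0 // ?mulf_neq0 //; move: h2; rewrite !invrN !mulrN.
- by rewrite eb ec exprMn s2; ring.
- by rewrite /al eb fE nf scale_vec vec0; field.
- by rewrite /de ec fE nf scale_vec vec1; field.
Qed.

Lemma phi2_closed : closed (surf_image phi2 u2 S).
Proof.
apply: closed_separated.
rewrite (_ : [set f | _] = [set f | exists u0 u1 w0 w1, framed_locus Q (u0, (u1, (w0, (w1, f))))]).
  apply: (@framed_locus_separated (-1) (-1)) => //; first exact: onen.
  - by move=> h [p [q [s [b [c [_ _ E]]]]]]; apply: nf2_equivariant E.
  move=> h a b a0 b0 [p [q [s [c [d [Dl s2 E]]]]]].
  exists p, q, (a ^+ 2 * b ^+ 2 * s), (b ^+ 4 * c), (a ^+ 4 * d); split=> //.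
    by rewrite exprMn s2; ring.
  by move=> x y; rewrite mat_vec E mat_vec; congr vec; ring.
apply/seteqP; split=> f /=.
  move=> [a [b [uab z e]]]; apply/framed_locusP.
  have := uab; rewrite u2P => ab; have [_ /(_ e)[g eg ->]] := @moduli_ofP (pair2 (a, b)) (moduli_class f) (pair2_endo ab).
  exists g, 1; split=> //; first exact: oner_neq0.
  exists a, b, 1, 1, 1; rewrite expr1n mulr1; split=> // x y; rewrite eg fv_pair2 scale_vec; congr vec; ring.
move=> /framed_locusP[g [k [-> k0 [p [q [s [b [c [[upq z] s2 E]]]]]]]]].
have nf : nf2 g (p * (s / k)) (b / k) (c / k) (q * (s / k)).
  move=> x y; apply: (scalerI k0); rewrite E scale_vec.
  by congr vec; field.
have sk : (s / k) ^+ 2 = b / k * (c / k) by rewrite expr_div_n s2; field.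
have [b0 c0 _] := nf2_class nf sk.
have sk0 : s / k != 0 by rewrite -sqrf_eq0 sk mulf_neq0.
rewrite !mulfK // => h; exists p, q; split=> //; apply/moduli_ofP => //; apply: pair2_endo.
by rewrite -u2P.
Qed.
End Closed2.

Section Closed3.
Variable S : set {poly algC}.
Let Delta (p : algC) := p != 0 /\ forall h, S h -> h.[p] = 0.
Let Q (h : 'cV[algC]_2 -> 'cV[algC]_2) := exists p a b, Delta p /\
  forall x y, h (vec x y) = vec (a * x ^+ 3 + b * y ^+ 3) (p * a * (x ^+ 2 * y)).
Variable ze : algC.
Hypothesis ze3 : ze ^+ 3 = 1.
Hypothesis ze1 : ze != 1.

Let ze0 : ze != 0.
Proof. by apply: contra_eqN ze3 => /eqP ->; rewrite expr0n eq_sym oner_neq0. Qed.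

Let ze2 : ze ^+ 2 != 1.
Proof. by apply: contraNneq ze1 => h; rewrite -ze3 exprS h mulr1. Qed.

Let Q_sep y : fdet y != 0 -> equivariant ze (ze ^+ 2) y -> ~ Q (framed y) ->
  exists phi, [/\ regular ev_lines4 phi, forall y, framed_locus Q y -> phi y = 0 & phi y != 0].
Proof.
move=> D0 eq nQ; have [f' [fE fa]] := equivariant_lift D0 eq.
have zN : ze <> -1.
  by move=> e; move: ze3; rewrite e exprS sqrrN expr1n mulr1 => /eqP; rewrite (negPf onen).
(* [diag_aut] also allows the mirror image of [nf3], but that one has scalar 1 instead of ze^2 and
   would create a common zero at (1 : 0). *)
have [a [b [c nf]]] : exists a b c, nf3 f' a b c.
  have [[[h _ _]|[h _ _]|[_ h]|[_ [a [b [c E]]]]]|[h _ _]] := diag_aut ze0 ze1 fa; try (by case: zN); try exact: h.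
    have e10 : fv f' (vec 1 0) = vec 0 a by rewrite E; congr vec; ring.
    have := fa (vec 1 0); rewrite mat_vec mulr1 !mulr0 addr0 mul0r addr0 e10 E mat_vec scale_vec.
    move=> /vec2_inj[_ e2]; have a0 : a = 0.
      have /eqP : (1 - ze ^+ 2) * a = 0 by apply: (lincomb2 (k := 1) (k' := - a) e2 ze3); ring.
      by rewrite mulf_eq0 subr_eq0 eq_sym (negPf ze2) => /eqP.
    have := @endo_fv_neq0 3 f' (vec 1 0).
    by rewrite e10 a0 !vec_neq0 oner_neq0 eqxx => /(_ isT).
  by move: ze1; rewrite -h exprS ze3 mulr1 eqxx.
have [a0 b0 c0 _] := nf3_class nf; set D := fdet y in D0 fE.
have [h [Sh hn]] : exists h, S h /\ h.[c / a] != 0.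
  apply: contrapT => n; apply: nQ; exists (c / a), (D * a), (D * b); split.
    split; first by rewrite mulf_neq0 ?invr_eq0.
    by move=> h Sh; apply: contrapT => /eqP hn; apply: n; exists h.
  by move=> x y'; rewrite fE nf scale_vec; congr vec; field.
pose al (y : Y4) := framed y (vec 1 0) 0 0; pose ga (y : Y4) := framed y (vec 1 1) 1 0.
have hom (t : Y4) p : ga t = p * al t ->
   \sum_(i <- index_enum 'I_(size h)) h`_i * (ga t ^+ i * al t ^+ (size h - i)) = al t ^+ size h * h.[p].
  move=> ->; rewrite horner_coef mulr_sumr; apply: eq_bigr => i _.
  have -> : al t ^+ size h = al t ^+ i * al t ^+ (size h - i) by rewrite -exprD subnKC // ltnW.
  by rewrite !exprMn; ring.
exists (fun y => \sum_(i <- index_enum 'I_(size h)) h`_i * (ga y ^+ i * al y ^+ (size h - i))); split.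
- have rf v i : regular ev_lines4 (fun y => framed y v i 0) by apply: regular_framed.
  have ral : regular ev_lines4 al by apply: rf.
  have rga : regular ev_lines4 ga by apply: rf.
  apply: regular_sum => i; apply: regularM; first exact: (regular_cst cst4).
  by apply: regularM; apply: regularX.
- move=> y' [D' [p [a' [b' [[_ z] E]]]]]; rewrite (hom _ p) ?z ?mulr0 //.
  by rewrite /ga /al !E vec0 vec1; ring.
have eal : al y = D * a by rewrite /al fE nf scale_vec vec0; ring.
rewrite (hom _ (c / a)); first by rewrite mulf_neq0 // expf_neq0 // eal mulf_neq0.
by rewrite /ga eal fE nf scale_vec vec1; field.
Qed.

Lemma phi3_closed : closed (curve_image phi3 'X S).
Proof.
apply: closed_separated.
rewrite (_ : [set f | _] = [set f | exists u0 u1 w0 w1, framed_locus Q (u0, (u1, (w0, (w1, f))))]).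
  apply: (@framed_locus_separated ze (ze ^+ 2)) => //.
  - move=> h [p [a [b [_ E]]]] v; rewrite [v]vecP mat_vec !E mat_vec scale_vec; congr vec.
      by apply: (lincomb1 (k := - b * v 1 0 ^+ 3) ze3); ring.
    by ring.
  move=> h a b a0 b0 [p [c [d [Dl E]]]].
  exists p, (b * a ^+ 3 * c), (b ^+ 4 * d); split=> // x y.
  by rewrite mat_vec E mat_vec; congr vec; ring.
apply/seteqP; split=> f /=.
  move=> [a [uab z e]]; apply/framed_locusP; rewrite hornerX in uab.
  have [_ /(_ e)[g eg ->]] := @moduli_ofP (pair3 a) (moduli_class f) (pair3_endo uab).
  exists g, 1; split=> //; first exact: oner_neq0.
  exists a, 1, a; split=> // x y; rewrite eg fv_pair3 scale_vec; congr vec; ring.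
move=> /framed_locusP[g [k [-> k0 [p [a [b [[p0 z] E]]]]]]].
have nf : nf3 g (a / k) (b / k) (p * (a / k)).
  move=> x y; apply: (scalerI k0); rewrite E scale_vec.
  by congr vec; field.
have [a0 _ _] := nf3_class nf; rewrite mulfK // => h.
by exists p; rewrite hornerX; split=> //; apply/moduli_ofP => //; apply: pair3_endo.
Qed.
End Closed3.

(** * Irreducibility and dimension of the loci *)

Section Chains.
Variable T : topologicalType.
Implicit Types K S : set T.

Lemma irreducible_singleton (p : T) : closed [set p] -> irreducible_closed [set p].
Proof.
move=> cp; split=> //; first by exists p.
by move=> A B _ _ /(_ p erefl)[h|h]; [left|right] => _ ->.
Qed.

Lemma has_chain1 (p : T) K : closed [set p] -> irreducible_closed K -> [set p] `<` K -> has_chain K 1.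
Proof.
move=> /irreducible_singleton ip iK pK; exists (fun i => if i is 0%N then [set p] else K); split.
  by move=> [|i] _; split=> //; apply: properW.
by move=> [|i].
Qed.

Lemma has_chain2 (p : T) K S : closed [set p] -> irreducible_closed K -> irreducible_closed S ->
  [set p] `<` K -> K `<` S -> has_chain S 2.
Proof.
move=> /irreducible_singleton ip iK iS pK KS.
exists (fun i => match i with 0%N => [set p] | 1%N => K | _ => S end); split.
  move=> [|[|i]] _; split=> //; last exact: properW.
  exact: subset_trans (properW pK) (properW KS).
by move=> [|[|i]].
Qed.

End Chains.

Lemma nth_ev (I : Type) (R : comNzRingType) (ev : I -> {rmorphism R -> algC}) t (v : seq R) (w : seq algC) :
  map (ev t) v = w -> forall i, nth 0 w i = ev t (nth 0 v i).
Proof.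
move=> <- i; have [iv|iv] := ltnP i (size v); first by rewrite (nth_map 0).
by rewrite !nth_default ?rmorph0 // size_map.
Qed.

Lemma moduli_of_class F (h : is_endo 3 F) : moduli_of F = moduli_class (mk_lift h).
Proof. by apply/esym/moduli_ofP => //; exists (mk_lift h). Qed.

Lemma family_moduli_of (I : Type) (D : set I) F : (forall t, D t -> is_endo 3 (F t)) ->
  pair_family D F = [set m | exists2 t, D t & m = moduli_of (F t)].
Proof.
move=> h; apply/seteqP; split=> m [t Dt] e; exists t => //; first by apply/(moduli_ofP m (h t Dt)).
by apply/(moduli_ofP m (h t Dt)).
Qed.

Lemma locusS1E : locusS1 = surf_image phi1 u2 set0.
Proof.
rewrite /locusS1 family_moduli_of; last by move=> [a b] /= /pair1_endo.
apply/seteqP; split=> m; first by move=> [[a b] /= ab ->]; exists a, b; rewrite u2P.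
by move=> [a [b [ab _ ->]]]; exists (a, b) => //=; rewrite -u2P.
Qed.

Lemma locusS2E : locusS2 = surf_image phi2 u2 set0.
Proof.
rewrite /locusS2 family_moduli_of; last by move=> [a b] /= /pair2_endo.
apply/seteqP; split=> m; first by move=> [[a b] /= ab ->]; exists a, b; rewrite u2P.
by move=> [a [b [ab _ ->]]]; exists (a, b) => //=; rewrite -u2P.
Qed.

Definition phiK1 a := moduli_of (pair2 (a, a)).
Definition phiK2 a := moduli_of (pairK2 a).
Definition uK : {poly algC} := 1 - 'X^2.

Lemma uK_neq0 : uK != 0.
Proof.
apply: contraTneq (oner_neq0 algC) => e; have : uK.[0] = 1 by rewrite !hornerE expr0n subr0.
by rewrite e horner0 => <-; rewrite eqxx.
Qed.

Lemma uKP a : (uK.[a] != 0) = (a ^+ 2 != 1).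
Proof. by rewrite !hornerE subr_eq0 eq_sym. Qed.

Lemma locusK1E : locusK1 = curve_image phiK1 uK set0.
Proof.
rewrite /locusK1 family_moduli_of; last by move=> a /= /sqr_neq1 a2; apply: pair2_endo; rewrite -expr2.
apply/seteqP; split=> m; first by move=> [a /= /sqr_neq1 a2 ->]; exists a; rewrite uKP.
by move=> [a [a2 _ ->]]; exists a => //=; apply/sqr_neq1; rewrite -uKP.
Qed.

Lemma locusK2E : locusK2 = curve_image phiK2 uK set0.
Proof.
rewrite /locusK2 family_moduli_of; last by move=> a /= /sqr_neq1; apply: pairK2_endo.
apply/seteqP; split=> m; first by move=> [a /= /sqr_neq1 a2 ->]; exists a; rewrite uKP.
by move=> [a [a2 _ ->]]; exists a => //=; apply/sqr_neq1; rewrite -uKP.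
Qed.

Lemma locus3E : locus3 = curve_image phi3 'X set0.
Proof.
rewrite /locus3 family_moduli_of; last by move=> a; apply: pair3_endo.
apply/seteqP; split=> m; first by move=> [a /= a0 ->]; exists a; rewrite hornerX.
by move=> [a [+ _ ->]]; rewrite hornerX => a0; exists a.
Qed.

Lemma mulNiCi (a : algC) : (- 'i * a) * ('i * a) = a ^+ 2.
Proof. by apply: (lincomb1 (k := - a ^+ 2) (sqrCi algC)); ring. Qed.

(** A rescaling by [t] with t^4 = -1 places the second curve inside the parameter plane of the
    second surface, on the line b = -a; the first curve is its diagonal. The closedness of both
    curves is inherited from [phi2_closed]. *)
Lemma phi_eqs a : a ^+ 2 != 1 -> phiK2 a = phi2 (- 'i * a) ('i * a).
Proof.
move=> a2; have ab : (- 'i * a) * ('i * a) != 1 by rewrite mulNiCi.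
have hK := pairK2_endo a2; have hP := pair2_endo ab; apply/moduli_ofP => //.
rewrite /phiK2 (moduli_of_class hK); apply/class_of_pairP; split=> //.
pose t : algC := sqrtC 'i; have t2 : t ^+ 2 = 'i by rewrite sqrtCK.
have t0 : t != 0 by rewrite -sqrf_eq0 t2 neq0Ci.
have t4 : t ^+ 4 = -1 by rewrite -[4%N]/(2 * 2)%N exprM t2 sqrCi.
exists (mat t 0 0 1), (t ^+ 3); split; rewrite ?expf_neq0 ?mat_unit ?mulr0 ?subr0 ?mulr1 // => v.
rewrite [v]vecP mat_vec fv_pairK2 fv_pair2 mat_vec scale_vec -t2; move: (v 0 0) (v 1 0) => x y; congr vec.
  by apply: (lincomb1 (k := a * t ^+ 2 * x ^+ 2 * y - y ^+ 3) t4); ring.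
by apply: (lincomb1 (k := - a * t * x * y ^+ 2) t4); ring.
Qed.

Lemma phiK1_closed S : closed (curve_image phiK1 uK S).
Proof.
rewrite (_ : curve_image _ _ _ = surf_image phi2 u2 ([set 'X - 'X%:P] `|` [set p%:P | p in S])).
  exact: phi2_closed.
apply/seteqP; split=> m.
  move=> [a [a2 z ->]]; exists a, a; rewrite u2P -expr2 -uKP; split=> // h [->|[p Sp <-]].
    by rewrite ev2B ev2X (ev2C _ _ 'X) hornerX subrr.
  by rewrite ev2C z.
move=> [a [b [ab z ->]]]; have := z _ (or_introl erefl).
rewrite ev2B ev2X (ev2C _ _ 'X) hornerX => /eqP; rewrite subr_eq0 => /eqP e.
rewrite u2P e -expr2 in ab; exists a; rewrite uKP; split=> //; last by rewrite e.
by move=> p Sp; rewrite -(ev2C a b); apply: z; right; exists p.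
Qed.

Lemma phiK2_closed S : closed (curve_image phiK2 uK S).
Proof.
(* The curve parameter is 'i times the first coordinate of the plane, which explains the
   substitution in the equations of [S]. *)
rewrite (_ : curve_image _ _ _ = surf_image phi2 u2 ([set 'X + 'X%:P] `|` [set (p \Po ('i *: 'X))%:P | p in S])).
  exact: phi2_closed.
have i2 (a : algC) : 'i * (- 'i * a) = a.
  by apply: (lincomb1 (k := - a) (sqrCi algC)); ring.
apply/seteqP; split=> m.
  move=> [a [a2 z ->]]; exists (- 'i * a), ('i * a); rewrite u2P mulNiCi -uKP; split=> //.
    move=> h [->|[p Sp <-]]; first by rewrite ev2D ev2X (ev2C _ _ 'X) hornerX mulNr addrN.
    by rewrite ev2C horner_comp hornerZ hornerX i2 z.
  by apply: phi_eqs; rewrite -uKP.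
move=> [a [b [ab z ->]]]; have := z _ (or_introl erefl).
rewrite ev2D ev2X (ev2C _ _ 'X) hornerX => /eqP; rewrite addr_eq0 => /eqP e.
have ea : - 'i * ('i * a) = a by rewrite -[RHS]i2; ring.
have eb : 'i * ('i * a) = b by rewrite e -{2}ea; ring.
rewrite u2P -{1}ea -{1}eb mulNiCi in ab; exists ('i * a); rewrite uKP; split=> //; last first.
  by rewrite phi_eqs // ea eb.
move=> p Sp; have := z _ (or_intror (ex_intro2 _ _ p Sp erefl)).
by rewrite ev2C horner_comp !hornerE.
Qed.

Definition cst2_poly : {rmorphism algC -> {poly {poly algC}}} := polyC \o polyC.

Lemma phi1_continuous C a b : closed C -> ev2 a b u2 != 0 -> ~ C (phi1 a b) ->
  exists h, (forall a b, ev2 a b u2 != 0 -> C (phi1 a b) -> ev2 a b h = 0) /\ ev2 a b h != 0.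
Proof.
(* Coefficients in the order of [coords]: increasing powers of X, numerator before denominator. *)
move=> cC uab nC; pose v : seq {poly {poly algC}} := [:: 0; 'X%:P; 0; 1; 1; 0; 'X; 0].
have [||h [h1 h2]] := @param_continuous _ _ (fun t => ev2 t.1 t.2) cst2_poly (fun t => phi1 t.1 t.2) v
  (fun t => ev2 t.1 t.2 u2 != 0) _ _ C (a, b) cC uab nC; last by exists h; split=> // c d; apply: (h1 (c, d)).
  by move=> c [x y]; apply: etrans (ev2C x y c%:P) (hornerC _ _).
move=> [x y]; rewrite u2P => /pair1_endo hF; exists (mk_lift hF) => [|i]; first exact: moduli_of_class.
rewrite (@coords_cub _ 1 0 x 0 0 y 0 1); last by move=> X Y; rewrite fv_pair1 /=; congr vec; rewrite /cub; ring.
apply: (@nth_ev _ _ (fun t => ev2 t.1 t.2) (x, y) v); rewrite -[LHS]/[:: ev2 x y 0; ev2 x y 'X%:P; ev2 x y 0; ev2 x y 1; ev2 x y 1; ev2 x y 0; ev2 x y 'X; ev2 x y 0].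
by rewrite (rmorph0 (ev2 x y)) (rmorph1 (ev2 x y)) ev2X (ev2C _ _ 'X) hornerX.
Qed.

Lemma phi2_continuous C a b : closed C -> ev2 a b u2 != 0 -> ~ C (phi2 a b) ->
  exists h, (forall a b, ev2 a b u2 != 0 -> C (phi2 a b) -> ev2 a b h = 0) /\ ev2 a b h != 0.
Proof.
move=> cC uab nC; pose v : seq {poly {poly algC}} := [:: 1; 0; 'X%:P; 0; 0; 'X; 0; 1].
have [||h [h1 h2]] := @param_continuous _ _ (fun t => ev2 t.1 t.2) cst2_poly (fun t => phi2 t.1 t.2) v
  (fun t => ev2 t.1 t.2 u2 != 0) _ _ C (a, b) cC uab nC; last by exists h; split=> // c d; apply: (h1 (c, d)).
  by move=> c [x y]; apply: etrans (ev2C x y c%:P) (hornerC _ _).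
move=> [x y]; rewrite u2P => /pair2_endo hF; exists (mk_lift hF) => [|i]; first exact: moduli_of_class.
rewrite (@coords_cub _ 0 x 0 1 1 0 y 0); last by move=> X Y; rewrite fv_pair2 /=; congr vec; rewrite /cub; ring.
apply: (@nth_ev _ _ (fun t => ev2 t.1 t.2) (x, y) v); rewrite -[LHS]/[:: ev2 x y 1; ev2 x y 0; ev2 x y 'X%:P; ev2 x y 0; ev2 x y 0; ev2 x y 'X; ev2 x y 0; ev2 x y 1].
by rewrite (rmorph0 (ev2 x y)) (rmorph1 (ev2 x y)) ev2X (ev2C _ _ 'X) hornerX.
Qed.

Lemma curve_continuous (F : algC -> form2 * form2) (v : seq {poly algC}) (u : {poly algC}) :
  (forall a, u.[a] != 0 -> exists h : is_endo 3 (F a), forall i, coords (mk_lift h) 0 i = (nth 0 v i).[a]) ->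
  forall C a, closed C -> u.[a] != 0 -> ~ C (moduli_of (F a)) ->
  exists h : {poly algC}, (forall a, u.[a] != 0 -> C (moduli_of (F a)) -> h.[a] = 0) /\ h.[a] != 0.
Proof.
move=> H C a cC ua nC; apply: (@param_continuous _ _ (fun a => horner_eval a) polyC (fun a => moduli_of (F a)) v
  (fun a => u.[a] != 0) _ _ C a cC ua nC).
  by move=> c x; rewrite /= /horner_eval hornerC.
by move=> x /H[h hE]; exists (mk_lift h); first exact: moduli_of_class.
Qed.

Lemma phiK1_continuous C a : closed C -> uK.[a] != 0 -> ~ C (phiK1 a) ->
  exists h : {poly algC}, (forall a, uK.[a] != 0 -> C (phiK1 a) -> h.[a] = 0) /\ h.[a] != 0.
Proof.
apply: (@curve_continuous _ [:: 1; 0; 'X; 0; 0; 'X; 0; 1]) => x; rewrite uKP expr2 => /pair2_endo hF; exists hF => i.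
rewrite (@coords_cub _ 0 x 0 1 1 0 x 0); last by move=> X Y; rewrite fv_pair2 /=; congr vec; rewrite /cub; ring.
by apply: (@nth_ev _ _ (fun a => horner_eval a)); rewrite /= /horner_eval !hornerE.
Qed.

Lemma phiK2_continuous C a : closed C -> uK.[a] != 0 -> ~ C (phiK2 a) ->
  exists h : {poly algC}, (forall a, uK.[a] != 0 -> C (phiK2 a) -> h.[a] = 0) /\ h.[a] != 0.
Proof.
apply: (@curve_continuous _ [:: - 1; 0; 'X; 0; 0; - 'X; 0; 1]) => x; rewrite uKP => /pairK2_endo hF; exists hF => i.
rewrite (@coords_cub _ 0 x 0 (-1) 1 0 (- x) 0); last by move=> X Y; rewrite fv_pairK2; congr vec; rewrite /cub; ring.
by apply: (@nth_ev _ _ (fun a => horner_eval a)); rewrite /= /horner_eval !hornerE.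
Qed.

Lemma phi3_continuous C a : closed C -> ('X : {poly algC}).[a] != 0 -> ~ C (phi3 a) ->
  exists h : {poly algC}, (forall a, ('X : {poly algC}).[a] != 0 -> C (phi3 a) -> h.[a] = 0) /\ h.[a] != 0.
Proof.
apply: (@curve_continuous _ [:: 'X; 0; 0; 1; 0; 0; 'X; 0]) => x; rewrite hornerX => /pair3_endo hF; exists hF => i.
rewrite (@coords_cub _ 1 0 0 x 0 x 0 0); last by move=> X Y; rewrite fv_pair3; congr vec; rewrite /cub; ring.
by apply: (@nth_ev _ _ (fun a => horner_eval a)); rewrite /= /horner_eval !hornerE.
Qed.

Lemma primitive3 : exists ze : algC, ze ^+ 3 = 1 /\ ze != 1.
Proof.
have [ze h] := @C_prim_root_exists 3 isT; exists ze; split; first exact: prim_expr_order h.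
by apply: contraTneq h => ->; apply/negP => /prim_order_dvd/(_ 1%N); rewrite expr1 eqxx.
Qed.

Lemma locus4_singleton : locus4 = [set moduli_of (pair2 (0, 0))].
Proof.
have h : is_endo 3 (pair2 (0, 0)) by apply: pair2_endo; rewrite mul0r eq_sym oner_neq0.
by apply/seteqP; split=> m /=; move/(moduli_ofP m h).
Qed.

Lemma irreducible_closedS1 : irreducible_closed locusS1.
Proof. by rewrite locusS1E; apply: surf_irreducible u2_neq0 phi1_continuous phi1_closed. Qed.
Lemma irreducible_closedS2 : irreducible_closed locusS2.
Proof. by rewrite locusS2E; apply: surf_irreducible u2_neq0 phi2_continuous phi2_closed. Qed.
Lemma irreducible_closedK1 : irreducible_closed locusK1.
Proof. by rewrite locusK1E; apply: curve_irreducible uK_neq0 phiK1_continuous phiK1_closed. Qed.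
Lemma irreducible_closedK2 : irreducible_closed locusK2.
Proof. by rewrite locusK2E; apply: curve_irreducible uK_neq0 phiK2_continuous phiK2_closed. Qed.
Lemma irreducible_closed3 : irreducible_closed locus3.
Proof.
have [ze [h1 h2]] := primitive3; rewrite locus3E.
by apply: curve_irreducible (negbT (polyX_eq0 _)) phi3_continuous (fun S => @phi3_closed S ze h1 h2).
Qed.

(** The point inherits closedness from the two curves that meet there, so no equations for it are
    required. *)
Lemma closed4 : closed [set moduli_of (pair2 (0, 0))].
Proof.
rewrite -locus4_singleton -locusK12; apply: closedI.
  by have [] := irreducible_closedK1.
by have [] := irreducible_closedK2.
Qed.

Lemma locus4_proper (K : set (Moduli 3)) : locus4 `<=` K -> (exists2 m, K m & ~ locus4 m) ->
  [set moduli_of (pair2 (0, 0))] `<` K.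
Proof. by rewrite -locus4_singleton => h [m Km nm]; split=> // /(_ m Km). Qed.

Lemma irreducible_curveK1 : irreducible_curve locusK1.
Proof.
split; first exact: irreducible_closedK1.
split; first exact: has_chain1 closed4 irreducible_closedK1 (locus4_proper locus4_K1 locusK1_not4).
by rewrite locusK1E; apply: curve_no_chain phiK1_continuous phiK1_closed.
Qed.

Lemma irreducible_curveK2 : irreducible_curve locusK2.
Proof.
split; first exact: irreducible_closedK2.
split; first exact: has_chain1 closed4 irreducible_closedK2 (locus4_proper locus4_K2 locusK2_not4).
by rewrite locusK2E; apply: curve_no_chain phiK2_continuous phiK2_closed.
Qed.

Lemma locusK1_S1 : locusK1 `<` locusS1.
Proof.
rewrite -locusS12; split=> [m []//|h].
have e : is_endo 3 (pair1 (1, 0)) by apply: pair1_endo; rewrite mulr0 eq_sym oner_neq0.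
have c : class_of_pair (pair1 (1, 0)) (moduli_class (mk_lift e)) by exists (mk_lift e).
have [|_] := h (moduli_class (mk_lift e)); last exact: pair1_10_notin c.
by exists (1, 0) => //=; rewrite mulr0 eq_sym oner_neq0.
Qed.

Lemma locusK1_neqK2 : locusK1 <> locusK2.
Proof.
move=> e; have [m Km] := locusK1_not4; apply; rewrite -locusK12; split=> //.
by rewrite -e.
Qed.

Lemma locusK1_S2 : locusK1 `<` locusS2.
Proof.
split=> [m|h]; first by rewrite -locusS12 => -[].
have [m Km] := locusK2_not4; apply; rewrite -locusK12; split=> //.
by apply: h; apply: locusK2_S2.
Qed.

Lemma irreducible_surfaceS1 : irreducible_surface locusS1.
Proof.
split; first exact: irreducible_closedS1.
split; last by rewrite locusS1E; apply: surf_no_chain phi1_continuous phi1_closed.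
apply: has_chain2 closed4 irreducible_closedK1 irreducible_closedS1 _ locusK1_S1.
exact: locus4_proper locus4_K1 locusK1_not4.
Qed.

Lemma irreducible_surfaceS2 : irreducible_surface locusS2.
Proof.
split; first exact: irreducible_closedS2.
split; last by rewrite locusS2E; apply: surf_no_chain phi2_continuous phi2_closed.
apply: has_chain2 closed4 irreducible_closedK1 irreducible_closedS2 _ locusK1_S2.
exact: locus4_proper locus4_K1 locusK1_not4.
Qed.

Lemma locusS1_neqS2 : locusS1 <> locusS2.
Proof.
move=> e; have [_ ] := locusK1_S1; apply; rewrite -locusS12 -e; by move=> m h; split.
Qed.

(** The fixed points of (z^3 - 3) / (-3 z^2) are infinity and the roots of 4 z^3 = 3, of which this
    is one. They are the vertices of the tetrahedron. *)
Definition tetra_x : algC := 3.-root (3 / 4).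
(** The Moebius involution exchanging infinity with [tetra_x] and the other two vertices with each
    other. *)
Definition tetra_mat : 'M[algC]_2 := mat tetra_x (2 * tetra_x ^+ 2) 1 (- tetra_x).

Lemma tetra_x3 : 4 * tetra_x ^+ 3 = 3.
Proof. by rewrite rootCK // mulrC divfK // pnatr_eq0. Qed.

Lemma tetra_x0 : tetra_x != 0.
Proof.
apply: contra_eqN tetra_x3 => /eqP ->.
by rewrite expr0n mulr0 eq_sym pnatr_eq0.
Qed.

Lemma tetra_involution : involution (-1) (pair3 (-3)) tetra_mat.
Proof.
have x3 := tetra_x3; have x0 := tetra_x0.
exists (3 * tetra_x ^+ 2); split.
- by rewrite mulf_neq0 ?expf_neq0 // pnatr_eq0.
- by rewrite mat_mul mat_scalar; congr mat; ring.
- by move=> c; rewrite mat_scalar => /mat_inj[_ _ /eqP]; rewrite oner_eq0.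
move=> v; rewrite [v]vecP mat_vec !fv_pair3 mat_vec scale_vec.
move: (v 0 0) (v 1 0) => X Y; congr vec.
  by apply: (lincomb1 (k := X ^+ 3 - 3 * tetra_x * X ^+ 2 * Y + 3 * tetra_x ^+ 2 * X * Y ^+ 2 + 2 * tetra_x ^+ 3 * Y ^+ 3) x3); ring.
by apply: (lincomb1 (k := 3 * tetra_x ^+ 2 * Y ^+ 3) x3); ring.
Qed.

(** * Realization of groups of automorphisms *)

Lemma PGL2_eq1P (A : GL2) : \pi_PGL2 A = 1%g <-> exists c, (A : 'M_2) = c%:M.
Proof.
split=> [/esym/PGL2_eqP[c _ ->]|[c e]]; first by exists c; rewrite scalemx1.
apply/esym/PGL2_eqP; exists c; last by rewrite scalemx1.
by apply: contraTneq (GL2_unit A) => z; rewrite e z raddf0 unitr0.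
Qed.

Lemma PGL2_piM (A B : GL2) : (\pi_PGL2 A * \pi_PGL2 B)%g = \pi_PGL2 (GL2_mul A B).
Proof. exact: PGL2_mulE. Qed.

Lemma PGL2_pi_exp (A : GL2) n : exists2 B : GL2, (\pi_PGL2 A ^+ n)%g = \pi_PGL2 B &
  (B : 'M_2) = (A : 'M_2) ^+ n.
Proof.
elim: n => [|n [B eB BA]]; first by exists GL2_one.
by exists (GL2_mul A B); rewrite ?expgS ?eB ?PGL2_piM // exprS /= BA.
Qed.

Lemma PGL2_exp_eq1 (A : GL2) n : (\pi_PGL2 A ^+ n)%g = 1%g <-> exists c, (A : 'M_2) ^+ n = c%:M.
Proof. by have [B -> <-] := PGL2_pi_exp A n; apply: PGL2_eq1P. Qed.

Section AutLocus.
Variable d : nat.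

Lemma autlocusP (gT : finGroupType) (G : {group gT}) (m : Moduli d) : autlocus d G m <->
  exists (f : endo_lift d) (phi : gT -> PGL2), [/\ m = moduli_class f,
     {in G &, {morph phi : x y / (x * y)%g}}, {in G &, injective phi}
     & forall x, x \in G -> rat_Aut (\pi_(RatMap d) f) (phi x)].
Proof.
split=> [[f -> [phi [h1 h2 h3]]]|[f [phi [-> h1 h2 h3]]]].
  by exists (repr f), phi; rewrite /moduli_class reprK.
by exists (\pi_(RatMap d) f) => //; exists phi.
Qed.

Lemma autlocusS (gT : finGroupType) (G H : {group gT}) : H \subset G -> autlocus d G `<=` autlocus d H.
Proof.
move=> /fintype.subsetP sHG m [f -> [phi [h1 h2 h3]]]; exists f => //; exists phi; split.
- by move=> x y hx hy; apply: h1; apply: sHG.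
- by move=> x y hx hy; apply: h2; apply: sHG.
- by move=> x hx; apply/h3/sHG.
Qed.

Lemma autlocus_isog (gT hT : finGroupType) (G : {group gT}) (H : {group hT}) :
  G \isog H -> autlocus d H `<=` autlocus d G.
Proof.
move=> /isogP[g /injmP ig gG] m [f -> [phi [h1 h2 h3]]]; exists f => //.
have gH x : x \in G -> g x \in H by move=> hx; rewrite -gG mem_morphim.
exists (phi \o g); split=> /= [x y hx hy|x y hx hy e|x hx].
- by rewrite morphM // h1 ?gH.
- by apply: ig => //; apply: h2 => //; apply: gH.
- by apply/h3/gH.
Qed.

Lemma autlocus_matrices (gT : finGroupType) (G : {group gT}) m : autlocus d G m ->
  exists (f : endo_lift d) (rho : gT -> GL2), [/\ m = moduli_class f,
   forall x, x \in G -> exists2 c, c != 0 & conj_via (rho x) c f f,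
   forall x y, x \in G -> y \in G -> exists2 c, c != 0 & (rho (x * y)%g : 'M_2) = c *: (rho x *m rho y)
   & forall x, x \in G -> (exists c, (rho x : 'M_2) = c%:M) -> x = 1%g].
Proof.
move=> /autlocusP[f [phi [-> h1 h2 h3]]]; exists f, (fun x => repr (phi x)).
have p1 : phi 1%g = 1%g.
  by apply: (mulgI (phi 1%g)); rewrite -h1 ?group1 // !mulg1.
split=> // [x hx|x y hx hy|x hx sx].
- by apply/rat_AutP; rewrite reprK; apply: h3.
- have e : \pi_PGL2 (GL2_mul (repr (phi x)) (repr (phi y))) = \pi_PGL2 (repr (phi (x * y)%g)).
    by rewrite -PGL2_piM !reprK h1.
  by have /PGL2_eqP := e.
- by apply: h2; rewrite ?group1 // p1 -[phi x]reprK; apply/PGL2_eq1P.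
Qed.

Lemma autlocus_cyclic n (f : endo_lift d) (A : 'M[algC]_2) c : A \in unitmx ->
  conj_via A c f f -> (exists k, A ^+ n.+2 = k%:M) ->
  (forall i, (0 < i < n.+2)%N -> forall k, A ^+ i <> k%:M) ->
  autlocus d [set: 'Z_n.+2]%G (moduli_class f).
Proof.
move=> uA fA An nA; pose a := \pi_PGL2 (MkGL2 uA).
have an : (a ^+ n.+2)%g = 1%g by apply/PGL2_exp_eq1.
have amod k : (a ^+ (k %% n.+2))%g = (a ^+ k)%g.
  by rewrite [in RHS](divn_eq k n.+2) expgnDr mulnC expgnA an expg1n mul1g.
apply/autlocusP; exists f, (fun i : 'Z_n.+2 => (a ^+ i)%g); split=> //.
- by move=> i j _ _; rewrite -expgnDr -[RHS]amod.
- have main (i j : 'Z_n.+2) : (i <= j)%N -> (a ^+ i)%g = (a ^+ j)%g -> i = j.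
    move=> ij e; apply/val_inj/eqP; rewrite eqn_leq ij leqNgt /=; apply/negP => lij.
    have : (a ^+ (j - i))%g = 1%g.
      by apply: (mulgI (a ^+ i)%g); rewrite mulg1 -expgnDr subnKC.
    move=> /PGL2_exp_eq1[k]; apply: nA; rewrite subn_gt0 lij /=.
    exact: leq_ltn_trans (leq_subr _ _) (ltn_ord j).
  move=> i j _ _ e; case/orP: (leq_total i j) => h; first exact: main.
  by apply/esym/main.
- move=> i _; elim: (nat_of_ord i) => [|k IH]; first by rewrite expg0 /rat_Aut /= rat_conj1.
  rewrite expgS /rat_Aut /= rat_conjM.
  have -> : rat_conj (\pi_(RatMap d) f) a = \pi_(RatMap d) f.
    by apply/rat_AutP; exists c => //; apply: conj_via_neq0 fA.
  exact: IH.
Qed.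

End AutLocus.

Section Realization.
Variables (d : nat) (f : endo_lift d) (pt : 'I_4 -> 'cV[algC]_2).
Hypothesis pt_indep : forall i j, i != j -> pt i 0 0 * pt j 1 0 - pt j 0 0 * pt i 1 0 != 0.

(* Contravariant on points, so that p |-> A is multiplicative. *)
Definition realizes (A : 'M[algC]_2) (p : 'S_4) :=
  [/\ A \in unitmx, exists c, conj_via A c f f & forall i, exists k, A *m pt (p i) = k *: pt i].

(** Permutations of four points induced by automorphisms of [f]. A finite group of automorphisms can
    then be found by computing in the symmetric group. *)
Definition realized : {set 'S_4} := [set p | `[< exists A, realizes A p >]].

Lemma realizesM A B p q : realizes A p -> realizes B q -> realizes (A *m B) (p * q)%g.
Proof.
move=> [uA [a fA] pA] [uB [b fB] qB]; split; first by rewrite unitmx_mul uA.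
  by exists (a * b); apply: conj_via_comp.
move=> i; have [k hk] := pA i; have [l hl] := qB (p i); exists (l * k).
by rewrite permM -mulmxA hl -scalemxAr hk scalerA.
Qed.

Lemma realized_group : group_set realized.
Proof.
apply/group_setP; split.
  rewrite !inE; exists 1%:M; split; first exact: unitmx1.
    by exists 1; apply: conj_via1.
  by move=> i; exists 1; rewrite perm1 mul1mx scale1r.
move=> p q; rewrite !inE => -[A hA] [B hB].
by exists (A *m B); apply: realizesM.
Qed.
Canonical realized_Group := Group realized_group.

Lemma eigen_trace (M : 'M[algC]_2) (i j : 'I_4) a b : i != j -> M *m pt i = a *: pt i ->
  M *m pt j = b *: pt j -> a + b = M 0 0 + M 1 1.
Proof.
move=> /pt_indep + + +; rewrite {1 2}[M]matP [pt i]vecP [pt j]vecP !vec0 !vec1 !mat_vec !scale_vec.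
move: (M 0 0) (M 0 1) (M 1 0) (M 1 1) => m1 m2 m3 m4.
move: (pt i 0 0) (pt i 1 0) (pt j 0 0) (pt j 1 0) => x1 x2 y1 y2 n /vec2_inj[a1 a2] /vec2_inj[b1 b2].
apply: (mulIf n).
have e1 : x1 * (m3 * y1 + m4 * y2) - y1 * (m3 * x1 + m4 * x2) = x1 * (b * y2) - y1 * (a * x2).
  by rewrite a2 b2.
have e2 : y2 * (m1 * x1 + m2 * x2) - x2 * (m1 * y1 + m2 * y2) = y2 * (a * x1) - x2 * (b * y1).
  by rewrite a1 b1.
by apply: (lincomb2 (k := -1) (k' := -1) e1 e2); ring.
Qed.

(** By [eigen_trace] any two of the three eigenvalues add up to the trace, so all three are
    equal. *)
Lemma three_lines (M : 'M[algC]_2) (i j l : 'I_4) : i != j -> i != l -> j != l ->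
  (forall i, exists k, M *m pt i = k *: pt i) -> exists k, M = k%:M.
Proof.
move=> ij il jl h.
have [a ha] := h i; have [b hb] := h j; have [c hc] := h l.
have /eqP := eigen_trace jl hb hc; rewrite -(eigen_trace ij ha hb) addrC (inj_eq (addIr _)) => /eqP ca.
have /eqP := eigen_trace jl hb hc; rewrite -(eigen_trace il ha hc) (inj_eq (addIr _)) => /eqP ba.
exists a; rewrite {}ba in hb; have n := pt_indep ij; move: ha hb n.
rewrite [M]matP [pt i]vecP [pt j]vecP !vec0 !vec1 !mat_vec !scale_vec mat_scalar.
move: (M 0 0) (M 0 1) (M 1 0) (M 1 1) => m1 m2 m3 m4.
move: (pt i 0 0) (pt i 1 0) (pt j 0 0) (pt j 1 0) => x1 x2 y1 y2 /vec2_inj[a1 a2] /vec2_inj[b1 b2] n.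
congr mat; apply: (mulIf n).
- by apply: (lincomb2 (k := y2) (k' := - x2) a1 b1); ring.
- by apply: (lincomb2 (k := - y1) (k' := x1) a1 b1); ring.
- by apply: (lincomb2 (k := y2) (k' := - x2) a2 b2); ring.
- by apply: (lincomb2 (k := - y1) (k' := x1) a2 b2); ring.
Qed.

Lemma realizes_scale A p i : realizes A p -> exists2 k, k != 0 & A *m pt (p i) = k *: pt i.
Proof.
move=> [uA _ /(_ i)[k hk]]; exists k => //; apply: contra_eqN hk => /eqP ->.
rewrite scale0r unitmx_neq0 //.
(* Independence from any other point shows that [pt (p i)] is not zero; the next index provides
   one. *)
have /pt_indep : p i != p (i + 1) by rewrite (inj_eq perm_inj) -subr_eq0 opprD addrA subrr sub0r oppr_eq0.
by apply: contra => /eqP ->; rewrite !mxE !(mul0r, mulr0) subrr.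
Qed.

Lemma realizes_uniq A B p : realizes A p -> realizes B p -> exists2 k, k != 0 & B = k *: A.
Proof.
move=> hA hB; have [uA _ _] := hA; have [uB _ _] := hB.
have [||||k hk] := @three_lines (B *m invmx A) 0 1 2; try by [].
  move=> i; have [a a0 ea] := realizes_scale i hA; have [b b0 eb] := realizes_scale i hB.
  exists (b / a); apply: (scalerI a0); rewrite scalemxAr -ea -mulmxA (mulmxA (invmx A)) mulVmx // mul1mx eb.
  by rewrite scalerA mulrC divfK.
have e : B = k *: A by rewrite -mul_scalar_mx -hk -mulmxA mulVmx ?mulmx1.
by exists k => //; apply: contraTneq uB => z; rewrite e z scale0r unitr0.
Qed.

Lemma realizes_inj A p q : realizes A p -> realizes A q -> p = q.
Proof.
move=> hA hB; apply/permP => i; apply/eqP; apply/negPn/negP => /pt_indep; have [uA _ _] := hA.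
have [a a0 ea] := realizes_scale i hA; have [b b0 eb] := realizes_scale i hB.
have e : a^-1 *: pt (p i) = b^-1 *: pt (q i).
  apply: (can_inj (mulKmx uA)); rewrite -!scalemxAr ea eb !scalerA !mulVf //.
move: e; rewrite [pt (p i)]vecP [pt (q i)]vecP !scale_vec !vec0 !vec1 => /vec2_inj[e1 e2] /eqP; apply.
apply: (mulfI (invr_neq0 a0)); apply: (mulfI (invr_neq0 b0)).
have e3 : (a^-1 * pt (p i) 0 0) * (b^-1 * pt (q i) 1 0) = (b^-1 * pt (q i) 0 0) * (a^-1 * pt (p i) 1 0).
  by rewrite e1 e2.
by apply: (lincomb1 (k := 1) e3); ring.
Qed.

(** A permutation determines its matrix up to a scalar, so an arbitrary choice of matrices is
    multiplicative in PGL_2. The matrix determines the permutation, since the points are distinct on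
    the projective line, so the choice is injective. *)
Lemma realized_autlocus (G : {group 'S_4}) : G \subset realized -> autlocus d G (moduli_class f).
Proof.
move=> /fintype.subsetP sG.
have [phi hphi] : {phi : 'S_4 -> PGL2 & forall p, p \in G -> exists A : GL2, phi p = \pi_PGL2 A /\ realizes A p}.
  apply: (@choice _ _ (fun p x => p \in G -> exists A : GL2, x = \pi_PGL2 A /\ realizes A p)) => p.
  have [pG|] := boolP (p \in G); last by exists 1%g.
  have := sG p pG; rewrite !inE => -[A hA]; have [uA _ _] := hA.
  by exists (\pi_PGL2 (MkGL2 uA)) => _; exists (MkGL2 uA).
apply/autlocusP; exists f, phi; split=> // [p q pG qG|p q pG qG e|p pG].
- have [A [-> hA]] := hphi _ pG; have [B [-> hB]] := hphi _ qG; have [C [-> hC]] := hphi _ (groupM pG qG).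
  rewrite PGL2_piM; apply/PGL2_eqP; exact: realizes_uniq hC (realizesM hA hB).
- have [A [eA hA]] := hphi _ pG; have [B [eB hB]] := hphi _ qG.
  have /PGL2_eqP[k k0 BA] : \pi_PGL2 A = \pi_PGL2 B by rewrite -eA -eB.
  apply: (realizes_inj hA); split; first by rewrite GL2_unit.
    by have [_ [c hc] _] := hA; exists c.
  move=> i; have [_ _ /(_ i)[l hl]] := hB; exists (k^-1 * l).
  by rewrite -scalerA -hl BA -scalemxAl scalerA mulVf // scale1r.
- have [A [-> [uA [c hc] _]]] := hphi _ pG; apply/rat_AutP; exists c => //.
  exact: conj_via_neq0 hc.
Qed.

End Realization.

(** The dihedral presentation makes the group a quotient of a dihedral group of order 2q. Its order
    is a multiple of q dividing 2q, and order q is excluded because [x] lies outside the cyclic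
    subgroup. *)
Lemma dihedral_isog (gT : finGroupType) (x y : gT) q : (1 < q)%N -> (x ^+ 2 = 1)%g -> (y ^+ 2 = 1)%g ->
  #[(x * y)%g]%g = q -> x \notin <[(x * y)%g]>%g -> <<[set x; y]%SET>>%G \isog ('D_(q.*2))%G.
Proof.
move=> q1 x2 y2 oxy nx; set G := <<_>>%G.
have homG : (G \homg 'D_(q.*2))%g.
  rewrite Grp'_dihedral //; apply/existsP; exists (x, y); rewrite /= !xpair_eqE.
  by rewrite joing_idl joing_idr x2 y2 -oxy expg_order !eqxx.
rewrite isogEcard homG card_dihedral //= dvdn_leq ?cardG_gt0 //.
have sG : <[(x * y)%g]>%g \subset G by rewrite cycle_subG groupM ?mem_gen ?set21 ?set22.
have [k oG] : exists k, #|G| = (k * q)%N by apply/dvdnP; rewrite -oxy cardSg.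
have : (#|G| %| q.*2)%N by rewrite -(card_dihedral q1) card_homg.
rewrite oG -mul2n dvdn_pmul2r ?(ltnW q1) // dvdn_divisors // !inE /=.
case/pred2P => [k1|->]; last by [].
case/negP: nx; suff -> : <[(x * y)%g]>%g = G by rewrite mem_gen ?set21.
by apply/eqP; rewrite eqEcard sG oG k1 mul1n -oxy /=.
Qed.

Lemma ord4 (P : 'I_4 -> Prop) : P 0 -> P 1 -> P 2 -> P 3 -> forall i, P i.
Proof.
by move=> h0 h1 h2 h3 [[|[|[|[|//]]]] h]; [move: h0|move: h1|move: h2|move: h3]; congr P; apply: val_inj.
Qed.

Definition points (x y : seq algC) (i : 'I_4) : 'cV[algC]_2 := vec x`_i y`_i.

Lemma points_indep x y : (forall i j : 'I_4, (i < j)%N -> x`_i * y`_j - x`_j * y`_i != 0) ->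
  forall i j, i != j -> points x y i 0 0 * points x y j 1 0 - points x y j 0 0 * points x y i 1 0 != 0.
Proof.
move=> h i j; rewrite /points !vec0 !vec1 -val_eqE neq_ltn => /orP[/h //|/h].
by rewrite -oppr_eq0 opprB.
Qed.


Section Klein.
Variable f : endo_lift 3.
Hypothesis fD : exists c, conj_via dmat c f f.
Hypothesis fJ : exists c, conj_via jmat c f f.

(** The points infinity, 0, 1, -1: each of z |-> -z and z |-> 1/z fixes two of them and exchanges
    the other two. *)
Let pt := points [:: 1; 0; 1; -1] [:: 0; 1; 1; 1].

Let pt_indep i j : i != j -> pt i 0 0 * pt j 1 0 - pt j 0 0 * pt i 1 0 != 0.
Proof.
apply: points_indep => {i j}; apply: ord4 => //; apply: ord4 => //= _;
  rewrite !(mul0r, mulr0, mul1r, mulr1, subr0, sub0r, opprK, oppr_eq0, oner_eq0) //.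
by rewrite -mulr2n pnatr_eq0.
Qed.

Lemma dihedral4_autlocus : autlocus 3 ('D_(4%N))%G (moduli_class f).
Proof.
pose x : 'S_4 := tperm 0 1; pose y : 'S_4 := tperm 2 3.
have x2 : (x ^+ 2 = 1)%g by rewrite expgS expg1 tperm2.
have y2 : (y ^+ 2 = 1)%g by rewrite expgS expg1 tperm2.
have xy : (x * y = y * x)%g by apply/permP; apply: ord4; rewrite !permM !permE.
have oxy : #[(x * y)%g]%g = 2.
  apply: nt_prime_order => //; first by rewrite expgMn // x2 y2 mulg1.
  by apply/eqP => /permP/(_ 0); rewrite permM !permE.
have nx : x \notin <[(x * y)%g]>%g.
  rewrite cycle2g //; apply/negP; rewrite !inE => /orP[]/eqP/permP.
    by move=> /(_ 0); rewrite !permE.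
  by move=> /(_ 2); rewrite permM !permE.
have := @dihedral_isog _ _ _ 2 isT x2 y2 oxy nx; rewrite isog_sym => iso.
apply: (autlocus_isog iso); apply: (realized_autlocus pt_indep).
rewrite gen_subG; apply/fintype.subsetP => p; rewrite !inE => /orP[]/eqP ->.
  exists jmat; split=> //; first by rewrite mat_unit !mul0r mul1r sub0r oppr_eq0 oner_eq0.
  by apply: ord4; rewrite permE /=; [exists 1|exists 1|exists 1|exists (-1)];
   rewrite mat_vec scale_vec /=; congr vec; ring.
exists dmat; split=> //; first by rewrite mat_unit !mul0r mulr1 subr0 oppr_eq0 oner_eq0.
by apply: ord4; rewrite permE /=; [exists (-1)|exists 1|exists 1|exists 1];
   rewrite mat_vec scale_vec /=; congr vec; ring.
Qed.

End Klein.

Section Octagon.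
Variable f : endo_lift 3.
Hypothesis fE : lift_val f = pair2 (0, 0).

(** The fourth roots of unity, permuted as the vertices of a square by z |-> 1/z, a reflection in a
    diagonal, and by z |-> 'i / z, a reflection in a bisector of two sides. *)
Let pt := points [:: 1; 'i; -1; - 'i] [:: 1; 1; 1; 1].

Let pt_indep i j : i != j -> pt i 0 0 * pt j 1 0 - pt j 0 0 * pt i 1 0 != 0.
Proof.
apply: points_indep => {i j}; apply: ord4 => //; apply: ord4 => //= _;
  apply/eqP => e; have /eqP : 2 != 0 :> algC by rewrite pnatr_eq0.
all: have i2 := sqrCi algC; apply.
- by apply: (lincomb2 (k := 1 + 'i) (k' := 1) e i2); ring.
- by apply: (lincomb1 (k := 1) e); ring.
- by apply: (lincomb2 (k := 1 - 'i) (k' := 1) e i2); ring.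
- by apply: (lincomb2 (k := 1 - 'i) (k' := 1) e i2); ring.
- by apply: (lincomb2 (k := - 'i) (k' := 2) e i2); ring.
- by apply: (lincomb2 (k := - (1 + 'i)) (k' := 1) e i2); ring.
Qed.

Lemma dihedral8_autlocus : autlocus 3 ('D_(8%N))%G (moduli_class f).
Proof.
pose x : 'S_4 := tperm 1 3; pose y : 'S_4 := (tperm 0%R 1%R * tperm 2%R 3%R)%g.
have x2 : (x ^+ 2 = 1)%g by rewrite expgS expg1 tperm2.
have y2 : (y ^+ 2 = 1)%g by apply/permP; apply: ord4; rewrite expgS expg1 !permM !permE.
have c0 : (x * y)%g 0 = 1 by rewrite !permM !permE.
have c1 : (x * y)%g 1 = 2 by rewrite !permM !permE.
have c2 : (x * y)%g 2 = 3 by rewrite !permM !permE.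
have c3 : (x * y)%g 3 = 0 by rewrite !permM !permE.
have oxy : #[(x * y)%g]%g = 4.
  have h4 : #[(x * y)%g]%g \in divisors 4.
    rewrite -dvdn_divisors // order_dvdn; move: (x * y)%g c0 c1 c2 c3 => c c0 c1 c2 c3.
    by apply/eqP/permP; apply: ord4; rewrite !expgS expg0 mulg1 !permM !(c0, c1, c2, c3) perm1.
  have h2 : ~~ (#[(x * y)%g]%g %| 2)%N.
    by rewrite order_dvdn; apply/eqP => /permP/(_ 0); rewrite expgS expg1 permM c0 c1 perm1.
  by move: h4 h2; rewrite !inE => /or3P[]/eqP ->.
have nx : x \notin <[(x * y)%g]>%g.
  apply/negP => /cycleP[k e]; have : commute x (x * y)%g.
    by rewrite {1}e; apply/commute_sym/commuteX/commute_refl.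
  have x0 : x 0 = 0 by rewrite permE.
  have x1 : x 1 = 3 by rewrite permE.
  by move=> /permP/(_ 0); rewrite [LHS]permM [RHS]permM x0 c0 x1.
have := @dihedral_isog _ _ _ 4 isT x2 y2 oxy nx; rewrite isog_sym => iso.
apply: (autlocus_isog iso); apply: (realized_autlocus pt_indep).
rewrite gen_subG; apply/fintype.subsetP => p; rewrite !inE => /orP[]/eqP ->.
  exists jmat; split=> //; first by rewrite mat_unit !mul0r mul1r sub0r oppr_eq0 oner_eq0.
    exists 1 => v; rewrite [v]vecP mat_vec fE !fv_pair2 mat_vec scale_vec; congr vec; ring.
  have i2 := sqrCi algC.
  apply: ord4; rewrite permE /=; [exists 1|exists (- 'i)|exists (-1)|exists 'i];
   rewrite mat_vec scale_vec /=; congr vec; try ring.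
  - by apply: (lincomb1 (k := 1) i2); ring.
  - by apply: (lincomb1 (k := 1) i2); ring.
exists (mat 0 'i 1 0); split=> //; first by rewrite mat_unit !mul0r mulr1 sub0r oppr_eq0 neq0Ci.
  exists (-'i) => v; rewrite [v]vecP mat_vec fE !fv_pair2 mat_vec scale_vec.
  have i2 := sqrCi algC; congr vec.
  - by apply: (lincomb1 (k := v 0 0 ^+ 3) i2); ring.
  - by apply: (lincomb1 (k := 'i * v 1 0 ^+ 3) i2); ring.
have i2 := sqrCi algC.
by apply: ord4; rewrite permM !permE /=; [exists 'i|exists 1|exists (-'i)|exists (-1)];
   rewrite mat_vec scale_vec /=; congr vec; try ring.
Qed.

End Octagon.

Section Tetrahedron.
Variable f : endo_lift 3.
Hypothesis fE : lift_val f = pair3 (-3).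
Variable ze : algC.
Hypothesis ze3 : ze ^+ 3 = 1.
Hypothesis ze1 : ze != 1.

Let ze2 : ze ^+ 2 = - ze - 1.
Proof.
have n : ze - 1 != 0 by rewrite subr_eq0.
by apply: (mulfI n); apply: (lincomb1 (k := 1) ze3); ring.
Qed.

Let ze0 : ze != 0.
Proof. by apply: contra_eqN ze3 => /eqP ->; rewrite expr0n eq_sym oner_neq0. Qed.

Let x := tetra_x.
(** The four fixed points of [f]. *)
Let pt := points [:: 1; x; x * ze; x * ze ^+ 2] [:: 0; 1; 1; 1].

Let pt_indep i j : i != j -> pt i 0 0 * pt j 1 0 - pt j 0 0 * pt i 1 0 != 0.
Proof.
have n : x * (ze - 1) != 0 by rewrite mulf_neq0 ?tetra_x0 // subr_eq0.
have three : x * 3 != 0 by rewrite mulf_neq0 ?tetra_x0 ?pnatr_eq0.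
apply: points_indep => {i j}; apply: ord4 => //; apply: ord4 => //= _;
  rewrite !(mul0r, mulr0, mul1r, mulr1, subr0, sub0r, opprK, oppr_eq0, oner_eq0) //.
- by apply: contra n => /eqP e; apply/eqP; apply: (lincomb1 (k := -1) e); ring.
- by apply: contra three => /eqP e; apply/eqP; apply: (lincomb2 (k := 1 - ze) (k' := x * (2 - ze)) e ze2); ring.
- by apply: contra n => /eqP e; apply/eqP; apply: (lincomb2 (k := - ze ^+ 2) (k' := x * (1 - ze)) e ze3); ring.
Qed.

Lemma tetrahedral_autlocus : autlocus 3 (Alt_group 'I_4) (moduli_class f).
Proof.
apply: (realized_autlocus pt_indep).
pose p : 'S_4 := (tperm 1%R 2%R * tperm 1%R 3%R)%g; pose t : 'S_4 := (tperm 0%R 1%R * tperm 2%R 3%R)%g.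
have p0 : p 0 = 0 by rewrite !permM !permE.
have p1 : p 1 = 2 by rewrite !permM !permE.
have p2 : p 2 = 3 by rewrite !permM !permE.
have p3 : p 3 = 1 by rewrite !permM !permE.
have t0 : t 0 = 1 by rewrite !permM !permE.
have t1 : t 1 = 0 by rewrite !permM !permE.
have t2 : t 2 = 3 by rewrite !permM !permE.
have t3 : t 3 = 2 by rewrite !permM !permE.
have rp : p \in realized f pt.
  rewrite !inE; exists (mat 1 0 0 ze); split; first by rewrite mat_unit mulr0 mul1r subr0.
    exists 1 => v; rewrite [v]vecP mat_vec fE !fv_pair3 mat_vec scale_vec; congr vec; last by ring.
    by apply: (lincomb1 (k := -3 * v 1 0 ^+ 3) ze3); ring.
  apply: ord4; rewrite ?p0 ?p1 ?p2 ?p3; [exists 1|exists ze|exists ze|exists ze];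
    rewrite mat_vec scale_vec /=; congr vec; try ring.
  by apply: (lincomb1 (k := - x) ze3); ring.
have rt : t \in realized f pt.
  have [s [s0 ss _ h]] := tetra_involution.
  rewrite !inE; exists tetra_mat; split; first exact: square_unit s0 ss.
    by exists (-1 * s); rewrite fE.
  apply: ord4; rewrite ?t0 ?t1 ?t2 ?t3; [exists (3 * x ^+ 2)|exists 1|exists (x * (ze ^+ 2 - 1))|exists (x * (ze - 1))];
    rewrite mat_vec scale_vec /= -/x; congr vec; try ring.
    by apply: (lincomb2 (k := x ^+ 2) (k' := - x ^+ 2) ze2 ze3); ring.
  by apply: (lincomb2 (k := x ^+ 2) (k' := - x ^+ 2) ze2 ze3); ring.
(* Intersecting with the alternating group avoids deciding whether odd permutations are realized. A
   3-cycle and a four-group make 12 divide the order of [K], which then is the whole alternating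
   group. *)
pose K := ('Alt_'I_4 :&: realized_Group f pt)%G.
have Kp : p \in K by rewrite finset.in_setI rp andbT; apply: etrans (Alt_even p) _; rewrite odd_permM !odd_tperm.
have Kt : t \in K by rewrite finset.in_setI rt andbT; apply: etrans (Alt_even t) _; rewrite odd_permM !odd_tperm.
pose s := (t ^ p)%g; have Ks : s \in K by rewrite groupJ.
have s0 : s 0 = 2 by rewrite -p0 /s permJ t0 p1.
have s2 : s 2 = 0 by rewrite -p1 /s permJ t1 p0.
have s3 : s 3 = 1 by rewrite -p2 /s permJ t2 p3.
have s1 : s 1 = 3 by rewrite /s -{1}p3 permJ t3 p2.
have tt : (t ^+ 2 = 1)%g by apply/permP; apply: ord4; rewrite expgS expg1 permM ?t0 ?t1 ?t2 ?t3 perm1.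
have ss : (s ^+ 2 = 1)%g by apply/permP; apply: ord4; rewrite expgS expg1 permM !(s0, s1, s2, s3) perm1.
have c0 : (t * s)%g 0 = 3 by rewrite permM t0 s1.
have c1 : (t * s)%g 1 = 2 by rewrite permM t1 s0.
have c2 : (t * s)%g 2 = 1 by rewrite permM t2 s3.
have c3 : (t * s)%g 3 = 0 by rewrite permM t3 s2.
have ots : #[(t * s)%g]%g = 2.
  apply: nt_prime_order => //; last by apply/eqP => /permP/(_ 0); rewrite c0 perm1.
  move: (t * s)%g c0 c1 c2 c3 => c c0 c1 c2 c3.
  by apply/permP; apply: ord4; rewrite expgS expg1 permM !(c0, c1, c2, c3) perm1.
have nt : t \notin <[(t * s)%g]>%g.
  rewrite cycle2g //; apply/negP; rewrite !inE => /orP[]/eqP/permP/(_ 0).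
    by rewrite t0 perm1.
  by rewrite c0 t0.
have op : #[p]%g = 3%N.
  apply: nt_prime_order => //; last by apply/eqP => /permP/(_ 1); rewrite p1 perm1.
  move: (p) p0 p1 p2 p3 => g g0 g1 g2 g3.
  by apply/permP; apply: ord4; rewrite !expgS expg0 mulg1 !permM !(g0, g1, g2, g3) perm1.
have K3 : (3 %| #|K|)%N by have := order_dvdG Kp; rewrite op.
have K4 : (4 %| #|K|)%N.
  have : (#|<<[set t; s]%SET>>%G| %| #|K|)%N.
    apply: cardSg; rewrite gen_subG; apply/fintype.subsetP => g.
    by rewrite in_set2 => /orP[]/eqP ->.
  by rewrite (card_isog (@dihedral_isog _ _ _ 2 isT tt ss ots nt)) card_dihedral.
have K12 : (12 <= #|K|)%N by rewrite dvdn_leq ?cardG_gt0 // (@Gauss_dvd 3 4) // K3.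
suff -> : ('Alt_'I_4)%G = K by apply: subsetIr.
apply/eqP; rewrite eq_sym -val_eqE eqEcard subsetIl /=.
by rewrite -(@leq_pmul2l 2) // card_Alt ?card_ord // (leq_trans _ (leq_mul (leqnn 2) K12)).
Qed.

End Tetrahedron.

(** * Identification of the loci *)

Lemma autlocus_order d (gT : finGroupType) (G : {group gT}) m (x : gT) n : autlocus d G m ->
  x \in G -> #[x]%g = n.+2 -> autlocus d [set: 'Z_n.+2]%G m.
Proof.
move=> h xG ox; have sG : <[x]>%G \subset G by rewrite cycle_subG.
have cZ : cyclic [set: 'Z_n.+2]%G by apply/cyclicP; exists Zp1; apply: Zp_cycle.
apply: (autlocus_isog _ (autlocusS sG h)).
by rewrite isog_cyclic_card // cycle_cyclic cardsT card_ord; apply/eqP.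
Qed.

Lemma autlocus_cyclicP d n m : autlocus d [set: 'Z_n.+2]%G m ->
  exists (f : endo_lift d) (A : 'M[algC]_2) c, [/\ m = moduli_class f, A \in unitmx, conj_via A c f f,
    exists k, A ^+ n.+2 = k%:M & forall i, (0 < i < n.+2)%N -> forall k, A ^+ i <> k%:M].
Proof.
move=> /autlocusP[f [phi [-> h1 h2 h3]]]; pose a : 'Z_n.+2 := Zp1.
have inT (y : 'Z_n.+2) : y \in [set: 'Z_n.+2]%G by rewrite inE.
have p1 : phi 1%g = 1%g by apply: (mulgI (phi 1%g)); rewrite -h1 ?inT // !mulg1.
have pX i : phi (a ^+ i)%g = (phi a ^+ i)%g.
  by elim: i => [|i IH]; rewrite ?expg0 // !expgS h1 ?inT // IH.
have aX i : ((repr (phi a) : 'M_2) ^+ i = (repr (phi a) : 'M_2) ^+ i) -> (phi a ^+ i)%g = 1%g <-> (n.+2 %| i)%N.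
  move=> _; rewrite -pX -[X in (X %| _)%N](order_Zp1 n.+1) order_dvdn; split=> [e|/eqP ->//].
  by apply/eqP; apply: h2; rewrite ?inT // p1.
have sX i : (exists k, (repr (phi a) : 'M_2) ^+ i = k%:M) <-> (n.+2 %| i)%N.
  by rewrite -aX // -{2}[phi a]reprK; split => /PGL2_exp_eq1.
have [c c0 hc] : exists2 c, c != 0 & conj_via (repr (phi a)) c f f.
  by apply/rat_AutP; rewrite reprK; apply/h3/inT.
exists f, (repr (phi a)), c; split=> //; first exact: GL2_unit.
  by apply/sX.
move=> i /andP[i0 lin] k e; have /dvdn_leq : (n.+2 %| i)%N by apply/sX; exists k.
by move=> /(_ i0); rewrite leqNgt lin.
Qed.

Lemma conj_via_scalar (f : endo_lift 3) s : conj_via s%:M (s ^+ 2) f f.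
Proof. by move=> v; rewrite !mul_scalar_mx endo_fvZ scalerA -exprSr. Qed.

(** Applying the automorphism twice gives the scalar c^2, while the scalar matrix [s] acts on a
    cubic with scalar s^2. Uniqueness yields c = s or c = - s, the two types. *)
Lemma order2_involution (f : endo_lift 3) A c s : A \in unitmx -> conj_via A c f f ->
  A *m A = s%:M -> (forall k, A <> k%:M) -> exists2 e, e = 1 \/ e = -1 & involution e f A.
Proof.
move=> uA fA AA nA.
have us : (s%:M : 'M[algC]_2) \in unitmx by rewrite -AA unitmx_mul uA.
have s0 : s != 0 by apply: contraTneq us => ->; rewrite raddf0 unitr0.
have := conj_via_comp fA fA; rewrite AA => h.
have /eqP := aut_unique us h (conj_via_scalar f s); rewrite -expr2 eqf_sqr => /orP[]/eqP e.
  by exists 1; [left|exists s; split=> //; rewrite mul1r -e].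
by exists (-1); [right|exists s; split=> //; rewrite mulN1r -e].
Qed.

Lemma mx_sqr (A : 'M[algC]_2) : A ^+ 2 = A *m A. Proof. by []. Qed.

Lemma autlocus_C2 : autlocus 3 [set: 'Z_2]%G = locusS1 `|` locusS2.
Proof.
apply/seteqP; split=> m.
  move=> /autlocus_cyclicP[f [A [c [-> uA fA [s AA] nA]]]].
  have [e [->|->] iA] := order2_involution uA fA AA (nA 1%N isT).
    by left; apply/locusS1P; exists A.
  by right; apply/locusS2P; exists A.
have main e (f : endo_lift 3) A : involution e f A -> autlocus 3 [set: 'Z_2]%G (moduli_class f).
  move=> [s [s0 AA nA fA]]; apply: (@autlocus_cyclic 3 0 f A (e * s)) => //; first exact: square_unit s0 AA.
    by exists s.
  by move=> [|[|//]].
by have [f ->] := moduli_class_surj m; move=> [/locusS1P[A /main]|/locusS2P[A /main]].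
Qed.

Lemma diag_pow (C : 'M[algC]_2) g k l n : C *m g = k *: (g *m mat l 0 0 1) ->
  C ^+ n *m g = k ^+ n *: (g *m mat (l ^+ n) 0 0 1).
Proof.
move=> Cg; elim: n => [|n IH]; first by rewrite !expr0 scale1r -(mat_scalar 1) mulmx1 mul1mx.
rewrite exprS -[C * _]/(C *m _) -mulmxA IH -scalemxAr mulmxA Cg -scalemxAl scalerA -exprSr -mulmxA mat_mul.
by congr (_ *: (_ *m _)); congr mat; rewrite ?exprS; ring.
Qed.

Lemma scalar_pow (C : 'M[algC]_2) g k l n s : g \in unitmx -> k != 0 -> C *m g = k *: (g *m mat l 0 0 1) ->
  C ^+ n = s%:M -> l ^+ n = 1.
Proof.
move=> ug k0 Cg Cn; have := diag_pow n Cg; rewrite Cn -scalar_mxC scalemxAr => /(can_inj (mulKmx ug)).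
rewrite mat_scalar scale_mat => /mat_inj[e1 _ _ e2].
by apply: (mulfI (expf_neq0 n k0)); rewrite -e1 e2.
Qed.

Lemma aut_diag (f : endo_lift 3) A c : A \in unitmx -> conj_via A c f f -> (forall k, A <> k%:M) ->
  exists (f' : endo_lift 3) g k l c', [/\ moduli_class f = moduli_class f', g \in unitmx, k != 0 & l != 0] /\
    [/\ l != 1, A *m g = k *: (g *m mat l 0 0 1) & conj_via (mat l 0 0 1) c' f' f'].
Proof.
move=> uA fA nA; have [[k /nA]|[g [k [l [ug k0 l0 l1 Ag]]]]|[g [k [ug k0 Ag]]]] // := mat_normal uA.
  have [f' ff'] := lift_conj_via f ug; exists f', g, k, l, (c / k ^+ 2); split; split=> //.
    by apply/moduli_classP; exists g, 1; rewrite oner_neq0.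
  exact: conj_via_aut ug k0 ff' Ag fA.
have [f' ff'] := lift_conj_via f ug.
by have /unipotent_aut := conj_via_aut ug k0 ff' Ag fA.
Qed.

Lemma autlocus_C3 : autlocus 3 [set: 'Z_3]%G = locus3.
Proof.
apply/seteqP; split=> m.
  move=> /autlocus_cyclicP[f [A [c [-> uA fA [s A3] nA]]]].
  have [f' [g [k [l [c' [[-> ug k0 l0] [l1 Ag hD]]]]]]] := aut_diag uA fA (nA 1%N isT).
  have l3 := scalar_pow ug k0 Ag A3.
  have nf3_in (h : endo_lift 3) a b p : nf3 h a b p -> locus3 (moduli_class h).
    by move=> /nf3_class[a0 b0 p0 cl]; exists (p / a) => //=; rewrite mulf_neq0 ?invr_eq0.
  have lN1 : l <> -1.
    by move=> e; move/eqP: l3; rewrite e exprS sqrrN expr1n mulr1 (negPf onen).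
  have [[[/lN1]|[/lN1]|[_ [a [b [p nf]]]]|[_ [a [b [p nf]]]]]|[l4 _ _]] // := diag_aut l0 l1 hD.
  - exact: nf3_in nf.
  (* The mirror image of [nf3], restored by exchanging the coordinates. *)
  - have uJ : jmat \in unitmx by rewrite mat_unit !mul0r mul1r sub0r oppr_eq0 oner_eq0.
    have [h fh] := lift_conj_via f' uJ.
    rewrite (_ : moduli_class f' = moduli_class h).
      apply: (@nf3_in h b a p) => x y; have e := fh (vec x y).
      apply: (can_inj (mulKmx uJ)); rewrite scale1r in e; rewrite -e !mat_vec nf; congr vec; ring.
    by apply/moduli_classP; exists jmat, 1; rewrite oner_neq0.
  - by move/eqP: l4; rewrite exprS l3 mulr1 (negPf l1).
move=> [a /= a0 [f fE ->]]; have [ze [ze3 ze1]] := primitive3.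
have ze2 : ze ^+ 2 != 1.
  by apply: contra ze1 => /eqP e; rewrite -ze3 exprS e mulr1.
have ze0 : ze != 0 by apply: contra_eqN ze3 => /eqP ->; rewrite expr0n eq_sym oner_neq0.
have Dg : mat ze 0 0 1 *m 1%:M = 1 *: (1%:M *m mat ze 0 0 1) by rewrite mulmx1 mul1mx scale1r.
apply: (@autlocus_cyclic 3 1 f (mat ze 0 0 1) (ze ^+ 2)).
- by rewrite mat_unit mulr1 mulr0 subr0.
- move=> v; rewrite [v]vecP mat_vec fE !fv_pair3 mat_vec scale_vec; congr vec; last by ring.
  by apply: (lincomb1 (k := - a * v 1 0 ^+ 3) ze3); ring.
- by exists 1; have := diag_pow 3 Dg; rewrite ze3 !mulmx1 mul1mx expr1n scale1r -mat_scalar.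
move=> i /andP[i0 i3] k /(scalar_pow (unitmx1 _ _) (oner_neq0 _) Dg) /eqP.
by case: i i0 i3 => [|[|[|//]]] //; rewrite ?expr1 ?(negPf ze1) ?(negPf ze2).
Qed.

Lemma order4_locus4 (f : endo_lift 3) A c s : A \in unitmx -> conj_via A c f f ->
  A ^+ 4 = s%:M -> (forall k, A ^+ 2 <> k%:M) -> locus4 (moduli_class f).
Proof.
move=> uA fA A4 nA2; have nA k : A <> k%:M.
  by move=> e; apply: (nA2 (k * k)); rewrite mx_sqr e -scalar_mxM.
have [f' [g [k [l [c' [[-> ug k0 l0] [l1 Ag hD]]]]]]] := aut_diag uA fA nA.
have l4 := scalar_pow ug k0 Ag A4.
have l2 : l ^+ 2 != 1.
  apply/eqP => l2; have := diag_pow 2 Ag; rewrite l2 -(mat_scalar 1) mulmx1 -mul_scalar_mx.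
  by move=> /(can_inj (mulmxK ug)); apply: nA2.
have lN1 : l <> -1 by move=> e; rewrite e sqrrN expr1n eqxx in l2.
have nl3 : l ^+ 3 <> 1 by move=> e; move/eqP: l4; rewrite exprS e mulr1 (negPf l1).
have [[[/lN1]|[/lN1]|[/nl3]|[/nl3]]|[_ _ [b [p nf]]]] // := diag_aut l0 l1 hD.
by have [_ _ _] := nf2_class nf (sqrtCK _); rewrite !mul0r.
Qed.

Lemma autlocus_C4_sub : autlocus 3 [set: 'Z_4]%G `<=` locus4.
Proof.
move=> m /autlocus_cyclicP[f [A [c [-> uA fA [s A4] nA]]]].
exact: order4_locus4 uA fA A4 (nA 2%N isT).
Qed.

Lemma autlocus_D4_C4 : autlocus 3 ('D_(8%N))%G `<=` autlocus 3 [set: 'Z_4]%G.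
Proof.
move=> m h; have [[x y] [_ xG ox _] _] := @generators_2dihedral _ ('D_(8%N))%G 3 isT (isog_refl _).
exact: autlocus_order h xG ox.
Qed.

Lemma autlocus_D4 : autlocus 3 ('D_(8%N))%G = locus4.
Proof.
apply/seteqP; split=> m; first by move=> /autlocus_D4_C4/autlocus_C4_sub.
by move=> [f fE ->]; apply: dihedral8_autlocus.
Qed.

Lemma autlocus_C4 : autlocus 3 [set: 'Z_4]%G = locus4.
Proof.
apply/seteqP; split=> m; first exact: autlocus_C4_sub.
by rewrite -autlocus_D4; apply: autlocus_D4_C4.
Qed.

Lemma autlocus_D2 : autlocus 3 ('D_(4%N))%G = locusK1 `|` locusK2.
Proof.
apply/seteqP; split=> m; last first.
  move=> [[a _ [f fE ->]]|[a _ [f fE ->]]]; apply: dihedral4_autlocus; rewrite fE.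
  - by have [s [_ _ _ h]] := pair2_involution a a; exists (-1 * s).
  - by have [s [_ _ _ h]] := pair2_swap_involution a; exists (1 * s).
  - by have [[s [_ _ _ h]] _] := pairK2_involution a; exists (-1 * s).
  - by have [_ [s [_ _ _ h]]] := pairK2_involution a; exists (-1 * s).
move=> /autlocus_matrices[f [rho [-> hrho rhoM rho1]]].
have [[x y] [_ xG ox yG] [oy xy]] := @generators_2dihedral _ ('D_(4%N))%G 2 isT (isog_refl _).
have {}yG : y \in ('D_(4%N))%G /\ y != x.
  move: yG; rewrite inE => /andP[yx ->]; split=> //.
  by apply: contra yx => /eqP ->; apply: cycle_id.
move: yG => [yG yx].
have sq z : z \in ('D_(4%N))%G -> #[z]%g = 2 -> exists s, [/\ s != 0, (rho z : 'M_2) *m rho z = s%:M & forall k, (rho z : 'M_2) <> k%:M].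
  move=> zG oz; have [c c0 e] := rhoM z z zG zG.
  (* [rho] is multiplicative only up to scalars, so even the image of the identity has to be shown
     to be a scalar matrix. *)
  have [c1 c10 e1] := rhoM 1%g 1%g (group1 _) (group1 _).
  have u1 := GL2_unit (rho 1%g).
  have r1 : (rho 1%g : 'M_2) = (c1^-1)%:M.
    apply: (can_inj (mulKmx u1)); rewrite scalar_mxC mul_scalar_mx.
    by apply: (scalerI c10); rewrite -e1 mulg1 scalerA mulfV // scale1r.
  have zz : (z * z = 1)%g by rewrite -[RHS](expg_order z) oz expgS expg1.
  exists (c^-1 * c1^-1); split; first by rewrite mulf_neq0 ?invr_eq0.
    by apply: (scalerI c0); rewrite -e zz r1 scale_scalar_mx mulrA divff // mul1r.
  by move=> k ek; have := rho1 z zG (ex_intro _ k ek) => z1; move: oz; rewrite z1 order1.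
have [s [s0 AA nA]] := sq x xG ox; have [t [t0 BB nB]] := sq y yG oy.
have cxy : (x * y = y * x)%g.
  rewrite conjgC xy; congr (_ * _)%g; apply/eqP; rewrite eq_invg_mul.
  by rewrite -(expg_order x) ox expgS expg1.
have [a a0 fA] := hrho x xG; have [b b0 fB] := hrho y yG.
have [e e1 iA] := order2_involution (GL2_unit _) fA AA nA.
have [e' e1' iB] := order2_involution (GL2_unit _) fB BB nB.
have AB : (rho x : 'M_2) *m rho y = - (rho y *m rho x).
  have [c c0 ec] := rhoM x y xG yG; have [c' c'0 ec'] := rhoM y x yG xG.
  apply: (@proj_commute _ _ s t (c' / c)) => //; last first.
    by apply: (scalerI c0); rewrite -ec scalerA mulrCA divff // mulr1 -ec' cxy.
  move=> k ek.
  have : (x * y = 1)%g.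
    apply: rho1; first exact: groupM.
    by exists (c * (k * s)); rewrite ec ek -scalemxAr AA !scale_scalar_mx.
  move/eqP; rewrite -eq_invg_mul eq_sym => /eqP yE; move/eqP: yx; apply; rewrite yE.
  by apply/eqP; rewrite eq_invg_mul -(expg_order x) ox expgS expg1.
have iAB := involution_mul iA iB AB.
have ABA : (rho x : 'M_2) *m rho y *m rho x = - (rho x *m (rho x *m rho y)).
  by rewrite -mulmxA [in RHS]AB mulmxN opprK.
(* The three involutions have types e, e' and - e e'. Unless e = e' = -1, two of them have opposite
   types and the class lies on the first curve. *)
case: e1 iA iAB => -> iA iAB; case: e1' iB iAB => -> iB iAB.
- by left; apply/locusK1P; exists (rho x *m rho y), (rho x); rewrite mulr1 in iAB.
- by left; apply/locusK1P; exists (rho y), (rho x); rewrite AB opprK.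
- by left; apply/locusK1P; exists (rho x), (rho y).
- by right; apply/locusK2P; exists (rho x), (rho y).
Qed.

Definition tetra_class : Moduli 3 := moduli_of (pair3 (-3)).

Lemma locus3_involution (f : endo_lift 3) A e : locus3 (moduli_class f) -> involution e f A ->
  moduli_class f = tetra_class.
Proof.
move=> [a /= a0 [g gE fg]] iA; have [h uh H] := involution_transport fg.
have := H _ _ iA; rewrite gE => /(pair3_involution_eq a0) aE; rewrite fg.
have h3 : is_endo 3 (pair3 (-3)) by apply: pair3_endo; rewrite oppr_eq0 pnatr_eq0.
by apply/(moduli_ofP _ h3); exists g; rewrite ?gE ?aE.
Qed.

Lemma tetra_class_pair : class_of_pair (pair3 (-3)) tetra_class.
Proof.
have h3 : is_endo 3 (pair3 (-3)) by apply: pair3_endo; rewrite oppr_eq0 pnatr_eq0.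
exact/(moduli_ofP _ h3).
Qed.

Lemma locus3_tetra : locus3 `&` (locusS1 `|` locusS2) = [set tetra_class].
Proof.
apply/seteqP; split=> [m|_ ->].
  have [f ->] := moduli_class_surj m.
  by move=> [h3 [/locusS1P[A]|/locusS2P[A]]]; apply: locus3_involution h3.
have cl := tetra_class_pair; split; first by exists (-3) => //=; rewrite oppr_eq0 pnatr_eq0.
move: cl => [f fE ->]; right; apply/locusS2P; exists tetra_mat; rewrite fE.
exact: tetra_involution.
Qed.

(** Cauchy's theorem gives elements of orders 2 and 3, which already place the class in the
    one-point intersection of [locus3_tetra]. *)
Lemma autlocus_A4 : autlocus 3 (Alt_group 'I_4) = [set tetra_class].
Proof.
apply/seteqP; split=> [m h|_ ->].
  have cA : #|Alt_group 'I_4| = 12%N.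
    by apply/eqP; rewrite -(@eqn_pmul2l 2) // card_Alt ?card_ord.
  have [x xG ox] : {x | x \in Alt_group 'I_4 & #[x]%g = 2%N} by apply: Cauchy => //; rewrite cA.
  have [y yG oy] : {y | y \in Alt_group 'I_4 & #[y]%g = 3%N} by apply: Cauchy => //; rewrite cA.
  rewrite -locus3_tetra -autlocus_C3 -autlocus_C2; split; last exact: autlocus_order h xG ox.
  exact: autlocus_order h yG oy.
have [f fE ->] := tetra_class_pair; have [ze [ze3 ze1]] := primitive3.
exact: (tetrahedral_autlocus fE ze3 ze1).
Qed.

Lemma closed_tetra : closed [set tetra_class].
Proof.
rewrite -locus3_tetra; apply: closedI; first by have [] := irreducible_closed3.
apply: closedU; first by have [] := irreducible_closedS1.
by have [] := irreducible_closedS2.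
Qed.

Lemma irreducible_curve3 : irreducible_curve locus3.
Proof.
have [ze [ze3 ze1]] := primitive3.
split; first exact: irreducible_closed3.
split; last by rewrite locus3E; apply: curve_no_chain phi3_continuous (fun S => @phi3_closed S ze ze3 ze1).
apply: has_chain1 closed_tetra irreducible_closed3 _; rewrite -locus3_tetra; split=> [m []//|h].
(* By [pair3_involution_eq] the member a = 1 has no involution, as 1 differs from -3; it shows that
   the curve is more than the point. *)
have e1 : is_endo 3 (pair3 1) by apply: pair3_endo; rewrite oner_neq0.
have [|_ S] := h (moduli_class (mk_lift e1)).
  by exists 1; [exact: oner_neq0|exists (mk_lift e1)].
have [B [e iB]] : exists B e, involution e (pair3 1) B.
  by move: S => [/locusS1P[B iB]|/locusS2P[B iB]]; exists B; [exists 1|exists (-1)].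
have /eqP := pair3_involution_eq (oner_neq0 _) iB.
by rewrite -subr_eq0 opprK (_ : 1 + 3 = 4) ?pnatr_eq0 //; ring.
Qed.


(* 'D_(2n) is the dihedral group of order 2n; z = X / Y. *)
Theorem theorem1p2 :
  let A_C2 := autlocus 3 [set: 'Z_2]%G in
  let A_C3 := autlocus 3 [set: 'Z_3]%G in
  let A_C4 := autlocus 3 [set: 'Z_4]%G in
  let A_D2 := autlocus 3 ('D_(4%N))%G in
  let A_D4 := autlocus 3 ('D_(8%N))%G in
  let A_A4 := autlocus 3 (Alt_group 'I_4) in
  (A_C4 = A_D4 /\
   exists2 p : Moduli 3, A_C4 = [set p] & class_of_pair (Y ^+ 3, X ^+ 3) p) /\
  ((exists2 q : Moduli 3, A_A4 = [set q] &
      class_of_pair (X ^+ 3 - 3 *: Y ^+ 3, (- 3) *: (X ^+ 2 * Y)) q) /\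
   A_A4 = A_C2 `&` A_C3) /\
  (irreducible_curve A_C3 /\
   given_by A_C3 [set a : algC | a != 0]
     (fun a => (X ^+ 3 + a *: Y ^+ 3, a *: (X ^+ 2 * Y)))) /\
  exists K1 K2 : set (Moduli 3),
    ([/\ irreducible_curve K1 /\
         given_by K1 [set a : algC | a != 1 /\ a != - 1]
           (fun a => (a *: (X ^+ 2 * Y) + Y ^+ 3, X ^+ 3 + a *: (X * Y ^+ 2))),
         irreducible_curve K2 /\
         given_by K2 [set a : algC | a != 1 /\ a != - 1]
           (fun a => (a *: (X ^+ 2 * Y) - Y ^+ 3, X ^+ 3 - a *: (X * Y ^+ 2))),
         K1 <> K2,
         A_D2 = K1 `|` K2
       & [/\ exists p : Moduli 3, K1 `&` K2 = [set p],
             K1 `&` K2 = A_D4 & K1 `&` K2 = A_C4]]) /\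
    exists S1 S2 : set (Moduli 3),
      [/\ irreducible_surface S1 /\
          given_by S1 [set ab : algC * algC | ab.1 * ab.2 != 1]
            (fun ab => (X ^+ 3 + ab.1 *: (X * Y ^+ 2),
                        ab.2 *: (X ^+ 2 * Y) + Y ^+ 3)),
          irreducible_surface S2 /\
          given_by S2 [set ab : algC * algC | ab.1 * ab.2 != 1]
            (fun ab => (ab.1 *: (X ^+ 2 * Y) + Y ^+ 3,
                        X ^+ 3 + ab.2 *: (X * Y ^+ 2))),
          S1 <> S2,
          A_C2 = S1 `|` S2
        & S1 `&` S2 = K1].
Proof.
set A_C2 := autlocus _ _; set A_C3 := autlocus _ _; set A_C4 := autlocus _ _.
set A_D2 := autlocus _ _; set A_D4 := autlocus _ _; set A_A4 := autlocus _ _ => /=.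
have p0 : (Y ^+ 3, X ^+ 3) = pair2 (0, 0) by rewrite /pair2 /= !scale0r add0r addr0.
have q0 : (X ^+ 3 - 3 *: Y ^+ 3, (- 3) *: (X ^+ 2 * Y)) = pair3 (-3) by congr pair; rewrite scaleNr.
have hp : is_endo 3 (pair2 (0, 0)) by apply: pair2_endo; rewrite mul0r eq_sym oner_neq0.
split; first split.
- by rewrite /A_C4 autlocus_C4 /A_D4 autlocus_D4.
- exists (moduli_of (pair2 (0, 0))); first by rewrite /A_C4 autlocus_C4 locus4_singleton.
  by rewrite p0; apply/(moduli_ofP _ hp).
split; first split.
- by exists tetra_class; [exact: autlocus_A4|rewrite q0; exact: tetra_class_pair].
- by rewrite /A_A4 autlocus_A4 /A_C2 autlocus_C2 /A_C3 autlocus_C3 setIC locus3_tetra.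
split; first by rewrite /A_C3 autlocus_C3; split; [exact: irreducible_curve3|split=> // a; exact: pair3_endo].
exists locusK1, locusK2; split.
  split.
  - split; first exact: irreducible_curveK1.
    by split=> // a /sqr_neq1 a2; apply: pair2_endo; rewrite -expr2.
  - split; first exact: irreducible_curveK2.
    by split=> // a /sqr_neq1; apply: pairK2_endo.
  - exact: locusK1_neqK2.
  - exact: autlocus_D2.
  - by rewrite locusK12 /A_D4 autlocus_D4 /A_C4 autlocus_C4; split=> //; exists (moduli_of (pair2 (0, 0))); apply: locus4_singleton.
exists locusS1, locusS2; split.
- split; first exact: irreducible_surfaceS1.
  by split=> // -[a b]; apply: pair1_endo.
- split; first exact: irreducible_surfaceS2.
  by split=> // -[a b]; apply: pair2_endo.
- exact: locusS1_neqS2.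
- exact: autlocus_C2.
- exact: locusS12.
Qed.
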